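(* A Legendrian curve $\gamma:I\to\mathcal S$ is critical for the total strain functional if and only if its stress density $\mathtt t$ vanishes identically on $I$. Moreover, a Legendrian curve with $\mathtt t\equiv0$ is either a cycle ($a\equiv0$ on $I$) or generic ($a(t)\neq0$ for all $t\in I$).
   Context: Let $\mathbb C^{2,1}$ denote $\mathbb C^3$ with the pseudo-Hermitian form $\langle z,w\rangle=i(\bar z^1w^3-\bar z^3w^1)+\bar z^2w^2$ (conjugate-linear in the first slot); $\mathcal S=\{[z]\in\mathbb{CP}^2:\langle z,z\rangle=0\}$ with contact distribution $\ker\zeta$, $\zeta=-\frac{i}{\bar z^tz}\langle z,dz\rangle|_{T\mathcal S}$. A Legendrian curve is a smooth immersion $\gamma:I\to\mathcal S$ ($I$ an open interval) tangent to the contact distribution. A normalized lift is a smooth $\Gamma:I\to\mathbb C^3\setminus\{0\}$ with $\gamma=[\Gamma]$ and $\det(\Gamma,\Gamma',\Gamma'')=i$ (exists, unique up to a cube root of unity). The Fubini densities are $a=\mathrm{Im}\langle\Gamma''',\Gamma''\rangle$, $b=\frac12\langle\Gamma'',\Gamma''\rangle$, and the strain density is $\mathtt s=\sqrt[3]{|a|}$. $\gamma$ is a cycle if $a\equiv0$ and generic if $a$ never vanishes. The stress density is $$\begin{aligned}\mathtt t=&\tfrac{4400}{81}aa'^3a''+a^2\big(-\tfrac{400}{27}ba'^3-\tfrac{200}{9}a'a''^2-\tfrac{400}{27}a'^2a'''\big)+a^3\big(\tfrac{25}{3}a'^2b'+\tfrac{50}{3}ba'a''+\tfrac{50}{9}a''a'''+\tfrac{25}{9}a'a^{(4)}\big)\\&+a^4\big(-\tfrac{16}{3}b^2a'-5b'a''-3a'b''-\tfrac{10}{3}ba'''-\tfrac13a^{(5)}\big)+a^5\big(8bb'+b'''\big)-\tfrac{6160}{243}a'^5.\end{aligned}$$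 An admissible variation of $\gamma$ is a smooth map $\mathbf g:I\times(-\epsilon,\epsilon)\to\mathcal S$ such that $\mathbf g(t,0)=\gamma(t)$; each $g_\tau=\mathbf g(\cdot,\tau)$ is a Legendrian curve; the variational vector field $t\mapsto \mathbf g_*|_{(t,0)}(\partial_\tau)$ has compact support $K_{\mathbf g}$; and, with $\mathtt s_\tau$ the strain density of $g_\tau$, the function $\mathfrak S_{\mathbf g}(\tau)=\int_{K_{\mathbf g}}\mathtt s_\tau\,dt$ is differentiable at $\tau=0$. $\gamma$ is critical for the total strain functional if $\mathfrak S_{\mathbf g}'(0)=0$ for every admissible variation $\mathbf g$. *)

(* Defs.v *)
From HB Require Import structures.
From mathcomp Require Import all_boot all_order all_algebra.
From mathcomp Require Import all_classical all_reals all_analysis.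
From mathcomp Require Import complex.

Set Implicit Arguments.
Unset Strict Implicit.
Unset Printing Implicit Defensive.

Import Order.TTheory GRing.Theory Num.Theory.
Import numFieldNormedType.Exports.

Local Open Scope classical_set_scope.
Local Open Scope ring_scope.

Section Legendrian.
Variable R : realType.

Local Notation C := (complex R).
Definition V3 := (C * C * C)%type.
Definition c1 (z : V3) : C := z.1.1.
Definition c2 (z : V3) : C := z.1.2.
Definition c3 (z : V3) : C := z.2.
Definition mkV3 (x y z : C) : V3 := (x, y, z).
Definition scaleV3 (l : C) (z : V3) : V3 := mkV3 (l * c1 z) (l * c2 z) (l * c3 z).
Definition iC : C := Complex 0 1.

Definition herm (z w : V3) : C :=
  iC * (conjc (c1 z) * c3 w - conjc (c3 z) * c1 w) + conjc (c2 z) * c2 w.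

Definition det3 (u v w : V3) : C :=
  c1 u * (c2 v * c3 w - c3 v * c2 w)
  - c1 v * (c2 u * c3 w - c3 u * c2 w)
  + c1 w * (c2 u * c3 v - c3 u * c2 v).

Definition nonzeroV3 (z : V3) : Prop := z <> mkV3 0 0 0.

Definition proj_eq (z w : V3) : Prop := exists l : C, l != 0 /\ z = scaleV3 l w.
Definition in_line (w z : V3) : Prop := exists l : C, w = scaleV3 l z.

Definition oitv (a b : \bar R) : set R := [set t : R | (a < t%:E)%E /\ (t%:E < b)%E].

Definition smooth1 (f : R -> R) (I : set R) : Prop :=
  forall (n : nat) (x : R), I x -> derivable (derive1n n f) x 1.

Definition coords (z : V3) : seq R :=
  [:: complex.Re (c1 z); complex.Im (c1 z); complex.Re (c2 z); complex.Im (c2 z); complex.Re (c3 z); complex.Im (c3 z)].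
Definition coord (k : nat) (z : V3) : R := nth 0 (coords z) k.

Definition smoothV (G : R -> V3) (I : set R) : Prop :=
  forall k : nat, (k < 6)%N -> smooth1 (fun t => coord k (G t)) I.

Definition dC (h : R -> C) (t : R) : C :=
  Complex (derive1 (fun s => complex.Re (h s)) t) (derive1 (fun s => complex.Im (h s)) t).
Definition dV (G : R -> V3) (t : R) : V3 :=
  mkV3 (dC (fun s => c1 (G s)) t) (dC (fun s => c2 (G s)) t) (dC (fun s => c3 (G s)) t).
Definition dVn (n : nat) (G : R -> V3) : R -> V3 := iter n dV G.

(* Legendrian curve gamma = [Gamma] : I -> S, given by a smooth lift Gamma *)
Definition legendrian_lift (I : set R) (Gam : R -> V3) : Prop :=
  smoothV Gam I /\
  forall t, I t ->
    [/\ nonzeroV3 (Gam t),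
        herm (Gam t) (Gam t) = 0,              (* gamma(t) in S *)
        herm (Gam t) (dV Gam t) = 0            (* tangent to ker zeta *)
      & ~ in_line (dV Gam t) (Gam t)].          (* immersion *)

Definition normalized_lift (I : set R) (Gam N : R -> V3) : Prop :=
  smoothV N I /\
  forall t, I t -> proj_eq (N t) (Gam t) /\ det3 (N t) (dV N t) (dVn 2 N t) = iC.

Definition fub_a (N : R -> V3) (t : R) : R := complex.Im (herm (dVn 3 N t) (dVn 2 N t)).
Definition fub_b (N : R -> V3) (t : R) : R := complex.Re (herm (dVn 2 N t) (dVn 2 N t)) / 2.

Definition strain_density (I : set R) (Gam : R -> V3) (t : R) : R :=
  match pselect (exists N, normalized_lift I Gam N) with
  | left H => (`| fub_a (proj1_sig (cid H)) t |) `^ (3^-1)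
  | right _ => 0
  end.

Definition stress (N : R -> V3) (t : R) : R :=
  let a := fub_a N t in
  let a1 := derive1n 1 (fub_a N) t in
  let a2 := derive1n 2 (fub_a N) t in
  let a3 := derive1n 3 (fub_a N) t in
  let a4 := derive1n 4 (fub_a N) t in
  let a5 := derive1n 5 (fub_a N) t in
  let b := fub_b N t in
  let b1 := derive1n 1 (fub_b N) t in
  let b2 := derive1n 2 (fub_b N) t in
  let b3 := derive1n 3 (fub_b N) t in
  (4400/81) * a * a1 ^+ 3 * a2
  + a ^+ 2 * (- (400/27) * b * a1 ^+ 3 - (200/9) * a1 * a2 ^+ 2 - (400/27) * a1 ^+ 2 * a3)
  + a ^+ 3 * ((25/3) * a1 ^+ 2 * b1 + (50/3) * b * a1 * a2 + (50/9) * a2 * a3 + (25/9) * a1 * a4)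
  + a ^+ 4 * (- (16/3) * b ^+ 2 * a1 - 5 * b1 * a2 - 3 * a1 * b2 - (10/3) * b * a3 - (1/3) * a5)
  + a ^+ 5 * (8 * b * b1 + b3)
  - (6160/243) * a1 ^+ 5.

Definition dpart (dir : bool) (f : R -> R -> R) : R -> R -> R :=
  if dir then (fun t tau => derive1 (fun s => f t s) tau)
  else (fun t tau => derive1 (fun s => f s tau) t).
Fixpoint pds (ds : seq bool) (f : R -> R -> R) : R -> R -> R :=
  if ds is d :: ds' then dpart d (pds ds' f) else f.

Definition smooth2 (f : R -> R -> R) (U : set (R * R)) : Prop :=
  forall (ds : seq bool) (p : R * R), U p ->
    [/\ {for p, continuous (fun q : R * R => pds ds f q.1 q.2)},
        derivable (fun s => pds ds f s p.2) p.1 1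
      & derivable (fun s => pds ds f p.1 s) p.2 1].

Definition smoothV2 (G : R -> R -> V3) (U : set (R * R)) : Prop :=
  forall k : nat, (k < 6)%N -> smooth2 (fun t tau => coord k (G t tau)) U.

(* variational vector field at (t,0): image of d/dtau under the projection;
   it vanishes iff dG/dtau(t,0) lies in the complex line C G(t,0) *)
Definition dtauV (G : R -> R -> V3) (t tau : R) : V3 := dV (fun s => G t s) tau.
Definition var_field_nonzero_set (I : set R) (G : R -> R -> V3) : set R :=
  [set t | I t /\ ~ in_line (dtauV G t 0) (G t 0)].
Definition var_support (I : set R) (G : R -> R -> V3) : set R :=
  closure (var_field_nonzero_set I G).

Definition strain_functional (I : set R) (G : R -> R -> V3) (tau : R) : R :=
  (\int[lebesgue_measure]_(t in var_support I G) strain_density I (fun s => G s tau) t)%R.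

Definition admissible_variation (I : set R) (Gam : R -> V3)
    (G : R -> R -> V3) (eps : R) : Prop :=
  0 < eps /\
  smoothV2 G [set p | I p.1 /\ `|p.2| < eps] /\
  (forall t, I t -> proj_eq (G t 0) (Gam t)) /\
  (forall tau, `|tau| < eps -> legendrian_lift I (fun t => G t tau)) /\
  (compact (var_support I G) /\ var_support I G `<=` I) /\
  derivable (strain_functional I G) 0 1.

Definition strain_critical (I : set R) (Gam : R -> V3) : Prop :=
  forall (G : R -> R -> V3) (eps : R),
    admissible_variation I Gam G eps -> derive1 (strain_functional I G) 0 = 0.

End Legendrian.

(* Main.v *)
(* Let G be a lift of a Legendrian curve or of a family of such curves, q = <G', G'>, and let D
   be the connection d/dt + k on lifts which preserves <,>/q and makes DG and DDG orthogonal.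
   The frame G, DG, DDG is adapted to the Hermitian form, and its structure equation
   DDDG = p G - 2b DG has gauge invariant coefficients, where Im p and b are the Fubini
   densities a and b, since k = 0 for normalized lifts. Differentiating the structure equation
   in the deformation parameter s expresses the variation of a by the height v = <G, dG/ds>/q
   and its derivatives, and an integration by parts gives
   18 d/ds |a|^(1/3) = dW/dt + 2 |a|^(1/3) a^(-6) t Im v, with t the stress density.

   Where a does not vanish, t = 0 therefore makes the total strain stationary; on a cycle the
   total strain has its minimum 0. Conversely, if t does not vanish at some point, then near a
   point where moreover a and the first homogeneous coordinate do not vanish the curve can be
   deformed, in the Heisenberg chart, with a nonnegative height of small support, and the total
   strain is not stationary.

   For the dichotomy put m = a'/(3a) and B = |a|^(-2/3) (2b - 2m' + m^2) on an interval where a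
   does not vanish. In the parameter u with du = |a|^(1/3) dt, t = 0 reads B_uuu + 4 B B_u = 0
   and has the first integrals k = 2 B_uu + 4 B^2 and 3 B_u^2 + 4 B^3 - 3 k B, whence B is
   bounded above. Hence m' is bounded below, and log |a| cannot tend to -oo at an end of the
   interval. *)
Require Import Defs.
From HB Require Import structures.
From mathcomp Require Import all_boot all_order all_algebra.
From mathcomp Require Import all_classical all_reals all_analysis.
From mathcomp Require Import complex.
From mathcomp Require Import ring lra.
Import Order.TTheory GRing.Theory Num.Theory.
Import numFieldNormedType.Exports.
Set Implicit Arguments.
Unset Strict Implicit.
Unset Printing Implicit Defensive.
Local Open Scope classical_set_scope.
Local Open Scope ring_scope.

Local Notation Re := complex.Re.
Local Notation Im := complex.Im.

(** * Smooth functions of one and two variables *)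

(** A normalized lift is determined only up to a cube root of unity, and [strain_density] picks one
    for each curve separately, so in a family normalized lifts carry no smooth dependence on the
    parameter. Hence every invariant is computed from the given smooth lift, through a connection
    compatible with changes of lift, and is compared with a normalized lift on one curve at a time.

    The computations are polynomial identities in two derivatives and a conjugation. They are
    carried out in an abstract commutative ring with these operations, where [ring] decides them;
    smooth complex functions on an open set, extended by 0, form such a ring.

    Two features of the definitions shape the analysis. The functional integrates over the support
    K, an arbitrary compact set; off K the variation at parameter 0 lies in the line of the lift, so
    the derivative of the strain vanishes there and K can be enlarged to a segment. And the cube
    root is not differentiable at 0, so the first variation is used only where a does not vanish;
    therefore the dichotomy precedes the proof that t = 0 is sufficient. *)

Section Calculus.
Variable R : realType.
Implicit Types (f g : R -> R -> R) (U : set (R * R)) (I : set R) (p : R * R).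

Definition eqon U f g := forall p, U p -> f p.1 p.2 = g p.1 p.2.

Lemma open_near1 U p : open U -> U p -> \forall s \near p.1, U (s, p.2).
Proof.
move=> oU Up; have : nbhs p U by exact: open_nbhs_nbhs.
case: p Up => x y /= Up.
have c : (fun s : R => (s, y)) s @[s --> x] --> (x, y).
  exact: (cvg_pair cvg_id (cvg_cst y)).
by move=> H; exact: (c U H).
Qed.

Lemma open_near2 U p : open U -> U p -> \forall s \near p.2, U (p.1, s).
Proof.
move=> oU Up; have : nbhs p U by exact: open_nbhs_nbhs.
case: p Up => x y /= Up.
have c : (fun s : R => (x, s)) s @[s --> y] --> (x, y).
  exact: (cvg_pair (cvg_cst x) cvg_id).
by move=> H; exact: (c U H).
Qed.

Definition reg1 f p := [/\ {for p, continuous (fun q : R * R => f q.1 q.2)},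
  derivable (fun s => f s p.2) p.1 1 & derivable (fun s => f p.1 s) p.2 1].

Lemma reg1_eqon U f g p : open U -> U p -> eqon U f g -> reg1 f p -> reg1 g p.
Proof.
move=> oU Up fg [c d1 d2]; split.
- have : \forall q \near p, f q.1 q.2 = g q.1 q.2.
    by apply: filterS (open_nbhs_nbhs (conj oU Up)) => q /fg.
  by move=> H; rewrite /prop_for /continuous_at -(fg _ Up);
     apply: cvg_trans c; apply: near_eq_cvg; apply: filterS H.
- apply: near_eq_derivable d1.
  by apply: filterS (open_near1 oU Up) => s; exact: (fg (s, p.2)).
- apply: near_eq_derivable d2.
  by apply: filterS (open_near2 oU Up) => s; exact: (fg (p.1, s)).
Qed.

Lemma eqon_dpart U f g d : open U -> eqon U f g -> eqon U (dpart d f) (dpart d g).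
Proof.
move=> oU fg p Up; rewrite /dpart; case: d; rewrite !derive1E;
  apply: near_eq_derive.
- by apply: filterS (open_near2 oU Up) => s; exact: (fg (p.1, s)).
- by apply: filterS (open_near1 oU Up) => s; exact: (fg (s, p.2)).
Qed.

(* One-constructor wrappers: a rigid head symbol keeps unification from unfolding
   the iterated derivatives. *)
Record sm1 I (f : R -> R) : Prop := Sm1 { sm1P : smooth1 f I }.
Record sm2 U f : Prop := Sm2 { sm2P : smooth2 f U }.

(** The class [S] acts as an invariant: being stable under both partial derivatives up to equality
    on [U], it contains, up to this equality, all iterated partial derivatives of its members.
    Smoothness of products and compositions then needs no formula for higher derivatives. *)
Lemma smooth2_coind U (S : (R -> R -> R) -> Prop) : open U ->
  (forall f p, S f -> U p -> reg1 f p) ->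
  (forall f d, S f -> exists2 g, S g & eqon U (dpart d f) g) ->
  forall f, S f -> sm2 U f.
Proof.
move=> oU S1 S2 f Sf; split=> ds p Up.
suff [g Sg fg] : exists2 g, S g & eqon U (pds ds f) g.
  by apply: (@reg1_eqon U g) => //; [move=> q Uq; rewrite fg|exact: S1].
elim: ds => [|d ds [g Sg fg]] /=; first by exists f.
have [h Sh gh] := S2 _ d Sg; exists h => // q Uq.
by rewrite (eqon_dpart d oU fg)// gh.
Qed.

Lemma smooth1_coind I (S : (R -> R) -> Prop) : open I ->
  (forall (f : R -> R) x, S f -> I x -> derivable f x 1) ->
  (forall f : R -> R, S f -> exists2 g : R -> R, S g & forall x, I x -> derive1 f x = g x) ->
  forall f : R -> R, S f -> sm1 I f.
Proof.
move=> oI S1 S2 f Sf; split=> n.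
have nb (h1 h2 : R -> R) x : I x -> (forall x, I x -> h1 x = h2 x) ->
    \forall s \near x, h1 s = h2 s.
  by move=> Ix H; apply: filterS (open_nbhs_nbhs (conj oI Ix)) => y /H.
suff [g Sg fg] : exists2 g : R -> R, S g & forall x, I x -> derive1n n f x = g x.
  move=> x Ix; apply: near_eq_derivable (S1 _ _ Sg Ix).
  by apply: nb => // y Iy; rewrite fg.
elim: n => [|n [g Sg fg]] /=; first by exists f.
have [h Sh gh] := S2 _ Sg; exists h => // x Ix.
rewrite -gh// !derive1E; apply: near_eq_derive.
exact: nb.
Qed.

Lemma smooth2_reg1 U f p : sm2 U f -> U p -> reg1 f p.
Proof. by case=> /(_ [::] p). Qed.

Lemma smooth2_dpart U f d : sm2 U f -> sm2 U (dpart d f).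
Proof.
case=> sf; split=> ds p /(sf (rcons ds d) p).
suff -> : pds (rcons ds d) f = pds ds (dpart d f) by [].
by elim: ds => //= e ds ->.
Qed.

Lemma smooth1_derivable I (f : R -> R) x : sm1 I f -> I x -> derivable f x 1.
Proof. by case=> /(_ 0%N x). Qed.

Lemma smooth1_derive1 I (f : R -> R) : sm1 I f -> sm1 I (derive1 f).
Proof. by case=> sf; split=> n x /(sf n.+1 x); rewrite derive1Sn. Qed.

Lemma smooth1_continuous I (f : R -> R) x : sm1 I f -> I x -> {for x, continuous f}.
Proof.
move=> sf Ix; apply: differentiable_continuous.
by apply/derivable1_diffP; exact: smooth1_derivable Ix.
Qed.

Lemma smooth1E I (f : R -> R) n x : sm1 I f -> I x -> derivable (derive1n n f) x 1.
Proof. by case=> sf; exact: sf. Qed.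

Lemma smooth2E U f ds p : sm2 U f -> U p -> reg1 (pds ds f) p.
Proof. by case=> sf; exact: sf. Qed.

Lemma smooth1_cst I (c : R) : sm1 I (fun _ => c).
Proof.
apply: Sm1 => n x Ix.
have [->|->] : derive1n n (fun _ : R => c) = cst c \/ derive1n n (fun _ : R => c) = cst 0.
- case: n; [by left|move=> n; right].
  elim: n => [|n IH]; first by apply/funext => y; rewrite /= derive1_cst.
  by rewrite derive1nS IH; apply/funext => y; rewrite derive1_cst.
- exact: derivable_cst.
- exact: derivable_cst.
Qed.

Lemma smooth2_lift I U (f : R -> R) : open U -> (forall p, U p -> I p.1) ->
  sm1 I f -> sm2 U (fun t _ => f t).
Proof.
move=> oU UI sf.
apply: (@smooth2_coind U (fun h => exists2 g : R -> R, sm1 I g & h = fun t _ => g t)) => //.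
- move=> _ p [g sg ->] Up; have Ip := UI _ Up; split => //=.
  + apply: (@continuous_comp _ _ _ (fun q : R * R => q.1) g); first exact: cvg_fst.
    exact: smooth1_continuous Ip.
  + exact: smooth1_derivable Ip.
- move=> _ [] [g sg ->]; rewrite /dpart.
  + exists (fun _ _ => 0); first by exists (fun _ => 0) => //; exact: smooth1_cst.
    by move=> p Up; rewrite derive1_cst.
  + exists (fun t _ => derive1 g t) => //.
    by exists (derive1 g) => //; exact: smooth1_derive1.
- by exists f.
Qed.

Lemma smooth2_liftr I U (f : R -> R) : open U -> (forall p, U p -> I p.2) ->
  sm1 I f -> sm2 U (fun _ t => f t).
Proof.
move=> oU UI sf.
apply: (@smooth2_coind U (fun h => exists2 g : R -> R, sm1 I g & h = fun _ t => g t)) => //.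
- move=> _ p [g sg ->] Up; have Ip := UI _ Up; split => //=.
  + apply: (@continuous_comp _ _ _ (fun q : R * R => q.2) g); first exact: cvg_snd.
    exact: smooth1_continuous Ip.
  + exact: smooth1_derivable Ip.
- move=> _ [] [g sg ->]; rewrite /dpart.
  + exists (fun _ t => derive1 g t) => //.
    by exists (derive1 g) => //; exact: smooth1_derive1.
  + exists (fun _ _ => 0); first by exists (fun _ => 0) => //; exact: smooth1_cst.
    by move=> p Up; rewrite derive1_cst.
- by exists f.
Qed.

Lemma smooth2_slice U f tau : sm2 U f ->
  sm1 [set t | U (t, tau)] (fun t => f t tau).
Proof.
have e n : derive1n n (fun t => f t tau) = fun t => pds (nseq n false) f t tau.
  by elim: n => //= n ->.
move=> sf; apply: Sm1 => n x Ux; rewrite e.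
by have [_ d _] := smooth2E (nseq n false) sf Ux.
Qed.

Lemma smooth2_cst U (c : R) : open U -> sm2 U (fun _ _ => c).
Proof.
by move=> oU; apply: (@smooth2_lift setT) => //; exact: smooth1_cst.
Qed.

Lemma derivable_comp1 (phi h : R -> R) x : derivable h x 1 ->
  derivable phi (h x) 1 -> derivable (fun s => phi (h s)) x 1.
Proof.
move=> /derivable1_diffP dh /derivable1_diffP dphi; apply/derivable1_diffP.
exact: (differentiable_comp dh dphi).
Qed.

Lemma derive1_comp1 (phi h : R -> R) x : derivable h x 1 -> derivable phi (h x) 1 ->
  derive1 (fun s => phi (h s)) x = derive1 phi (h x) * derive1 h x.
Proof. exact: derive1_comp. Qed.

(** Sums, products and compositions are closed off together, because the derivative of a product is
    a sum of products and that of a composition is a product. The joint closure is stable under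
    [dpart], so [smooth2_coind] applies to it. *)
Inductive smcl U : (R -> R -> R) -> Prop :=
| smcl_base f : sm2 U f -> smcl U f
| smcl_add f g : smcl U f -> smcl U g -> smcl U (fun t s => f t s + g t s)
| smcl_mul f g : smcl U f -> smcl U g -> smcl U (fun t s => f t s * g t s)
| smcl_comp phi V f : open V -> sm1 V phi -> (forall p, U p -> V (f p.1 p.2)) ->
    smcl U f -> smcl U (fun t s => phi (f t s)).

Lemma smcl_reg1 U f p : smcl U f -> U p -> reg1 f p.
Proof.
move=> cf Up; elim: cf => {f}.
- by move=> f sf; exact: smooth2_reg1 Up.
- move=> f g _ [c1 d1 e1] _ [c2 d2 e2]; split.
  + exact: (cvgD c1 c2).
  + exact: (derivableD d1 d2).
  + exact: (derivableD e1 e2).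
- move=> f g _ [c1 d1 e1] _ [c2 d2 e2]; split.
  + exact: (cvgM c1 c2).
  + exact: (derivableM d1 d2).
  + exact: (derivableM e1 e2).
- move=> phi V f oV sphi fV _ [c1 d1 e1]; have Vp := fV _ Up; split.
  + apply: (@continuous_comp _ _ _ (fun q : R * R => f q.1 q.2) phi) => //.
    exact: smooth1_continuous Vp.
  + exact: (derivable_comp1 d1 (smooth1_derivable sphi Vp)).
  + exact: (derivable_comp1 e1 (smooth1_derivable sphi Vp)).
Qed.

Lemma dpartD f g d p : reg1 f p -> reg1 g p ->
  dpart d (fun t s => f t s + g t s) p.1 p.2 = dpart d f p.1 p.2 + dpart d g p.1 p.2.
Proof.
by move=> [c1 d1 e1] [c2 d2 e2]; rewrite /dpart; case: d; rewrite !derive1E ?(deriveD e1 e2) ?(deriveD d1 d2).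
Qed.

Lemma dpartM f g d p : reg1 f p -> reg1 g p ->
  dpart d (fun t s => f t s * g t s) p.1 p.2 =
  f p.1 p.2 * dpart d g p.1 p.2 + g p.1 p.2 * dpart d f p.1 p.2.
Proof.
by move=> [c1 d1 e1] [c2 d2 e2]; rewrite /dpart; case: d; rewrite !derive1E ?(deriveM e1 e2) ?(deriveM d1 d2).
Qed.

Lemma dpart_comp (phi : R -> R) f d p : reg1 f p -> derivable phi (f p.1 p.2) 1 ->
  dpart d (fun t s => phi (f t s)) p.1 p.2 = derive1 phi (f p.1 p.2) * dpart d f p.1 p.2.
Proof.
move=> [c1 d1 e1] dp; rewrite /dpart; case: d.
  exact: (derive1_comp1 e1 dp).
exact: (derive1_comp1 d1 dp).
Qed.

Lemma smcl_dpart U f d : open U -> smcl U f -> exists2 g, smcl U g & eqon U (dpart d f) g.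
Proof.
move=> oU; elim => {f}.
- by move=> f sf; exists (dpart d f) => //; apply: smcl_base; exact: smooth2_dpart.
- move=> f g cf [f' cf' ff'] cg [g' cg' gg'].
  exists (fun t s => f' t s + g' t s); first exact: smcl_add.
  by move=> p Up; rewrite dpartD// ?ff' ?gg'//; exact: smcl_reg1 Up.
- move=> f g cf [f' cf' ff'] cg [g' cg' gg'].
  exists (fun t s => f t s * g' t s + g t s * f' t s).
    by apply: smcl_add; exact: smcl_mul.
  by move=> p Up; rewrite dpartM// ?ff' ?gg'//; exact: smcl_reg1 Up.
- move=> phi V f oV sphi fV cf [f' cf' ff'].
  exists (fun t s => derive1 phi (f t s) * f' t s).
    apply: smcl_mul => //; apply: (smcl_comp oV) => //; exact: smooth1_derive1.
  move=> p Up; rewrite dpart_comp// ?ff'//; first exact: smcl_reg1 Up.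
  by apply: smooth1_derivable; [exact: sphi|exact: fV].
Qed.

Lemma smcl_smooth2 U f : open U -> smcl U f -> sm2 U f.
Proof.
move=> oU; apply: (@smooth2_coind U (smcl U)) => //.
- by move=> ? ?; exact: smcl_reg1.
- by move=> ? ?; exact: smcl_dpart.
Qed.

Lemma smooth2D U f g : open U -> sm2 U f -> sm2 U g ->
  sm2 U (fun t s => f t s + g t s).
Proof. by move=> oU *; apply: smcl_smooth2 => //; apply: smcl_add; exact: smcl_base. Qed.

Lemma smooth2M U f g : open U -> sm2 U f -> sm2 U g ->
  sm2 U (fun t s => f t s * g t s).
Proof. by move=> oU *; apply: smcl_smooth2 => //; apply: smcl_mul; exact: smcl_base. Qed.

Lemma smooth2_comp U V (phi : R -> R) f : open U -> open V -> sm1 V phi ->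
  (forall p, U p -> V (f p.1 p.2)) -> sm2 U f -> sm2 U (fun t s => phi (f t s)).
Proof.
by move=> oU oV *; apply: smcl_smooth2 => //; apply: (smcl_comp oV) => //; exact: smcl_base.
Qed.

Lemma smooth2_eqon U f g : open U -> eqon U f g -> sm2 U f -> sm2 U g.
Proof.
move=> oU fg sf; apply: Sm2 => ds p Up; apply: (@reg1_eqon U (pds ds f)) (smooth2E ds sf Up) => //.
by elim: ds => //= d ds IH; exact: eqon_dpart.
Qed.

Lemma smooth2_sub U V f : (forall p, V p -> U p) -> sm2 U f -> sm2 V f.
Proof. by move=> VU sf; apply: Sm2 => ds p /VU; exact: smooth2E. Qed.

Lemma smooth2N U f : open U -> sm2 U f -> sm2 U (fun t s => - f t s).
Proof.
move=> oU sf; apply: (@smooth2_eqon U (fun t s => -1 * f t s)) => //.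
  by move=> p _; rewrite mulN1r.
by apply: smooth2M => //; exact: smooth2_cst.
Qed.

(* If the mixed partials differed at p, on small rectangles the double difference,
   computed by two mean value theorems in either order, would give a contradiction. *)
Lemma dpartC U f : open U -> sm2 U f ->
  eqon U (dpart false (dpart true f)) (dpart true (dpart false f)).
Proof.
move=> oU sf [x y] Uxy.
pose A := pds [:: false; true] f; pose B := pds [:: true; false] f.
change (A x y = B x y).
apply/eqP; rewrite -subr_eq0 -normr_le0; apply/ler_addgt0Pr => e e0; rewrite add0r.
have cA : {for (x, y), continuous (fun q : R * R => A q.1 q.2)}.
  by have [cA _ _] := smooth2E [:: false; true] sf Uxy.
have cB : {for (x, y), continuous (fun q : R * R => B q.1 q.2)}.
  by have [cB _ _] := smooth2E [:: true; false] sf Uxy.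
have EA z w : derive1 (fun s => dpart true f s w) z = A z w by [].
have EB z w : derive1 (fun s => dpart false f z s) w = B z w by [].
have dA z w : U (z, w) -> derivable (fun s => dpart true f s w) z 1.
  by move=> Uz; have [_ d1 _] := smooth2_reg1 (smooth2_dpart true sf) Uz.
have dB z w : U (z, w) -> derivable (fun s => dpart false f z s) w 1.
  by move=> Uz; have [_ _ d1] := smooth2_reg1 (smooth2_dpart false sf) Uz.
clearbody A B.
have e2 : 0 < e / 2 by lra.
have nA : \forall q \near (x, y), `|A x y - A q.1 q.2| < e / 2.
  by move/cvgrPdist_lt : cA; apply.
have nB : \forall q \near (x, y), `|B x y - B q.1 q.2| < e / 2.
  by move/cvgrPdist_lt : cB; apply.
have nU : \forall q \near (x, y), U q by exact: open_nbhs_nbhs.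
have [r r0 H] : exists2 r : R, 0 < r & forall q : R * R, `|q.1 - x| < r -> `|q.2 - y| < r ->
    [/\ U q, `|A x y - A q.1 q.2| < e / 2 & `|B x y - B q.1 q.2| < e / 2].
  have /nbhs_ballP[r /= r0 H] : nbhs (x, y) (U `&` [set q | `|A x y - A q.1 q.2| < e / 2] `&`
      [set q | `|B x y - B q.1 q.2| < e / 2]).
    by apply: filterI nB; exact: filterI.
  exists r => // q q1 q2.
  have bq : ball (x, y) r q by split; rewrite /ball /= distrC.
  by have [[Uq aq] bq'] := H _ bq; split.
pose h := r / 2; have h0 : 0 < h by rewrite /h; lra.
have inb (c z : R) : c <= z -> z <= c + h -> `|z - c| < r.
  move=> z1; rewrite /h => z2; rewrite ger0_norm ?subr_ge0//.
  by lra.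
clearbody h.
have mvt (g : R -> R) (c : R) : (forall z, c <= z <= c + h -> derivable g z 1) ->
    exists2 z, c < z < c + h & g (c + h) - g c = derive1 g z * h.
  move=> dg.
  have [z] : exists2 z, z \in `]c, c + h[%R & g (c + h) - g c = derive1 g z * (c + h - c).
    apply: MVT; first by rewrite ltrDl.
      move=> z; rewrite in_itv /= => /andP[z1 z2]; rewrite derive1E; apply/derivableP.
      by apply: dg; rewrite !ltW.
    apply: derivable_within_continuous => z; rewrite in_itv /= => zz; exact: dg.
  have -> : c + h - c = h by ring.
  by rewrite in_itv /= => zz ->; exists z.
pose D := f (x + h) (y + h) - f (x + h) y - f x (y + h) + f x y.
have [z1 [w1 [zz1 ww1 E1]]] : exists z w, [/\ x < z < x + h, y < w < y + h & D = B z w * h * h].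
  have [|z zz E] := mvt (fun s => f s (y + h) - f s y) x.
    move=> z /andP[z1 z2].
    have [Uz _ _] := H (z, y + h) (inb _ _ z1 z2) (inb _ _ (ltW (ltr_pwDr h0 (lexx y))) (lexx _)).
    have [Uz' _ _] := H (z, y) (inb _ _ z1 z2) (inb _ _ (lexx _) (ltW (ltr_pwDr h0 (lexx y)))).
    have [_ d1 _] := smooth2_reg1 sf Uz; have [_ d2 _] := smooth2_reg1 sf Uz'.
    exact: (derivableB d1 d2).
  move: (zz) => /andP[/ltW z1 /ltW z2].
  have [|w ww E'] := mvt (fun s => dpart false f z s) y.
    move=> w /andP[w1 w2].
    have [Uz _ _] := H (z, w) (inb _ _ z1 z2) (inb _ _ w1 w2).
    exact: dB.
  exists z, w; split => //.
  have -> : D = (f (x + h) (y + h) - f (x + h) y) - (f x (y + h) - f x y) by rewrite /D; ring.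
  rewrite E; congr (_ * _); rewrite -?EA -?EB -E'.
  have [Uz _ _] := H (z, y + h) (inb _ _ z1 z2) (inb _ _ (ltW (ltr_pwDr h0 (lexx y))) (lexx _)).
  have [Uz' _ _] := H (z, y) (inb _ _ z1 z2) (inb _ _ (lexx _) (ltW (ltr_pwDr h0 (lexx y)))).
  have [_ d1 _] := smooth2_reg1 sf Uz; have [_ d2 _] := smooth2_reg1 sf Uz'.
  by rewrite /dpart !derive1E (deriveB d1 d2).
have [z2 [w2 [zz2 ww2 E2]]] : exists z w, [/\ x < z < x + h, y < w < y + h & D = A z w * h * h].
  have [|w ww E] := mvt (fun s => f (x + h) s - f x s) y.
    move=> z /andP[z2 z3].
    have [Uz _ _] := H (x + h, z) (inb _ _ (ltW (ltr_pwDr h0 (lexx _))) (lexx _)) (inb _ _ z2 z3).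
    have [Uz' _ _] := H (x, z) (inb _ _ (lexx _) (ltW (ltr_pwDr h0 (lexx _)))) (inb _ _ z2 z3).
    have [_ _ d1] := smooth2_reg1 sf Uz; have [_ _ d2] := smooth2_reg1 sf Uz'.
    exact: (derivableB d1 d2).
  move: (ww) => /andP[/ltW z2 /ltW z3].
  have [|z zz E'] := mvt (fun s => dpart true f s w) x.
    move=> z /andP[v1 v2].
    have [Uz _ _] := H (z, w) (inb _ _ v1 v2) (inb _ _ z2 z3).
    exact: dA.
  exists z, w; split => //.
  have -> : D = (f (x + h) (y + h) - f x (y + h)) - (f (x + h) y - f x y) by rewrite /D; ring.
  rewrite E; congr (_ * _); rewrite -?EA -?EB -E'.
  have [Uz _ _] := H (x + h, w) (inb _ _ (ltW (ltr_pwDr h0 (lexx _))) (lexx _)) (inb _ _ z2 z3).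
  have [Uz' _ _] := H (x, w) (inb _ _ (lexx _) (ltW (ltr_pwDr h0 (lexx _)))) (inb _ _ z2 z3).
  have [_ _ d1] := smooth2_reg1 sf Uz; have [_ _ d2] := smooth2_reg1 sf Uz'.
  by rewrite /dpart !derive1E (deriveB d1 d2).
have AB : A z2 w2 = B z1 w1.
  have hn : h * h != 0 by rewrite mulf_neq0// gt_eqF.
  by apply: (mulIf hn); rewrite /= !mulrA -E2.
have [_ _ b1] : [/\ U (z1, w1), `|A x y - A z1 w1| < e / 2 & `|B x y - B z1 w1| < e / 2].
  by case/andP: zz1 => *; case/andP: ww1 => *; apply: (H (z1, w1)); apply: inb; apply: ltW.
have [_ a1 _] : [/\ U (z2, w2), `|A x y - A z2 w2| < e / 2 & `|B x y - B z2 w2| < e / 2].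
  by case/andP: zz2 => *; case/andP: ww2 => *; apply: (H (z2, w2)); apply: inb; apply: ltW.
have -> : A x y - B x y = (A x y - A z2 w2) - (B x y - B z1 w1) by rewrite AB; ring.
apply: le_trans (ler_normB _ _) _; lra.
Qed.

End Calculus.

(** * Smooth functions of one variable and primitives *)

Section OneVariable.
Variable R : realType.
Implicit Types (f g h : R -> R) (I J : set R) (a b : \bar R).

Lemma open_oitv a b : open (oitv a b).
Proof.
have -> : oitv a b = [set t : R | (a < t%:E)%E] `&` [set t | (t%:E < b)%E] by [].
by apply: openI; [exact: open_ereal_gt|exact: open_ereal_lt].
Qed.

Lemma oitv_between a b (x y t : R) : oitv a b x -> oitv a b y -> x <= t <= y -> oitv a b t.
Proof.
move=> [ax _] [_ yb] /andP[xt ty]; split.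
- by apply: lt_le_trans ax _; rewrite lee_fin.
- by apply: le_lt_trans yb; rewrite lee_fin.
Qed.

Lemma open_ball_sub I (x : R) : open I -> I x ->
  exists2 e : R, 0 < e & forall y, `|y - x| <= e -> I y.
Proof.
move=> oI Ix; have : nbhs x I by exact: open_nbhs_nbhs.
move=> /nbhs_ballP[e /= e0 H]; exists (e / 2); first by lra.
by move=> y ye; apply: H; rewrite /ball /= distrC; apply: le_lt_trans ye _; lra.
Qed.

Lemma sm1_eq I f g : open I -> (forall x, I x -> f x = g x) -> sm1 I f -> sm1 I g.
Proof.
move=> oI fg sf; apply: (@smooth1_coind _ I (fun h => exists2 k, sm1 I k & forall x, I x -> h x = k x)) => //.
- move=> h x [k sk hk] Ix; apply: near_eq_derivable (smooth1_derivable sk Ix).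
  by apply: filterS (open_nbhs_nbhs (conj oI Ix)) => y /hk.
- move=> h [k sk hk]; exists (derive1 k).
    by exists (derive1 k) => //; exact: smooth1_derive1.
  move=> x Ix; rewrite !derive1E; apply: near_eq_derive.
  by apply: filterS (open_nbhs_nbhs (conj oI Ix)) => y /hk.
- by exists f => // x Ix; rewrite fg.
Qed.

Lemma sm1_local I f : (forall x, I x -> exists2 J, J x & sm1 J f) -> sm1 I f.
Proof. by move=> H; split=> n x /H [J Jx sf]; exact: smooth1E Jx. Qed.

Lemma sm1_sub I J f : (forall x, J x -> I x) -> sm1 I f -> sm1 J f.
Proof. by move=> JI sf; apply: sm1_local => x /JI Ix; exists I. Qed.

Lemma sm1_prim I f g : (forall x, I x -> derivable f x 1) ->
  open I -> (forall x, I x -> derive1 f x = g x) -> sm1 I g -> sm1 I f.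
Proof.
move=> df oI fg sg.
have sf' : sm1 I (derive1 f) by apply: sm1_eq sg => // x Ix; rewrite fg.
split=> -[|n] x Ix; first exact: df.
by rewrite derive1Sn; exact: smooth1E Ix.
Qed.

(** The closure properties in one variable are read off from those in two variables, for functions
    constant in the second one. *)
Let lift I : set (R * R) := [set p | I p.1].
Let open_lift I : open I -> open (lift I).
Proof.
move=> oI; rewrite /lift -[X in open X]/((fun p : R * R => p.1) @^-1` I).
by apply: open_comp oI => p _; exact: cvg_fst.
Qed.
Let liftP I f : open I -> sm1 I f -> sm2 (lift I) (fun t _ => f t).
Proof. by move=> oI; apply: smooth2_lift => //; exact: open_lift. Qed.
Let liftK I f : sm2 (lift I) (fun t _ => f t) -> sm1 I f.
Proof. by move=> /(@smooth2_slice _ _ _ 0). Qed.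

Lemma sm1D I f g : open I -> sm1 I f -> sm1 I g -> sm1 I (fun x => f x + g x).
Proof.
move=> oI sf sg; apply: liftK.
exact: (smooth2D (open_lift oI) (liftP oI sf) (liftP oI sg)).
Qed.

Lemma sm1M I f g : open I -> sm1 I f -> sm1 I g -> sm1 I (fun x => f x * g x).
Proof.
move=> oI sf sg; apply: liftK.
exact: (smooth2M (open_lift oI) (liftP oI sf) (liftP oI sg)).
Qed.

Lemma sm1N I f : open I -> sm1 I f -> sm1 I (fun x => - f x).
Proof.
move=> oI sf; apply: liftK.
exact: (smooth2N (open_lift oI) (liftP oI sf)).
Qed.

Lemma sm1_comp I J (phi : R -> R) f : open I -> open J -> sm1 J phi ->
  (forall x, I x -> J (f x)) -> sm1 I f -> sm1 I (fun x => phi (f x)).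
Proof.
move=> oI oJ sphi fJ sf; apply: liftK.
apply: (smooth2_comp (open_lift oI) oJ sphi _ (liftP oI sf)) => p; exact: fJ.
Qed.

Lemma sm1_id : sm1 setT (@id R).
Proof.
apply: (@sm1_prim _ _ (fun _ => 1)).
- by move=> x _; exact: derivable_id.
- exact: openT.
- by move=> x _; exact: derive1_id.
- exact: smooth1_cst.
Qed.

(** The four functions +-cos and +-sin are permuted by the derivative. *)
Lemma sm1_trig : sm1 setT (@cos R) /\ sm1 setT (@sin R).
Proof.
pose S h := [\/ h = @cos R, h = (fun x => - sin x), h = (fun x => - cos x) | h = @sin R].
have dN (k : R -> R) x : derivable k x 1 -> derivable (fun x => - k x) x 1 /\
    derive1 (fun x => - k x) x = - derive1 k x.
  by move=> dk; split; [exact: (derivableN dk)|rewrite !derive1E (deriveN dk)].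
have dc x : derive1 (@cos R) x = - sin x by rewrite derive1E derive_val.
have dsn x : derive1 (@sin R) x = cos x by rewrite derive1E derive_val.
have SS f : S f -> sm1 setT f.
  apply: (@smooth1_coind _ setT S) => //; first exact: openT.
  - move=> h x [] -> _.
    + exact: derivable_cos.
    + by have [] := dN _ _ (@derivable_sin R x).
    + by have [] := dN _ _ (@derivable_cos R x).
    + exact: derivable_sin.
  - move=> h [] ->.
    + exists (fun x => - sin x); first exact: Or42.
      by move=> x _; exact: dc.
    + exists (fun x => - cos x); first exact: Or43.
      by move=> x _; have [_ ->] := dN _ _ (@derivable_sin R x); rewrite dsn.
    + exists (@sin R); first exact: Or44.
      by move=> x _; have [_ ->] := dN _ _ (@derivable_cos R x); rewrite dc opprK.
    + exists (@cos R); first exact: Or41.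
      by move=> x _; exact: dsn.
by split; apply: SS; [exact: Or41|exact: Or44].
Qed.

Lemma derivable_powR1 (r x : R) : 0 < x -> derivable (fun y => y `^ r) x 1.
Proof. by move=> x0; apply: derivable_powR; rewrite in_itv /= andbT. Qed.

Lemma derive1_powR (r x : R) : 0 < x -> derive1 (fun y => y `^ r) x = r * x `^ (r - 1).
Proof. by move=> x0; apply: powR_derive1; rewrite in_itv /= andbT. Qed.

(** The multiples c x^s, with all real exponents s, are stable under the derivative on the positive
    half line. *)
Lemma sm1_powR (r : R) : sm1 [set x : R | 0 < x] (fun x => x `^ r).
Proof.
apply: (@smooth1_coind _ _ (fun h => exists c s, h = fun x : R => c * x `^ s)).
- exact: open_gt.
- move=> _ x [c [s ->]] x0.
  have dc : derivable (fun _ : R => c) x 1 by exact: derivable_cst.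
  exact: (derivableM dc (@derivable_powR1 s x x0)).
- move=> _ [c [s ->]]; exists (fun x => (c * s) * x `^ (s - 1)).
    by exists (c * s), (s - 1).
  move=> x x0; have d := @derivable_powR1 s x x0.
  have dc : derivable (fun _ : R => c) x 1 by exact: derivable_cst.
  rewrite derive1E (deriveM dc d) -!derive1E derive1_powR// derive1_cst.
  by rewrite scaler0 addr0 -mulrA.
- by exists 1, r; apply/funext => x; rewrite mul1r.
Qed.

Lemma derive1_0_cst I f : (forall x y t, I x -> I y -> x <= t <= y -> I t) ->
  (forall x, I x -> derivable f x 1) -> (forall x, I x -> derive1 f x = 0) ->
  forall x y, I x -> I y -> f x = f y.
Proof.
move=> cI df d0.
suff H x y : I x -> I y -> x < y -> f x = f y.
  by move=> x y Ix Iy; have [/H->|/H->|->] := ltgtP x y.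
move=> Ix Iy xy.
have [z zxy] : exists2 z, z \in `]x, y[%R & f y - f x = 0 * (y - x).
  apply: (@MVT _ f (fun _ => 0)) => //.
    move=> z; rewrite in_itv /= => /andP[xz zy].
    have Iz : I z by apply: (cI x y) => //; rewrite !ltW.
    by rewrite -(d0 _ Iz) derive1E; apply/derivableP; exact: df.
  apply: derivable_within_continuous => z; rewrite in_itv /= => xzy.
  by apply: df; exact: (cI x y).
by rewrite mul0r => /eqP; rewrite subr_eq0 => /eqP.
Qed.

Lemma integrable_segment f (x y : R) : (forall t, x <= t <= y -> {for t, continuous f}) ->
  lebesgue_measure.-integrable `[x, y] (EFin \o f).
Proof.
move=> cf; apply: continuous_compact_integrable; first exact: segment_compact.
apply: continuous_in_subspaceT => t; rewrite inE /= in_itv /= => xty.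
exact: cf.
Qed.

(** The oriented integral from a base point [x0] is a primitive on both sides of it. Near a point
    [t] it differs by a constant from the integral with lower end [c], for a [c] to the left of both
    [t] and [x0], and to the latter the fundamental theorem applies. *)
Lemma primitive_exists a b f : (forall t, oitv a b t -> {for t, continuous f}) ->
  exists F : R -> R, forall t, oitv a b t -> derivable F t 1 /\ derive1 F t = f t.
Proof.
move=> cf.
have [[x0 I0]|nI] := pselect (exists x, oitv a b x); last first.
  by exists f => t It; case: nI; exists t.
pose F x := if x0 <= x then \int[lebesgue_measure]_(t in `[x0, x]) f t
            else - \int[lebesgue_measure]_(t in `[x, x0]) f t.
exists F => t It.
have [e1 e10 b1] := open_ball_sub (@open_oitv a b) It.
have [e2 e20 b2] := open_ball_sub (@open_oitv a b) I0.
pose c := Num.min (t - e1) (x0 - e2); pose u := t + e1.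
have Ic : oitv a b c.
  rewrite /c minEle; case: ifP => _; [apply: b1|apply: b2];
    by rewrite addrAC subrr add0r normrN gtr0_norm.
have Iu : oitv a b u by apply: b1; rewrite /u addrAC subrr add0r gtr0_norm.
have ct : c < t by rewrite /c gt_min; apply/orP; left; lra.
have cx0 : c < x0 by rewrite /c gt_min; apply/orP; right; lra.
have tu : t < u by rewrite /u; lra.
clearbody c u.
have ig x y : c <= x -> oitv a b y -> lebesgue_measure.-integrable `[x, y] (EFin \o f).
  move=> cx Iy; apply: integrable_segment => s /andP[xs sy]; apply: cf.
  by apply: (oitv_between Ic Iy); rewrite sy (le_trans cx).
have split3 x y : c < x -> x <= y -> oitv a b y ->
    \int[lebesgue_measure]_(t in `[c, y]) f t - \int[lebesgue_measure]_(t in `[c, x]) f t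
    = \int[lebesgue_measure]_(t in `[x, y]) f t.
  move=> cx xy Iy.
  rewrite Rintegral_itvB ?bnd_simp//; [|exact: ig|exact: ltW].
  apply: Rintegral_itv_obnd_cbnd.
  apply: integrableS (ig x y (ltW cx) Iy) => //.
  by move=> s /=; rewrite !in_itv /= => /andP[/ltW -> ->].
have FE : forall x, c < x -> x < u ->
   \int[lebesgue_measure]_(t in `[c, x]) f t = F x + \int[lebesgue_measure]_(t in `[c, x0]) f t.
  move=> x cx xu; have Ix : oitv a b x by apply: (oitv_between Ic Iu); rewrite !ltW.
  rewrite /F; case: (leP x0 x) => h.
    by rewrite -(split3 _ _ cx0 h Ix) subrK.
  by rewrite -(split3 _ _ cx (ltW h) I0); ring.
have [d1 d2] : derivable (fun x => \int[lebesgue_measure]_(t in [set` Interval (BLeft c) (BRight x)]) f t) t 1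
   /\ derive1 (fun x => \int[lebesgue_measure]_(t in [set` Interval (BLeft c) (BRight x)]) f t) t = f t.
  apply: (continuous_FTC1 tu).
  - exact: (ig c u).
  - by [].
  - exact: cf.
have nr : \forall x \near t, c < x < u.
  have : t \in `]c, u[%R by rewrite in_itv /= ct tu.
  by move/near_in_itvoo; apply: filterS => x; rewrite in_itv.
pose C := \int[lebesgue_measure]_(t in `[c, x0]) f t.
have e : \forall x \near t, \int[lebesgue_measure]_(t in `[c, x]) f t + - C = F x.
  by apply: filterS nr => x /andP[cx xu]; rewrite FE// /C addrK.
have dc : derivable (fun _ : R => - C) t 1 by exact: derivable_cst.
split; first by apply: near_eq_derivable (derivableD d1 dc); exact: e.
have E : 'D_1 F t = 'D_1 (fun x => \int[lebesgue_measure]_(t in `[c, x]) f t + - C) t.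
  by apply: near_eq_derive; apply: filterS e => x ->.
rewrite derive1E E (deriveD d1 dc) -!derive1E derive1_cst addr0.
exact: d2.
Qed.

End OneVariable.

(** * Bump functions *)

Section Bump.
Variable R : realType.
Implicit Types (x : R) (n : nat).

(** The derivative of [flat n] is a combination of the functions with indices n + 1 and n + 2, so
    the span of all of them is stable under the derivative. *)
Definition flat n x : R := if 0 < x then x ^- n * expR (- x^-1) else 0.

(** With y = 1/x and k = n + 2, the k-th power of y/k <= exp(y/k) gives (y/k)^k <= exp y. The two
    surplus powers leave the factor x^2, which makes the derivative at 0 exist and vanish
    ([derive_quadratic]). *)
Lemma flat_bound n x : `|flat n x| <= (n.+2)%:R ^+ n.+2 * x ^+ 2.
Proof.
rewrite /flat; case: ifPn => x0; last by rewrite normr0 mulr_ge0 ?sqr_ge0 ?exprn_ge0 ?ler0n.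
have k0 : 0 < (n.+2)%:R :> R by rewrite ltr0n.
have xi0 : 0 < x^-1 by rewrite invr_gt0.
rewrite gtr0_norm ?mulr_gt0 ?expR_gt0 ?invr_gt0 ?exprn_gt0// expRN.
have h : (x^-1 / (n.+2)%:R) ^+ n.+2 <= expR x^-1.
  rewrite -[X in expR X](divfK (lt0r_neq0 k0)) expRM_natr lerXn2r ?nnegrE ?expR_ge0//.
    by rewrite divr_ge0 ?ltW.
  by apply: le_trans (expR_ge1Dx _); rewrite lerDr.
have xn0 : 0 < x ^+ n.+2 by rewrite exprn_gt0.
have kn0 : 0 < (n.+2)%:R ^+ n.+2 :> R by rewrite exprn_gt0.
rewrite ler_pdivrMr ?expR_gt0//.
apply: le_trans (_ : (n.+2)%:R ^+ n.+2 * x ^+ 2 * (x^-1 / (n.+2)%:R) ^+ n.+2 <= _); last first.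
  by rewrite ler_wpM2l// mulr_ge0 ?sqr_ge0 ?ltW.
rewrite expr_div_n exprVn -addn2.
by rewrite le_eqVlt; apply/orP; left; apply/eqP; rewrite !exprD; field; rewrite !expf_neq0 ?gt_eqF.
Qed.

Lemma derive_quadratic (f : R -> R) (C : R) : (forall x, `|f x| <= C * x ^+ 2) ->
  derivable f 0 1 /\ derive1 f 0 = 0.
Proof.
move=> fC.
have f0 : f 0 = 0.
  by apply/eqP; rewrite -normr_le0; apply: le_trans (fC 0) _; rewrite expr0n mulr0.
have [d e] : is_derive (0 : R) 1 f 0.
  apply/is_derive1_caratheodory; exists (fun z => if z == 0 then 0 else f z / z); split.
  - move=> z; rewrite f0 !subr0; case: eqP => [->|/eqP z0]; first by rewrite mulr0.
    by rewrite divfK.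
  - apply/cvgrPdist_le => e e0 /=; rewrite eqxx.
    have C0 : 0 <= C by have := fC 1; rewrite expr1n mulr1; apply: le_trans.
    have d0 : 0 < e / (C + 1) by rewrite divr_gt0// ltr_wpDl.
    have := @nbhs0_le R R _ d0; apply: filterS => z zd; rewrite sub0r normrN.
    case: eqP => [_|/eqP z0]; first by rewrite normr0 ltW.
    rewrite normrM normfV ler_pdivrMr ?normr_gt0//; apply: le_trans (fC z) _.
    rewrite -real_normK ?num_real// expr2 mulrA ler_wpM2r//.
    rewrite ler_pdivlMr ?ltr_wpDl// in zd.
    by apply: le_trans zd; rewrite mulrC ler_wpM2l// lerDl.
  - by rewrite eqxx.
by split=> //; rewrite derive1E.
Qed.

Lemma flat_derive n x : derivable (flat n) x 1 /\
  derive1 (flat n) x = - n%:R * flat n.+1 x + flat n.+2 x.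
Proof.
have [x0|x0|<-] := ltgtP 0 x; last first.
- have [d e] := derive_quadratic (flat_bound n).
  by split=> //; rewrite e /flat ltxx mulr0 addr0.
- have nE : \forall y \near x, (fun _ : R => 0) y = flat n y.
    near=> y; rewrite /flat; have -> : (0 < y) = false; last by [].
    apply/negbTE; rewrite -leNgt; apply: ltW. near: y; exact: lt_nbhsl.
  split.
    have dk : derivable (fun _ : R => 0 : R) x 1 by exact: derivable_cst.
    exact: near_eq_derivable dk.
  rewrite derive1E -(near_eq_derive (1 : R) nE) -derive1E derive1_cst /flat !ltNge !(ltW x0) /=.
  by rewrite mulr0 addr0.
- have nE : \forall y \near x, y ^- n * expR (- y^-1) = flat n y.
    near=> y; rewrite /flat; have -> : 0 < y; last by [].
    by near: y; exact: lt_nbhsr.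
  have xn : x != 0 by rewrite gt_eqF.
  have dV : is_derive x 1 (fun y : R => y^-1) (- x ^- 2).
    apply: (is_derive_eq (@is_deriveV R id x 1 1 xn (is_derive_id x 1))).
    by rewrite /GRing.scale /= mulr1.
  have dVN : is_derive x 1 (fun y : R => - y^-1) (x ^- 2).
    by have := is_deriveN dV; rewrite opprK.
  have de : derivable (fun y : R => expR (- y^-1)) x 1.
    by apply: (derivable_comp1 (h := fun y : R => - y^-1)); [exact: ex_derive|exact: derivable_expR].
  have ee : derive1 (fun y : R => expR (- y^-1)) x = expR (- x^-1) * x ^- 2.
    rewrite (derive1_comp1 (h := fun y : R => - y^-1)); [|exact: ex_derive|exact: derivable_expR].
    by rewrite !derive1E derive_val [X in _ * X](@derive_val _ _ _ _ _ _ _ dVN).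
  have dX : is_derive x 1 (fun y : R => y ^- n) (- n%:R * x ^- n.+1).
    have dXn : is_derive x 1 (fun y : R => y ^+ n) (n%:R * x ^+ n.-1).
      by split; [exact: exprn_derivable|rewrite -derive1E exp_derive1].
    apply: (is_derive_eq (@is_deriveV R (fun y => y ^+ n) x _ 1 (expf_neq0 n xn) dXn)).
    rewrite /GRing.scale /=.
    case: n {nE dXn} => [|n]; first by rewrite !mul0r mulr0 ?oppr0 ?mul0r.
    by rewrite /= !exprS expr0; field; rewrite ?expf_neq0.
  have dXd : derivable (fun y : R => y ^- n) x 1 by exact: ex_derive.
  split; first by apply: near_eq_derivable (derivableM dXd de).
  rewrite derive1E -(near_eq_derive (1 : R) nE) (deriveM dXd de) -!derive1E ee.
  rewrite (derive1E (fun y => y ^- n)) (@derive_val _ _ _ _ _ _ _ dX).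
  rewrite /flat x0 /GRing.scale /= !exprS; field.
  by rewrite xn expf_neq0.
Unshelve. all: by end_near. Qed.

Inductive flat_span : (R -> R) -> Prop :=
| flat_span_gen n : flat_span (flat n)
| flat_spanD f g : flat_span f -> flat_span g -> flat_span (fun x => f x + g x)
| flat_spanZ c f : flat_span f -> flat_span (fun x => c * f x).

Lemma flat_smooth n : sm1 setT (flat n).
Proof.
apply: (@smooth1_coind _ setT flat_span) => //; first exact: openT.
- move=> f x sf _; elim: sf => {f}.
  + by move=> m; have [] := flat_derive m x.
  + by move=> f g _ df _ dg; exact: (derivableD df dg).
  + move=> c f _ df; have dc : derivable (fun _ : R => c) x 1 by exact: derivable_cst.
    exact: (derivableM dc df).
- move=> f sf; suff [g sg H] : exists2 g : R -> R, flat_span g & forall x, derivable f x 1 /\ derive1 f x = g x.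
    by exists g => // x _; have [] := H x.
  elim: sf => {f}.
  + move=> m; exists (fun x => - m%:R * flat m.+1 x + flat m.+2 x); last by move=> x; exact: flat_derive.
    by apply: flat_spanD; [apply: flat_spanZ|]; exact: flat_span_gen.
  + move=> f g _ [f' sf Hf] _ [g' sg Hg]; exists (fun x => f' x + g' x); first exact: flat_spanD.
    move=> x; have [df ef] := Hf x; have [dg eg] := Hg x.
    split; first exact: (derivableD df dg).
    by rewrite derive1E (deriveD df dg) -!derive1E ef eg.
  + move=> c f _ [f' sf Hf]; exists (fun x => c * f' x); first exact: flat_spanZ.
    move=> x; have [df ef] := Hf x; have dc : derivable (fun _ : R => c) x 1 by exact: derivable_cst.
    split; first exact: (derivableM dc df).
    by rewrite derive1E (deriveM dc df) -!derive1E derive1_cst scaler0 addr0 ef.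
- exact: flat_span_gen.
Qed.

Lemma bump_exists (t r : R) : 0 < r -> exists h : R -> R,
  [/\ sm1 setT h, forall x, 0 <= h x, 0 < h t & forall x, r <= `|x - t| -> h x = 0].
Proof.
(* [u] and [v] are r + (x - t) and r - (x - t), both positive exactly when |x - t| < r. *)
move=> r0; pose u x := x + (r - t); pose v x := - x + (r + t).
have su : sm1 setT u by apply: sm1D; [exact: openT|exact: sm1_id|exact: smooth1_cst].
have sv : sm1 setT v.
  apply: sm1D; [exact: openT| |exact: smooth1_cst].
  by apply: (sm1N openT); exact: sm1_id.
have oT : open (setT : set R) := openT.
exists (fun x => flat 0 (u x) * flat 0 (v x)); split.
- by apply: (sm1M oT); [exact: (sm1_comp oT oT (flat_smooth 0) _ su)|exact: (sm1_comp oT oT (flat_smooth 0) _ sv)].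
- have f0 x : 0 <= flat 0 x.
    by rewrite /flat; case: ifPn => // x0; rewrite mulr_ge0 ?expR_ge0 ?invr_ge0 ?exprn_ge0 ?ltW.
  by move=> x; rewrite mulr_ge0.
- have ut : u t = r by rewrite /u; ring.
  have vt : v t = r by rewrite /v; ring.
  by rewrite ut vt /flat r0 mulr_gt0// mulr_gt0 ?expR_gt0// invr_gt0 exprn_gt0.
- move=> x; rewrite ler_normr => /orP[h|h].
  + have -> : flat 0 (v x) = 0 by rewrite /flat ifN// -leNgt /v; lra.
    by rewrite mulr0.
  + have -> : flat 0 (u x) = 0 by rewrite /flat ifN// -leNgt /u; lra.
    by rewrite mul0r.
Qed.

End Bump.

(** * The moving frame of a Legendrian family *)

(* The complex functions on a surface: dt is the derivative along the curves of a family,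
   ds the derivative in the deformation parameter, cj the conjugation, ii the imaginary unit. *)
Record diffRing := DiffRing {
  drsort :> comPzRingType;
  dt : drsort -> drsort;
  ds : drsort -> drsort;
  cj : drsort -> drsort;
  ii : drsort;
  sixth : drsort;
  dtD : forall x y, dt (x + y) = dt x + dt y;
  dtM : forall x y, dt (x * y) = dt x * y + x * dt y;
  dsD : forall x y, ds (x + y) = ds x + ds y;
  dsM : forall x y, ds (x * y) = ds x * y + x * ds y;
  dsdt : forall x, ds (dt x) = dt (ds x);
  cjD : forall x y, cj (x + y) = cj x + cj y;
  cjM : forall x y, cj (x * y) = cj x * cj y;
  cjK : forall x, cj (cj x) = x;
  cj1 : cj 1 = 1;
  cj_dt : forall x, cj (dt x) = dt (cj x);
  cj_ds : forall x, cj (ds x) = ds (cj x);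
  iiM : ii * ii = -1;
  cj_ii : cj ii = - ii;
  dt_ii : dt ii = 0;
  ds_ii : ds ii = 0;
  sixthE : 6 * sixth = 1
}.
Arguments ii {_}.
Arguments sixth {_}.

Section DiffRing.
Variable A : diffRing.
Implicit Types x y z : A.

Lemma dt0 : dt (0 : A) = 0.
Proof. by apply: (addrI (dt 0)); rewrite -dtD !addr0. Qed.
Lemma dtN x : dt (- x) = - dt x.
Proof. by apply/eqP; rewrite -addr_eq0 -dtD addNr dt0. Qed.
Lemma dtB x y : dt (x - y) = dt x - dt y.
Proof. by rewrite dtD dtN. Qed.
Lemma dt1 : dt (1 : A) = 0.
Proof. by apply: (addrI (dt 1)); rewrite addr0 -{3}[1]mulr1 dtM mulr1 mul1r. Qed.
Lemma dtn n : dt (n%:R : A) = 0.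
Proof. by elim: n => [|n IH]; [rewrite mulr0n dt0|rewrite mulrS dtD IH dt1 addr0]. Qed.
Lemma dsz : ds (0 : A) = 0.
Proof. by apply: (addrI (ds 0)); rewrite -dsD !addr0. Qed.
Lemma dsN x : ds (- x) = - ds x.
Proof. by apply/eqP; rewrite -addr_eq0 -dsD addNr dsz. Qed.
Lemma dsB x y : ds (x - y) = ds x - ds y.
Proof. by rewrite dsD dsN. Qed.
Lemma ds1 : ds (1 : A) = 0.
Proof. by apply: (addrI (ds 1)); rewrite addr0 -{3}[1]mulr1 dsM mulr1 mul1r. Qed.
Lemma dsn n : ds (n%:R : A) = 0.
Proof. by elim: n => [|n IH]; [rewrite mulr0n dsz|rewrite mulrS dsD IH ds1 addr0]. Qed.
Lemma cj0 : cj (0 : A) = 0.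
Proof. by apply: (addrI (cj 0)); rewrite -cjD !addr0. Qed.
Lemma cjN x : cj (- x) = - cj x.
Proof. by apply/eqP; rewrite -addr_eq0 -cjD addNr cj0. Qed.
Lemma cjB x y : cj (x - y) = cj x - cj y.
Proof. by rewrite cjD cjN. Qed.
Lemma cjn n : cj (n%:R : A) = n%:R.
Proof. by elim: n => [|n IH]; [rewrite mulr0n cj0|rewrite mulrS cjD IH cj1]. Qed.
Lemma dtX x n : dt (x ^+ n) = n%:R * x ^+ n.-1 * dt x.
Proof.
elim: n => [|n IH]; first by rewrite expr0 dt1 !mul0r.
rewrite exprS dtM IH; case: n {IH} => [|n] /=; first by ring.
by rewrite !exprS -[n.+2]addn1 natrD; ring.
Qed.

Definition dtE := (dtN, dtD, dtM, dtX, dtn, dt0, dt1, dt_ii).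
Definition dsE := (dsN, dsD, dsM, dsn, dsz, ds1, ds_ii).
Definition cjE := (cjN, cjD, cjM, cjn, cj0, cj1, cj_ii, cjK, cj_dt, cj_ds).

Lemma inv_uniq x y z : x * y = 1 -> x * z = 1 -> y = z.
Proof. by move=> xy xz; rewrite -[y]mulr1 -xz mulrA [y * x]mulrC xy mul1r. Qed.

Lemma cj_inv x y : x * y = 1 -> cj x = x -> cj y = y.
Proof. by move=> xy cx; apply: (inv_uniq (x := x)) => //; rewrite -{1}cx -cjM xy cj1. Qed.

Lemma cj_sixth : cj sixth = sixth :> A.
Proof. by apply: (cj_inv (x := 6)); [exact: sixthE|exact: cjn]. Qed.

Lemma dt_inv x y : x * y = 1 -> dt y = - (y * y * dt x).
Proof.
move=> xy; have : dt (x * y) = 0 by rewrite xy dt1.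
rewrite dtM => /eqP; rewrite addr_eq0 => /eqP /(congr1 (fun z => y * z)).
rewrite mulrN [y * (x * _)]mulrA [y * x]mulrC xy mul1r => h.
by rewrite -[LHS]opprK -h; ring.
Qed.

Lemma ds_inv x y : x * y = 1 -> ds y = - (y * y * ds x).
Proof.
move=> xy; have : ds (x * y) = 0 by rewrite xy ds1.
rewrite dsM => /eqP; rewrite addr_eq0 => /eqP /(congr1 (fun z => y * z)).
rewrite mulrN [y * (x * _)]mulrA [y * x]mulrC xy mul1r => h.
by rewrite -[LHS]opprK -h; ring.
Qed.

Lemma dt_sixth : dt sixth = 0 :> A.
Proof. by rewrite (dt_inv (sixthE A)) dtn mulr0 oppr0. Qed.

(** * Vectors over the ring and the adapted frame *)

Definition vec := (A * A * A)%type.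
Implicit Types u v w : vec.
Definition vD u v : vec := (u.1.1 + v.1.1, u.1.2 + v.1.2, u.2 + v.2).
Definition vZ x u : vec := (x * u.1.1, x * u.1.2, x * u.2).
Definition vdt u : vec := (dt u.1.1, dt u.1.2, dt u.2).
Definition vds u : vec := (ds u.1.1, ds u.1.2, ds u.2).
(** Locked, so that [ring] and rewriting treat products of vectors as atoms. *)
Definition hm u v : A :=
  locked (ii * (cj u.1.1 * v.2 - cj u.2 * v.1.1) + cj u.1.2 * v.1.2).
Definition det u v w : A :=
  u.1.1 * (v.1.2 * w.2 - v.2 * w.1.2) - v.1.1 * (u.1.2 * w.2 - u.2 * w.1.2)
  + w.1.1 * (u.1.2 * v.2 - u.2 * v.1.2).

Lemma vecP u v : u.1.1 = v.1.1 -> u.1.2 = v.1.2 -> u.2 = v.2 -> u = v.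
Proof. by case: u => [[? ?] ?]; case: v => [[? ?] ?] /= -> -> ->. Qed.

Lemma hmDr u v w : hm u (vD v w) = hm u v + hm u w.
Proof. by rewrite /hm -!lock /=; ring. Qed.
Lemma hmZr x u v : hm u (vZ x v) = x * hm u v.
Proof. by rewrite /hm -!lock /=; ring. Qed.
Lemma hmDl u v w : hm (vD v w) u = hm v u + hm w u.
Proof. by rewrite /hm -!lock /= !cjE; ring. Qed.
Lemma hmZl x u v : hm (vZ x v) u = cj x * hm v u.
Proof. by rewrite /hm -!lock /= !cjE; ring. Qed.
Lemma cj_hm u v : cj (hm u v) = hm v u.
Proof. by rewrite /hm -!lock /= !cjE; ring. Qed.
Lemma dt_hm u v : dt (hm u v) = hm (vdt u) v + hm u (vdt v).
Proof. by rewrite /hm -!lock /= !dtE !cj_dt; ring. Qed.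
Lemma ds_hm u v : ds (hm u v) = hm (vds u) v + hm u (vds v).
Proof. by rewrite /hm -!lock /= !dsE !cj_ds; ring. Qed.
Definition hmE := (hmDr, hmZr, hmDl, hmZl).

Lemma vdtZ x u : vdt (vZ x u) = vD (vZ (dt x) u) (vZ x (vdt u)).
Proof. by rewrite /vdt /= !dtM. Qed.
Lemma vdtD u v : vdt (vD u v) = vD (vdt u) (vdt v).
Proof. by rewrite /vdt /= !dtD. Qed.

(* Cauchy-Binet: the Gram matrix of the Hermitian form has determinant -1. *)
Lemma det_gram u v w (x y z : vec) : cj (det u v w) * det x y z =
  - (hm u x * (hm v y * hm w z - hm v z * hm w y)
     - hm u y * (hm v x * hm w z - hm v z * hm w x)
     + hm u z * (hm v x * hm w y - hm v y * hm w x)).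
Proof.
rewrite /det /hm -!lock /= !cjE.
move: (cj u.1.1) (cj u.1.2) (cj u.2) (cj v.1.1) (cj v.1.2) (cj v.2)
  (cj w.1.1) (cj w.1.2) (cj w.2) => a1 a2 a3 b1 b2 b3 d1 d2 d3.
have i2 : (ii : A) ^+ 2 = -1 by rewrite expr2 iiM.
have i3 : (ii : A) ^+ 3 = - ii by rewrite exprS i2 mulrN1.
ring: i2 i3.
Qed.

(** Cramer's rule without division: the coefficients that combine the three equations are minors of
    the conjugated vectors. *)
Lemma hm_nondeg u v w (x : vec) : hm u x = 0 -> hm v x = 0 -> hm w x = 0 ->
  [/\ cj (det u v w) * (ii * x.1.1) = 0, cj (det u v w) * x.1.2 = 0
    & cj (det u v w) * (ii * x.2) = 0].
Proof.
case: u v w x => [[a1 a2] a3] [[b1 b2] b3] [[d1 d2] d3] [[x1 x2] x3].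
rewrite /hm /det -!lock /= => u0 u1 u2; split; rewrite !cjE.
- transitivity ((ii * (cj a1 * x3 - cj a3 * x1) + cj a2 * x2) * (cj b2 * cj d1 - cj b1 * cj d2) +
    (ii * (cj b1 * x3 - cj b3 * x1) + cj b2 * x2) * (cj d2 * cj a1 - cj d1 * cj a2) +
    (ii * (cj d1 * x3 - cj d3 * x1) + cj d2 * x2) * (cj a2 * cj b1 - cj a1 * cj b2)); first by ring.
  by rewrite u0 u1 u2 !mul0r !addr0.
- transitivity ((ii * (cj a1 * x3 - cj a3 * x1) + cj a2 * x2) * (cj b3 * cj d1 - cj b1 * cj d3) +
    (ii * (cj b1 * x3 - cj b3 * x1) + cj b2 * x2) * (cj d3 * cj a1 - cj d1 * cj a3) +
    (ii * (cj d1 * x3 - cj d3 * x1) + cj d2 * x2) * (cj a3 * cj b1 - cj a1 * cj b3)); first by ring.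
  by rewrite u0 u1 u2 !mul0r !addr0.
- transitivity ((ii * (cj a1 * x3 - cj a3 * x1) + cj a2 * x2) * (cj b2 * cj d3 - cj b3 * cj d2) +
    (ii * (cj b1 * x3 - cj b3 * x1) + cj b2 * x2) * (cj d2 * cj a3 - cj d3 * cj a2) +
    (ii * (cj d1 * x3 - cj d3 * x1) + cj d2 * x2) * (cj a2 * cj b3 - cj a3 * cj b2)); first by ring.
  by rewrite u0 u1 u2 !mul0r !addr0.
Qed.

(* With q the norm <,> of dt u and qi = 1/q, the connection dt + conn preserves <,>/q, and
   its phase makes the first two covariant derivatives of u orthogonal. For normalized lifts
   q = 1 and conn = 0, so that the gauge invariants frame_b and p - cj p, with p = frame_p,
   are 2b and 2ia for the Fubini densities a, b. *)
Definition conn qi u : A :=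
  - (2 * sixth * qi * (2 * hm (vdt u) (vdt (vdt u)) + hm (vdt (vdt u)) (vdt u))).
Definition cov k u : vec := locked (vD (vdt u) (vZ k u)).
Lemma covE k u : cov k u = vD (vdt u) (vZ k u).
Proof. by rewrite /cov -lock. Qed.
Definition fr1 qi u := cov (conn qi u) u.
Definition fr2 qi u := cov (conn qi u) (fr1 qi u).
Definition fr3 qi u := cov (conn qi u) (fr2 qi u).
Definition br qi u v := qi * hm u v.
Definition frame_b qi u := br qi (fr2 qi u) (fr2 qi u).
Definition frame_p qi u := - br qi (fr2 qi u) (fr3 qi u).

Section Frame.
Variables (G : vec) (q qi : A).
Hypotheses (h00 : hm G G = 0) (h01 : hm G (vdt G) = 0)
  (hq : hm (vdt G) (vdt G) = q) (qqi : q * qi = 1).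
Local Notation k := (conn qi G).
Local Notation e1 := (fr1 qi G).
Local Notation e2 := (fr2 qi G).
Local Notation e3 := (fr3 qi G).
Local Notation br := (br qi).

Lemma cj_q : cj q = q. Proof. by rewrite -hq cj_hm. Qed.
Lemma cj_qi : cj qi = qi. Proof. exact: cj_inv qqi cj_q. Qed.
Lemma h10 : hm (vdt G) G = 0. Proof. by rewrite -cj_hm h01 cj0. Qed.
Lemma h02 : hm G (vdt (vdt G)) = - q.
Proof.
have := congr1 (@dt A) h01; rewrite dt_hm dt0 hq addrC => /eqP.
by rewrite addr_eq0 => /eqP.
Qed.
Lemma dq : dt q = hm (vdt G) (vdt (vdt G)) + hm (vdt (vdt G)) (vdt G).
Proof. by rewrite -hq dt_hm addrC. Qed.

(** This is compatibility with the metric <,>/q. The orthogonality [br12] requires 2k - cj k = -<G',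
    G''>/q; adding the two conditions gives 3k = -(2<G', G''> + <G'', G'>)/q, which is the origin of
    the formula for [conn]. *)
Lemma conn_metric : cj k + k = - (dt q * qi).
Proof.
rewrite dq /conn !cjE cj_qi cj_sixth !cj_hm.
rewrite -[RHS]mul1r; transitivity (6 * sixth *
  - ((hm (vdt G) (vdt (vdt G)) + hm (vdt (vdt G)) (vdt G)) * qi)); first by ring.
by rewrite sixthE.
Qed.

Lemma br_cj u v : cj (br u v) = br v u.
Proof. by rewrite cjM cj_hm cj_qi. Qed.

Lemma br_dt u v : dt (br u v) = br (cov k u) v + br u (cov k v).
Proof.
rewrite /br !covE !hmE dtM dt_hm (dt_inv qqi).
have -> : qi * (hm (vdt u) v + cj k * hm u v) + qi * (hm u (vdt v) + k * hm u v)
  = qi * (hm (vdt u) v + hm u (vdt v)) + qi * (cj k + k) * hm u v by ring.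
by rewrite conn_metric; ring.
Qed.

Lemma brDr u v w : br u (vD v w) = br u v + br u w.
Proof. by rewrite /br hmE; ring. Qed.
Lemma brDl u v w : br (vD v w) u = br v u + br w u.
Proof. by rewrite /br hmE; ring. Qed.
Lemma brZr x u v : br u (vZ x v) = x * br u v.
Proof. by rewrite /br hmE; ring. Qed.
Lemma brZl x u v : br (vZ x v) u = cj x * br v u.
Proof. by rewrite /br hmE; ring. Qed.

Lemma br00 : br G G = 0. Proof. by rewrite /br h00 mulr0. Qed.
Lemma br01 : br G e1 = 0.
Proof. by rewrite /br /fr1 !covE !hmE h00 h01 !mulr0 addr0 mulr0. Qed.
Lemma br10 : br e1 G = 0. Proof. by rewrite -br_cj br01 cj0. Qed.
Lemma br11 : br e1 e1 = 1.
Proof.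
rewrite /br /fr1 !covE !hmE h00 h01 h10 hq !mulr0 !addr0 -[RHS]qqi; ring.
Qed.
Lemma br02 : br G e2 = -1.
Proof.
have := br_dt G e1; rewrite br01 dt0 -/e1 -/e2 br11 => /esym/eqP.
by rewrite addrC addr_eq0 => /eqP.
Qed.
Lemma br20 : br e2 G = -1. Proof. by rewrite -br_cj br02 cjN cj1. Qed.
Lemma br12 : br e1 e2 = 0.
Proof.
rewrite /br /fr2 /fr1 !covE vdtD vdtZ !hmE h00 h01 h10 hq h02.
transitivity (qi * hm (vdt G) (vdt (vdt G)) + (q * qi) * (2 * k - cj k)); first by ring.
rewrite qqi mul1r /conn !cjE cj_qi cj_sixth !cj_hm.
have -> : qi * hm (vdt G) (vdt (vdt G)) = 6 * sixth * qi * hm (vdt G) (vdt (vdt G)).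
  by rewrite sixthE mul1r.
ring.
Qed.
Lemma br21 : br e2 e1 = 0. Proof. by rewrite -br_cj br12 cj0. Qed.
Lemma br03 : br G e3 = 0.
Proof.
by have := br_dt G e2; rewrite br02 dtN dt1 oppr0 -/e1 -/e3 br12 add0r => <-.
Qed.
Lemma br30 : br e3 G = 0. Proof. by rewrite -br_cj br03 cj0. Qed.

Local Notation b := (frame_b qi G).
Local Notation p := (frame_p qi G).

Lemma cj_b : cj b = b. Proof. exact: br_cj. Qed.
Lemma br13 : br e1 e3 = - b.
Proof.
have := br_dt e1 e2; rewrite br12 dt0 -/e2 -/e3 => /esym/eqP.
by rewrite addrC addr_eq0 => /eqP.
Qed.
Lemma br31 : br e3 e1 = - b. Proof. by rewrite -br_cj br13 cjN cj_b. Qed.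
Lemma br23 : br e2 e3 = - p. Proof. by rewrite opprK. Qed.
Lemma br32 : br e3 e2 = - cj p. Proof. by rewrite -br_cj br23 cjN. Qed.
Lemma dt_b : dt b = - (cj p + p).
Proof. by rewrite /frame_b br_dt -/e3 br23 br32; ring. Qed.

(** The Gram matrix of [G], [e1], [e2] for [br] has antidiagonal entries -1, 1, -1 and zeros above
    the antidiagonal, hence determinant -1. It follows that the determinant of the frame is
    invertible, so that [hm_nondeg] makes the frame a basis. *)
Lemma det_unit : cj (det G e1 e2) * det G e1 e2 = q ^+ 3.
Proof.
have hbr u v : hm u v = q * br u v by rewrite mulrA qqi mul1r.
rewrite det_gram !hbr br00 br01 br02 br10 br11 br12 br20 br21; ring.
Qed.

Lemma frame_nondeg u : br G u = 0 -> br e1 u = 0 -> br e2 u = 0 -> u = (0, 0, 0).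
Proof.
move=> u0 u1 u2.
have hbr v : hm v u = q * br v u by rewrite mulrA qqi mul1r.
have {u0 u1 u2}[u0 u1 u2] : [/\ hm G u = 0, hm e1 u = 0 & hm e2 u = 0].
  by rewrite !hbr u0 u1 u2 mulr0.
have key x : cj (det G e1 e2) * x = 0 -> x = 0.
  move=> /(congr1 (fun y => qi ^+ 3 * (det G e1 e2 * y))) /=; rewrite !mulr0 => h.
  rewrite -[x]mul1r -[1](expr1n _ 3) -qqi exprMn -det_unit -h; ring.
have i1 x : ii * x = 0 -> x = 0 :> A.
  move=> h; have /eqP : ii * (ii * x) = 0 by rewrite h mulr0.
  by rewrite mulrA iiM mulN1r oppr_eq0 => /eqP.
have [k1 k2 k3] := hm_nondeg u0 u1 u2.
by apply: vecP => /=; [apply/i1/key|apply/key|apply/i1/key]; rewrite ?k1 ?k2 ?k3.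
Qed.

(** Both sides have the same products with [G], [e1] and [e2], so [frame_nondeg] applies to their
    difference. *)
Lemma frame_e3 : e3 = vD (vZ p G) (vZ (- b) e1).
Proof.
have h : vD e3 (vZ (-1) (vD (vZ p G) (vZ (- b) e1))) = (0, 0, 0).
  apply: frame_nondeg; rewrite brDr (brZr (-1)) (brDr _ (vZ p G)) !brZr.
  - by rewrite br03 br00 br01; ring.
  - by rewrite br13 br10 br11; ring.
  - by rewrite br23 br20 br21; ring.
case: h => h1 h2 h3.
by apply: vecP; apply/eqP; rewrite -subr_eq0; apply/eqP;
  [rewrite -[RHS]h1|rewrite -[RHS]h2|rewrite -[RHS]h3] => /=; ring.
Qed.

Lemma br3l u : br e3 u = cj p * br G u - b * br e1 u.
Proof. by rewrite frame_e3 brDl !brZl cjN cj_b mulNr. Qed.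

End Frame.

Lemma dt_det u v w :
  dt (det u v w) = det (vdt u) v w + det u (vdt v) w + det u v (vdt w).
Proof. by rewrite /det /= !dtE; ring. Qed.

(** * Change of lift *)

Section Gauge.
Variables (G : vec) (q qi l li : A).
Hypotheses (h00 : hm G G = 0) (h01 : hm G (vdt G) = 0)
  (hq : hm (vdt G) (vdt G) = q) (qqi : q * qi = 1) (lli : l * li = 1).
Local Notation qi' := (cj li * li * qi).

Lemma cov_gauge k u : cov (k - dt l * li) (vZ l u) = vZ l (cov k u).
Proof.
have e x : l * (li * x) = x by rewrite mulrA lli mul1r.
(* In each coordinate the difference of the two sides is l' x (1 - l li), with x the coordinate of
   [u]. *)
by rewrite !covE; apply: vecP; rewrite /= !dtM; apply/eqP; rewrite -subr_eq0; apply/eqP;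
  set x := (X in dt l * X); transitivity (dt l * x * (1 - l * li)); [ring
  |rewrite lli subrr mulr0|ring|rewrite lli subrr mulr0|ring|rewrite lli subrr mulr0].
Qed.

Lemma br_gauge u v : br qi' (vZ l u) (vZ l v) = br qi u v.
Proof.
rewrite /br !hmE; have c : cj l * cj li = 1 by rewrite -cjM lli cj1.
transitivity ((cj l * cj li) * (l * li) * (qi * hm u v)); first by ring.
by rewrite c lli !mul1r.
Qed.

(** The inhomogeneous term -l'/l is the one of [cov_gauge]. Covariant derivation therefore commutes
    with multiplication by [l]: the whole frame is multiplied by [l], and since [qi'] absorbs |l|^2
    the products [br] of frame vectors do not change. *)
Lemma conn_gauge : conn qi' (vZ l G) = conn qi G - dt l * li.
Proof.
have c : cj l * cj li = 1 by rewrite -cjM lli cj1.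
have h02' : hm G (vdt (vdt G)) = - q := h02 h01 hq.
have h20 : hm (vdt (vdt G)) G = - q by rewrite -cj_hm h02' cjN (cj_q hq).
have h10' : hm (vdt G) G = 0 := h10 h01.
rewrite /conn; set S := hm (vdt G) (vdt (vdt G)); set S' := hm (vdt (vdt G)) (vdt G).
have E1 : hm (vdt (vZ l G)) (vdt (vdt (vZ l G))) =
    - (cj (dt l) * l * q) + 2 * cj l * dt l * q + cj l * l * S.
  rewrite !(vdtZ, vdtD) !hmE h00 h01 h10' hq h02' -/S; ring.
have E2 : hm (vdt (vdt (vZ l G))) (vdt (vZ l G)) =
    - (dt l * cj l * q) + 2 * l * cj (dt l) * q + cj l * l * S'.
  by rewrite -cj_hm E1 /S /S' !(cj_hm, cjE) (cj_q hq); ring.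
rewrite E1 E2.
transitivity (- (2 * sixth * ((cj l * cj li) * (l * li) * qi) * (2 * S + S')) -
   (6 * sixth) * (cj l * cj li) * (q * qi) * (dt l * li)); first by ring.
by rewrite c lli qqi sixthE !mul1r.
Qed.

Lemma fr1_gauge : fr1 qi' (vZ l G) = vZ l (fr1 qi G).
Proof. by rewrite /fr1 conn_gauge cov_gauge. Qed.
Lemma fr2_gauge : fr2 qi' (vZ l G) = vZ l (fr2 qi G).
Proof. by rewrite /fr2 conn_gauge fr1_gauge cov_gauge. Qed.
Lemma fr3_gauge : fr3 qi' (vZ l G) = vZ l (fr3 qi G).
Proof. by rewrite /fr3 conn_gauge fr2_gauge cov_gauge. Qed.
Lemma frame_b_gauge : frame_b qi' (vZ l G) = frame_b qi G.
Proof. by rewrite /frame_b fr2_gauge br_gauge. Qed.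
Lemma frame_p_gauge : frame_p qi' (vZ l G) = frame_p qi G.
Proof. by rewrite /frame_p fr2_gauge fr3_gauge br_gauge. Qed.

End Gauge.

Lemma hm_vdtZ l u : hm u u = 0 -> hm u (vdt u) = 0 ->
  [/\ hm (vZ l u) (vZ l u) = 0, hm (vZ l u) (vdt (vZ l u)) = 0 &
     hm (vdt (vZ l u)) (vdt (vZ l u)) = cj l * l * hm (vdt u) (vdt u)].
Proof.
move=> h00 h01; have h10' := h10 h01.
by rewrite !vdtZ !hmE h00 h01 h10'; split; ring.
Qed.

(** * The frame of a normalized lift *)

Section Normalized.
Variables (N : vec) (q : A).
Hypotheses (h00 : hm N N = 0) (h01 : hm N (vdt N) = 0) (hq : hm (vdt N) (vdt N) = q)
  (hd : det N (vdt N) (vdt (vdt N)) = ii).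

(** By [det_gram] both sides are |i|^2, because <N, N> = <N, N'> = 0 makes the Gram determinant
    -q^3. In an abstract ring this does not yield q = 1, which is a separate hypothesis below; for
    functions it follows from the reality of q. *)
Lemma normalized_q3 : q ^+ 3 = 1.
Proof.
have h02' := h02 h01 hq.
have h20 : hm (vdt (vdt N)) N = - q by rewrite -cj_hm h02' cjN (cj_q hq).
have := det_gram N (vdt N) (vdt (vdt N)) N (vdt N) (vdt (vdt N)).
rewrite hd cj_ii mulNr iiM opprK h00 h01 (h10 h01) hq h02' h20 => ->; ring.
Qed.

Hypothesis q1 : q = 1.

(** As the determinant is constant, det(N, N', N''') = 0, and [det_gram] turns this into <N, N'''> =
    0. The derivative of <N, N''> = -1 then leaves <N', N''> = 0. *)
Lemma normalized_12 : hm (vdt N) (vdt (vdt N)) = 0.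
Proof.
have h02' := h02 h01 hq.
have h03 : hm N (vdt (vdt (vdt N))) = 0.
  have d0 : det N (vdt N) (vdt (vdt (vdt N))) = 0.
    have := congr1 (@dt A) hd; rewrite dt_ii dt_det => <-.
    by rewrite /det /=; ring.
  have := det_gram N (vdt N) (vdt (vdt N)) N (vdt N) (vdt (vdt (vdt N))).
  have h20 : hm (vdt (vdt N)) N = -1 by rewrite -cj_hm h02' q1 cjN cj1.
  rewrite d0 mulr0 h00 h01 hq h20 q1 (h10 h01).
  set x := hm N _ => h; have -> : x = - (- (0 * (1 * hm (vdt (vdt N)) (vdt (vdt (vdt N))) -
    hm (vdt N) (vdt (vdt (vdt N))) * hm (vdt (vdt N)) (vdt N)) - 0 * (0 * hm (vdt (vdt N)) (vdt (vdt (vdt N))) -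
    hm (vdt N) (vdt (vdt (vdt N))) * -1) + x * (0 * hm (vdt (vdt N)) (vdt N) - 1 * -1))) by ring.
  by rewrite -h oppr0.
have := congr1 (@dt A) h02'; rewrite q1 dt_hm h03 addr0 => ->.
by rewrite dtN dt1 oppr0.
Qed.

Lemma normalized_conn : conn 1 N = 0.
Proof. by rewrite /conn -[hm (vdt (vdt N)) (vdt N)]cj_hm normalized_12 cj0; ring. Qed.

Lemma cov0 u : cov 0 u = vdt u.
Proof. by rewrite covE; apply: vecP; rewrite /= mul0r addr0. Qed.

Lemma normalized_b : frame_b 1 N = hm (vdt (vdt N)) (vdt (vdt N)).
Proof. by rewrite /frame_b /fr2 /fr1 normalized_conn !cov0 /br mul1r. Qed.

Lemma normalized_p : frame_p 1 N = - hm (vdt (vdt N)) (vdt (vdt (vdt N))).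
Proof. by rewrite /frame_p /fr3 /fr2 /fr1 normalized_conn !cov0 /br mul1r. Qed.

End Normalized.

(** * Lifts parallel for the connection *)

Section Normalization.
Variables (G : vec) (q qi l : A).
Hypotheses (h00 : hm G G = 0) (h01 : hm G (vdt G) = 0)
  (hq : hm (vdt G) (vdt G) = q) (qqi : q * qi = 1)
  (dl : dt l = conn qi G * l) (cl : cj l * l = qi).
Local Notation N := (vZ l G).

Lemma vdt_parallel u : vdt (vZ l u) = vZ l (cov (conn qi G) u).
Proof. by rewrite covE; apply: vecP; rewrite /= dtM dl; ring. Qed.

(** Derivatives of the parallel lift are covariant derivatives multiplied by [l], so by [frame_e3]
    its third derivative is a combination of the lift and its first derivative. *)
Lemma det_parallel : dt (det N (vdt N) (vdt (vdt N))) = 0.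
Proof.
rewrite !vdt_parallel -/(fr1 qi G) -/(fr2 qi G) dt_det !vdt_parallel.
rewrite -/(fr1 qi G) -/(fr2 qi G) -/(fr3 qi G) (frame_e3 h00 h01 hq qqi).
by rewrite /det /=; ring.
Qed.

Lemma det_parallel_norm : cj (det N (vdt N) (vdt (vdt N))) * det N (vdt N) (vdt (vdt N)) = 1.
Proof.
rewrite !vdt_parallel -/(fr1 qi G) -/(fr2 qi G).
have -> : det N (vZ l (fr1 qi G)) (vZ l (fr2 qi G)) = l ^+ 3 * det G (fr1 qi G) (fr2 qi G).
  by rewrite /det /=; ring.
have c3 : cj (l ^+ 3) = cj l ^+ 3 by rewrite !exprS !cjM cj1.
rewrite cjM c3.
transitivity ((cj l * l) ^+ 3 * (cj (det G (fr1 qi G) (fr2 qi G)) * det G (fr1 qi G) (fr2 qi G))).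
  by ring.
by rewrite cl (det_unit h00 h01 hq qqi) -exprMn mulrC qqi expr1n.
Qed.

End Normalization.

End DiffRing.

(** * The first variation of the strain *)

Section Variation.
Variable A : diffRing.
Implicit Types (x y z : A) (u v w : vec A).
Variables (G : vec A) (q qi nu : A).
Hypotheses (h00 : hm G G = 0) (h01 : hm G (vdt G) = 0)
  (hq : hm (vdt G) (vdt G) = q) (qqi : q * qi = 1) (hnu : cj nu + nu = - (ds q * qi)).
Local Notation k := (conn qi G).
Local Notation e1 := (fr1 qi G).
Local Notation e2 := (fr2 qi G).
Local Notation e3 := (fr3 qi G).
Local Notation br := (br qi).
Local Notation b := (frame_b qi G).
Local Notation p := (frame_p qi G).
Local Notation D := (cov k).

Definition covs u := locked (vD (vds u) (vZ nu u)).
Lemma covsE u : covs u = vD (vds u) (vZ nu u).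
Proof. by rewrite /covs -lock. Qed.
Local Notation T := covs.
(** The curvature of the connection with components [k] along the curves and [nu] in the parameter;
    by [curv_comm] it is the commutator of the two covariant derivatives. Only the metric condition
    is imposed on [nu], so the curvature is imaginary, and it is eliminated through [curv_eq]. *)
Definition curv := ds k - dt nu.
Local Notation F := curv.

Lemma br_ds u v : ds (br u v) = br (T u) v + br u (T v).
Proof.
rewrite /br !covsE !hmE dsM ds_hm (ds_inv qqi).
transitivity (qi * (hm (vds u) v + hm u (vds v)) + qi * (cj nu + nu) * hm u v).
  by rewrite hnu; ring.
by ring.
Qed.

Lemma curv_comm u : T (D u) = vD (D (T u)) (vZ F u).
Proof.
by rewrite !covsE !covE /curv; apply: vecP; rewrite /= !(dsD, dsM, dtD, dtM) !dsdt; ring.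
Qed.

Lemma cj_curv : cj F = - F.
Proof.
apply/eqP; rewrite -addr_eq0; apply/eqP.
have -> : cj F + F = ds (cj k + k) - dt (cj nu + nu).
  by rewrite /curv !cjE !(dsD, dtD); ring.
rewrite (conn_metric hq qqi) hnu dtN dsN !(dsM, dtM) !dsdt (ds_inv qqi) (dt_inv qqi); ring.
Qed.

Local Notation V := (T G).

Lemma D_vD u v : D (vD u v) = vD (D u) (D v).
Proof. by rewrite !covE; apply: vecP; rewrite /= !dtD; ring. Qed.
Lemma D_vZ x u : D (vZ x u) = vD (vZ (dt x) u) (vZ x (D u)).
Proof. by rewrite !covE; apply: vecP; rewrite /= !dtM; ring. Qed.

Lemma T_e1 : T e1 = vD (D V) (vZ F G).
Proof. exact: curv_comm. Qed.
Lemma T_e2 : T e2 = vD (D (D V)) (vD (vZ (dt F) G) (vZ (2 * F) e1)).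
Proof.
rewrite [LHS]curv_comm T_e1 D_vD D_vZ -/(fr1 qi G).
by apply: vecP => /=; ring.
Qed.
Lemma T_e3 : T e3 = vD (D (D (D V)))
  (vD (vZ (dt (dt F)) G) (vD (vZ (3 * dt F) e1) (vZ (3 * F) e2))).
Proof.
rewrite [LHS]curv_comm T_e2 !(D_vD, D_vZ) -/(fr1 qi G) -/(fr2 qi G) -/(fr3 qi G).
have d2 : dt (2 * F) = 2 * dt F by rewrite !dtE; ring.
move: (D (D (D V))) F d2 => W f d2.
by apply: vecP; rewrite /= d2; ring.
Qed.

Local Notation v0 := (br G V).
Local Notation v1 := (br e1 V).
Local Notation v2 := (br e2 V).

Let brc u v : cj (br u v) = br v u := br_cj hq qqi u v.
Let brd u v : dt (br u v) = br (D u) v + br u (D v) := br_dt hq qqi u v.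

Lemma w_step0 u : br G (D u) = dt (br G u) - br e1 u.
Proof. by rewrite brd -/(fr1 qi G); ring. Qed.
Lemma w_step1 u : br e1 (D u) = dt (br e1 u) - br e2 u.
Proof. by rewrite brd -/(fr2 qi G); ring. Qed.
Lemma w_step2 u : br e2 (D u) = dt (br e2 u) - (cj p * br G u - b * br e1 u).
Proof. by rewrite brd -/(fr3 qi G) -(br3l h00 h01 hq qqi); ring. Qed.

(** Here and in [cj_v1], [cj_v2] and [curv_eq], one constant entry of the Gram matrix of the frame,
    in turn <G, G>, <G, e1>, <e1, e1> and <e1, e2>, is differentiated in the deformation
    parameter. *)
Lemma cj_v0 : cj v0 = - v0.
Proof.
have := br_ds G G; rewrite (br00 _ h00) dsz => /esym/eqP.
by rewrite addr_eq0 brc => /eqP ->.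
Qed.

Lemma cj_v1 : cj v1 = v1 - dt v0.
Proof.
have := br_ds G e1; rewrite (br01 _ h00 h01) dsz T_e1 brDr brZr (br00 _ h00) mulr0 addr0.
by rewrite w_step0 -[br V _]brc => h; rewrite -[RHS]addr0 h; ring.
Qed.

Lemma cj_v2 : cj v2 = 2 * dt v1 - dt (dt v0) - v2.
Proof.
have := br_ds e1 e1; rewrite (br11 h00 h01 hq qqi) ds1 T_e1 brDr brDl brZr brZl.
rewrite (br01 _ h00 h01) (br10 h00 h01 hq qqi) !mulr0 !addr0.
rewrite w_step1 -[br (D V) _]brc w_step1 cjB cj_dt cj_v1 dtB => h.
by rewrite -[RHS]subr0 h; ring.
Qed.

Lemma curv_eq : 3 * F = - (cj (br e2 (D V)) + br e1 (D (D V))).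
Proof.
have := br_ds e1 e2; rewrite (br12 h00 h01 hq qqi) dsz T_e1 T_e2 !(brDr, brDl, brZr, brZl).
rewrite (br02 h00 h01 hq qqi) (br11 h00 h01 hq qqi) (br10 h00 h01 hq qqi) -[br (D V) _]brc.
rewrite cj_curv => h; rewrite -[RHS]addr0 h; ring.
Qed.

(** The derivative of cj p = -<e3, e2>. The factor 3 clears the denominator of the curvature in
    [curv_eq]. *)
Lemma ds_cj_p : 3 * ds (cj p) = - (3 * cj (br e2 (D (D (D V)))) + 3 * dt (dt F) - 15 * F * b
  + 3 * cj p * br G (D (D V)) - 3 * b * br e1 (D (D V))).
Proof.
have e : cj p = - br e3 e2 by rewrite (br32 hq qqi) opprK.
rewrite {1}e dsN br_ds T_e3 T_e2 !(brDr, brDl, brZr, brZl) -[br (D (D (D V))) _]brc.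
rewrite (br02 h00 h01 hq qqi) (br12 h00 h01 hq qqi) (br30 h00 h01 hq qqi).
rewrite (br31 h00 h01 hq qqi) (br3l h00 h01 hq qqi (D (D V))) -/(frame_b qi G).
rewrite !(cj_curv, cjE) !dtE; ring.
Qed.

Definition alpha := p - cj p.
Local Notation al := alpha.
(** By [cj_v1] this is v1 + cj v1, twice the component of the variation along the curve. It enters
    [first_variation] in the way of a reparametrization, under which [al] is a density of weight
    3. *)
Definition tangent_part := 2 * v1 - dt v0.

Lemma cj_alpha : cj al = - al.
Proof. by rewrite /alpha !cjE; ring. Qed.

Definition dtk n x : A := iter n (@dt A) x.

(** [w_step0], [w_step1] and [w_step2] reduce all covariant derivatives of the variation vector to
    v0, v1, v2. The reality relations then cancel v2 and leave v1 in [tangent_part] only. What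
    remains is a linear operator of order 5 on the height v0, with coefficients depending on b
    alone. *)
Lemma first_variation : 6 * ds al = 3 * dt al * tangent_part + 9 * al * dt tangent_part
  - (8 * b * dt b * v0 + 10 * b * dtk 3 v0 + 8 * b ^+ 2 * dt v0 + 15 * dt b * dtk 2 v0
     + 9 * dtk 2 b * dt v0 + 2 * dtk 3 b * v0 + 2 * dtk 5 v0).
Proof.
have e1' := ds_cj_p.
have e2' : 3 * ds p = cj (3 * ds (cj p)) by rewrite !cjE.
have cb : cj b = b := cj_b hq qqi.
have -> : 6 * ds al = 2 * (3 * ds p - 3 * ds (cj p)) by rewrite /alpha dsB; ring.
rewrite e2' e1'.
have F3 : 3 * dt (dt F) = dt (dt (3 * F)) by rewrite !dtE; ring.
have F15 : 15 * F * b = 5 * (3 * F) * b by ring.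
have cp : cj p = - dt b - p by rewrite (dt_b hq qqi); ring.
rewrite F3 F15 curv_eq /dtk /= /tangent_part /alpha.
rewrite !(w_step0, w_step1, w_step2).
have c0 := cj_v0; have c1 := cj_v1; have c2 := cj_v2.
move: (br G V) (br e1 V) (br e2 V) p b c0 c1 c2 cb cp => x0 x1 x2 y z c0 c1 c2 cb cp.
rewrite !(cjE, c0, c1, c2, cb, cp, dtE).
ring.
Qed.

End Variation.

(** * The Euler-Lagrange expression of the strain *)

Section EulerLagrange.
Variable A : diffRing.
Implicit Types x y z m b : A.

(* For m = a'/(3a) and b twice the second Fubini density this is 4 a^(-5) times the stress
   density. *)
Definition EL m b : A :=
  8 * b * dt b + 120 * b * m * dt m - 80 * b * m ^+ 3 - 20 * b * dtk 2 m
  - 16 * b ^+ 2 * m + 60 * dt b * m ^+ 2 - 30 * dt b * dt m - 18 * dtk 2 b * m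
  + 2 * dtk 3 b - 240 * m * dt m ^+ 2 + 40 * m * dtk 3 m - 160 * m ^+ 2 * dtk 2 m
  + 320 * m ^+ 3 * dt m - 64 * m ^+ 5 + 80 * dt m * dtk 2 m - 4 * dtk 4 m.

(* The boundary term of an integration by parts: c_j is z times the coefficient of the j-th
   derivative of v0 in the first variation formula. *)
Definition bilin z b x : A :=
  let c1 := z * (8 * b ^+ 2 + 9 * dtk 2 b) in
  let c2 := z * (15 * dt b) in
  let c3 := z * (10 * b) in
  let c5 := z * 2 in
  c1 * x + (c2 * dt x - dt c2 * x)
  + (c3 * dtk 2 x - dt c3 * dt x + dtk 2 c3 * x)
  + (c5 * dtk 4 x - dt c5 * dtk 3 x + dtk 2 c5 * dtk 2 x - dtk 3 c5 * dt x + dtk 4 c5 * x).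

Lemma dt_weight n z m y : dt z = - n%:R * m * z -> dt (z * y) = z * (dt y - n%:R * m * y).
Proof. by move=> dz; rewrite dtM dz; ring. Qed.

Lemma dtk1 n x : dtk n.+1 x = dt (dtk n x). Proof. by []. Qed.
Lemma dtkSr n x : dtk n.+1 x = dtk n (dt x). Proof. by rewrite /dtk iterSr. Qed.

Lemma dtk_weight2 z m : dt z = - 2 * m * z ->
  [/\ dtk 2 z = z * (4 * m ^+ 2 - 2 * dt m),
      dtk 3 z = z * (- 8 * m ^+ 3 + 12 * m * dt m - 2 * dtk 2 m),
      dtk 4 z = z * (16 * m ^+ 4 - 48 * m ^+ 2 * dt m + 16 * m * dtk 2 m
        + 12 * dt m ^+ 2 - 2 * dtk 3 m) &
      dtk 5 z = z * (- 32 * m ^+ 5 + 160 * m ^+ 3 * dt m - 80 * m ^+ 2 * dtk 2 m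
        - 120 * m * dt m ^+ 2 + 20 * m * dtk 3 m + 40 * dt m * dtk 2 m - 2 * dtk 4 m)].
Proof.
move=> dz; have dw := dt_weight _ dz.
have E2 : dtk 2 z = z * (4 * m ^+ 2 - 2 * dt m).
  by rewrite /dtk /= dz !dtE dz; ring.
have E3 : dtk 3 z = z * (- 8 * m ^+ 3 + 12 * m * dt m - 2 * dtk 2 m).
  by rewrite dtk1 E2 dw /dtk /= !dtE; ring.
have E4 : dtk 4 z = z * (16 * m ^+ 4 - 48 * m ^+ 2 * dt m + 16 * m * dtk 2 m
        + 12 * dt m ^+ 2 - 2 * dtk 3 m).
  by rewrite dtk1 E3 dw /dtk /= !dtE; ring.
split=> //.
by rewrite dtk1 E4 dw /dtk /= !dtE; ring.
Qed.

Lemma dtk2M x y : dtk 2 (x * y) = dtk 2 x * y + 2 * dt x * dt y + x * dtk 2 y.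
Proof. by rewrite /dtk /= !(dtM, dtD); ring. Qed.

Lemma dtk3M x y : dtk 3 (x * y) =
  dtk 3 x * y + 3 * dtk 2 x * dt y + 3 * dt x * dtk 2 y + x * dtk 3 y.
Proof. by rewrite dtk1 dtk2M /dtk /= !dtE; ring. Qed.

Lemma dtkc n (c : nat) x : dtk n (c%:R * x) = c%:R * dtk n x.
Proof. by elim: n => [//|n IH]; rewrite dtk1 IH dtM dtn mul0r add0r. Qed.

(** The formal adjoint of the operator of [first_variation], applied to [z], is -z [EL]. Since z' =
    -2 m z, the derivatives of [z] are [z] times polynomials in the derivatives of [m], which makes
    [EL] a polynomial in the jets of [m] and [b]. *)
Lemma bilin_dt z m b x : dt z = - 2 * m * z ->
  z * (8 * b * dt b * x + 10 * b * dtk 3 x + 8 * b ^+ 2 * dt x + 15 * dt b * dtk 2 x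
     + 9 * dtk 2 b * dt x + 2 * dtk 3 b * x + 2 * dtk 5 x)
  = dt (bilin z b x) - z * EL m b * x.
Proof.
move=> dz; have [E2 E3 E4 E5] := dtk_weight2 dz.
set c1 := z * (8 * b ^+ 2 + 9 * dtk 2 b); set c2 := z * (15 * dt b).
set c3 := z * (10 * b); set c5 := z * 2.
have dbil : dt (bilin z b x) = c1 * dt x + c2 * dtk 2 x + c3 * dtk 3 x + c5 * dtk 5 x
    + (dt c1 - dtk 2 c2 + dtk 3 c3 + dtk 5 c5) * x.
  rewrite /bilin -/c1 -/c2 -/c3 -/c5; move: c1 c2 c3 c5 => d1 d2 d3 d5.
  by rewrite /dtk /= !(dtN, dtD, dtM); ring.
have D1 : dt c1 = z * (16 * b * dt b + 9 * dtk 3 b - 2 * m * (8 * b ^+ 2 + 9 * dtk 2 b)).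
  by rewrite /c1 (dt_weight _ dz) /dtk /= !dtE; ring.
have D2 : dtk 2 c2 = dtk 2 z * (15 * dt b) + 30 * dt z * dtk 2 b + 15 * z * dtk 3 b.
  rewrite /c2 dtk2M !(dtkc 2) !dtM !dtn -dtkSr -[dt (dt b)]/(dtk 2 b); ring.
have D3 : dtk 3 c3 = 10 * (dtk 3 z * b + 3 * dtk 2 z * dt b + 3 * dt z * dtk 2 b + z * dtk 3 b).
  by rewrite /c3 dtk3M !(dtkc 3) !(dtkc 2) !dtM !dtn; ring.
have D5 : dtk 5 c5 = 2 * dtk 5 z by rewrite /c5 mulrC (dtkc 5).
rewrite dbil D1 D2 D3 D5 E2 E3 E5 dz /c1 /c2 /c3 /c5 /EL; ring.
Qed.

(** [w] is the reciprocal of the strain density, so [w] times [dt] is the derivative in the natural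
    parameter u, and [C1], [C2] stand for B_u, B_uu. As w' = -m w, the derivative of a multiple of a
    power of [w] is again a multiple of that power. *)
Lemma EL_natural m b w : dt w = - 1 * m * w ->
  let B := w ^+ 2 * (b - 2 * dt m + m ^+ 2) in
  let C1 := w * dt B in
  let C2 := w * dt C1 in
  2 * w * dt C2 + 8 * B * C1 = w ^+ 5 * EL m b.
Proof.
move=> dw /=.
have wt n y : dt (w ^+ n.+1 * y) = w ^+ n.+1 * (dt y - n.+1%:R * m * y).
  by apply: dt_weight; rewrite dtX dw /= exprS; ring.
set X := b - 2 * dt m + m ^+ 2.
have -> : w * dt (w ^+ 2 * X) = w ^+ 3 * (dt X - 2 * m * X) by rewrite wt; ring.
set X1 := dt X - 2 * m * X.
have -> : w * dt (w ^+ 3 * X1) = w ^+ 4 * (dt X1 - 3 * m * X1) by rewrite wt; ring.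
set X2 := dt X1 - 3 * m * X1.
rewrite wt.
have d1 : dt X = dt b - 2 * dtk 2 m + 2 * m * dt m.
  by rewrite /X /dtk /= !dtE; ring.
have d2 : dtk 2 X = dtk 2 b - 2 * dtk 3 m + 2 * m * dtk 2 m + 2 * dt m ^+ 2.
  by rewrite dtk1 [dtk 1 X]d1 /dtk /= !dtE; ring.
have d3 : dtk 3 X = dtk 3 b - 2 * dtk 4 m + 2 * m * dtk 3 m + 6 * dt m * dtk 2 m.
  by rewrite dtk1 d2 /dtk /= !dtE; ring.
have f1 : dt X1 = dtk 2 X - 2 * dt m * X - 2 * m * dt X.
  by rewrite /X1; move: (X) => Y; rewrite /dtk /= !dtE; ring.
have f2 : dtk 2 X1 = dtk 3 X - 2 * dtk 2 m * X - 4 * dt m * dt X - 2 * m * dtk 2 X.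
  by rewrite dtk1 [dtk 1 X1]f1; move: (X) => Y; rewrite /dtk /= !dtE; ring.
have g1 : dt X2 = dtk 2 X1 - 3 * dt m * X1 - 3 * m * dt X1.
  by rewrite /X2; move: (X1) => Y; rewrite /dtk /= !dtE; ring.
rewrite g1 f2 /X2 f1 /X1 d3 d2 d1 /X /EL; ring.
Qed.

End EulerLagrange.

Section StrainVariation.
Variable A : diffRing.
Variables (G : vec A) (q qi nu m s z : A).
Hypotheses (h00 : hm G G = 0) (h01 : hm G (vdt G) = 0)
  (hq : hm (vdt G) (vdt G) = q) (qqi : q * qi = 1) (hnu : cj nu + nu = - (ds q * qi)).
Local Notation al := (alpha G qi).
Local Notation b := (frame_b qi G).
Local Notation v0 := (br qi G (covs nu G)).
Hypotheses (ds_ : dt s = m * s) (dal : dt al = 3 * m * al) (zal : z * al = s)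
  (dz : dt z = - 2 * m * z) (dss : 3 * ds s = z * ds al).

(** The weights match: s' = m s, al' = 3 m al and z al = s, so the tangential terms of
    [first_variation] multiplied by [z] are the total derivative of 9 s [tangent_part]. The height
    terms are integrated by parts with [bilin_dt]. *)
Lemma strain_variation : 18 * ds s =
  dt (9 * s * tangent_part G qi nu - bilin z b v0) + z * EL m b * v0.
Proof.
transitivity (z * (6 * ds al)).
  by transitivity (6 * (3 * ds s)); [ring|rewrite dss; ring].
rewrite (first_variation h00 h01 hq qqi hnu) mulrBr (bilin_dt _ _ dz) (dtB (9 * s * _)).
rewrite dal !dtM dtn ds_.
transitivity (9 * m * (z * al) * tangent_part G qi nu + 9 * (z * al) * dt (tangent_part G qi nu) -
  (dt (bilin z b v0) - z * EL m b * v0)); first by ring.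
by rewrite zal; ring.
Qed.

End StrainVariation.

(** * The strain density in the differential ring *)

Section Strain.
Variable A : diffRing.
Variables (al ai s : A).
Hypotheses (ala : al * ai = 1) (s6 : s ^+ 6 * - 4 = al * al).
(** The logarithmic derivative al'/(3 al), as 2 [sixth] is 1/3. For al = 2ia and s = |a|^(1/3) the
    hypothesis [s6] is s^6 = a^2 multiplied by -4; sixth powers avoid the absolute value. *)
Definition strain_m := 2 * sixth * ai * dt al.
Local Notation m := strain_m.
Local Notation z := (s * ai).

Lemma strain_dal : dt al = 3 * m * al.
Proof.
transitivity ((6 * sixth) * (al * ai) * dt al); last by rewrite /strain_m; ring.
by rewrite sixthE ala !mul1r.
Qed.

Lemma strain_dt : dt s = m * s.
Proof.
have h : 6 * s ^+ 5 * dt s * - 4 = dt al * al + al * dt al.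
  by rewrite -dtM -s6 dtM dtX dtN dtn oppr0 mulr0 addr0.
transitivity ((6 * sixth) * (al * ai) ^+ 2 * dt s); first by rewrite sixthE ala expr1n !mul1r.
transitivity (sixth * ai ^+ 2 * s * (6 * s ^+ 5 * dt s * - 4)).
  by rewrite exprMn [al ^+ 2]expr2 -s6; ring.
rewrite h; transitivity (2 * sixth * ai * dt al * s * (al * ai)); first by ring.
by rewrite ala mulr1.
Qed.

Lemma strain_ds : 3 * ds s = z * ds al.
Proof.
have h : 6 * s ^+ 5 * ds s * - 4 = 2 * al * ds al.
  transitivity (ds (al * al)); last by rewrite dsM; ring.
  by rewrite -s6 dsM dsN dsn oppr0 mulr0 addr0 !(exprS s) expr0 mulr1 !dsM; ring.
transitivity (3 * (al * ai) ^+ 2 * ds s); first by rewrite ala expr1n mulr1.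
transitivity (3 * sixth * ai ^+ 2 * s * (6 * s ^+ 5 * ds s * - 4)).
  transitivity ((6 * sixth) * (3 * ai ^+ 2 * (s ^+ 6 * - 4) * ds s)); last by ring.
  by rewrite sixthE mul1r s6; ring.
rewrite h; transitivity ((6 * sixth) * (al * ai) * (s * ai * ds al)); first by ring.
by rewrite sixthE ala !mul1r.
Qed.

Lemma strain_z : z * al = s.
Proof. by rewrite -mulrA [ai * al]mulrC ala mulr1. Qed.

Lemma strain_dz : dt z = - 2 * m * z.
Proof.
rewrite dtM strain_dt (dt_inv ala) strain_dal.
transitivity (m * s * ai - 3 * m * (al * ai) * s * ai); first by ring.
by rewrite ala; ring.
Qed.

Lemma alpha_derivs :
  [/\ dt al = al * (3 * m), dtk 2 al = al * (9 * m ^+ 2 + 3 * dt m),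
      dtk 3 al = al * (27 * m * dt m + 27 * m ^+ 3 + 3 * dtk 2 m),
      dtk 4 al = al * (36 * m * dtk 2 m + 162 * m ^+ 2 * dt m + 81 * m ^+ 4
        + 27 * dt m ^+ 2 + 3 * dtk 3 m) &
      dtk 5 al = al * (405 * m * dt m ^+ 2 + 45 * m * dtk 3 m + 270 * m ^+ 2 * dtk 2 m
        + 810 * m ^+ 3 * dt m + 243 * m ^+ 5 + 90 * dt m * dtk 2 m + 3 * dtk 4 m)].
Proof.
have := strain_dal; move: m => n dal.
have D x : dt (al * x) = al * (dt x + 3 * n * x) by rewrite dtM dal; ring.
have E1 : dt al = al * (3 * n) by rewrite dal; ring.
have E2 : dtk 2 al = al * (9 * n ^+ 2 + 3 * dt n).
  by rewrite dtk1 [dtk 1 al]E1 D !dtE; ring.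
have E3 : dtk 3 al = al * (27 * n * dt n + 27 * n ^+ 3 + 3 * dtk 2 n).
  by rewrite dtk1 E2 D /dtk /= !dtE; ring.
have E4 : dtk 4 al = al * (36 * n * dtk 2 n + 162 * n ^+ 2 * dt n + 81 * n ^+ 4
        + 27 * dt n ^+ 2 + 3 * dtk 3 n).
  by rewrite dtk1 E3 D /dtk /= !dtE; ring.
split=> //.
by rewrite dtk1 E4 D /dtk /= !dtE; ring.
Qed.

End Strain.

(** * Smooth functions as a differential ring *)

Section ComplexParts.
Variable R : realType.
Implicit Types x y : complex R.
Lemma ReD x y : Re (x + y) = Re x + Re y. Proof. by case: x y => [? ?] [? ?]. Qed.
Lemma ImD x y : Im (x + y) = Im x + Im y. Proof. by case: x y => [? ?] [? ?]. Qed.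
Lemma ReN x : Re (- x) = - Re x. Proof. by case: x. Qed.
Lemma ImN x : Im (- x) = - Im x. Proof. by case: x. Qed.
Lemma ReM x y : Re (x * y) = Re x * Re y - Im x * Im y.
Proof. by case: x y => [? ?] [? ?]. Qed.
Lemma ImM x y : Im (x * y) = Re x * Im y + Im x * Re y.
Proof. by case: x y => [? ?] [? ?]. Qed.
Lemma ReJ x : Re (conjc x) = Re x. Proof. by case: x. Qed.
Lemma ImJ x : Im (conjc x) = - Im x. Proof. by case: x. Qed.
Lemma complexP x y : Re x = Re y -> Im x = Im y -> x = y.
Proof. by case: x y => [? ?] [? ?] /= -> ->. Qed.
End ComplexParts.

Record openset (R : realType) := OpenSet { oset : set (R * R); osetP : open oset }.
Arguments osetP {R} _.

Section SmoothComplex.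
Variable R : realType.
Local Notation C := (complex R).
Implicit Types (f g : R -> R -> C) (p : R * R).

Record smC (U : set (R * R)) f : Prop := SmC {
  smRe : sm2 U (fun t s => Re (f t s)); smIm : sm2 U (fun t s => Im (f t s)) }.

Definition dC2 d f t s : C :=
  Complex (dpart d (fun t s => Re (f t s)) t s) (dpart d (fun t s => Im (f t s)) t s).

Variable O : openset R.
Local Notation U := (oset O).
Let oU := osetP O.

Lemma smC_eqon f g : (forall p, U p -> f p.1 p.2 = g p.1 p.2) -> smC U f -> smC U g.
Proof.
move=> fg [h1 h2]; split.
- by apply: smooth2_eqon h1 => // p /fg /= ->.
- by apply: smooth2_eqon h2 => // p /fg /= ->.
Qed.
Lemma smC_cst (c : C) : smC U (fun _ _ => c).
Proof. by split; exact: smooth2_cst. Qed.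
Lemma smCD f g : smC U f -> smC U g -> smC U (fun t s => f t s + g t s).
Proof.
move=> [f1 f2] [g1 g2]; split.
- apply: smooth2_eqon (smooth2D oU f1 g1) => // p _; by rewrite ReD.
- apply: smooth2_eqon (smooth2D oU f2 g2) => // p _; by rewrite ImD.
Qed.
Lemma smCN f : smC U f -> smC U (fun t s => - f t s).
Proof.
move=> [f1 f2]; split.
- apply: smooth2_eqon (smooth2N oU f1) => // p _; by rewrite ReN.
- apply: smooth2_eqon (smooth2N oU f2) => // p _; by rewrite ImN.
Qed.
Lemma smCM f g : smC U f -> smC U g -> smC U (fun t s => f t s * g t s).
Proof.
move=> [f1 f2] [g1 g2]; split.
- apply: smooth2_eqon (smooth2D oU (smooth2M oU f1 g1) (smooth2N oU (smooth2M oU f2 g2))) => // p _.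
  by rewrite ReM.
- apply: smooth2_eqon (smooth2D oU (smooth2M oU f1 g2) (smooth2M oU f2 g1)) => // p _.
  by rewrite ImM.
Qed.
Lemma smCJ f : smC U f -> smC U (fun t s => conjc (f t s)).
Proof.
move=> [f1 f2]; split.
- apply: smooth2_eqon f1 => // p _; by rewrite ReJ.
- apply: smooth2_eqon (smooth2N oU f2) => // p _; by rewrite ImJ.
Qed.
Lemma smC_d d f : smC U f -> smC U (dC2 d f).
Proof. by move=> [f1 f2]; split; exact: smooth2_dpart. Qed.

Lemma dC2_eqon d f g : (forall p, U p -> f p.1 p.2 = g p.1 p.2) ->
  forall p, U p -> dC2 d f p.1 p.2 = dC2 d g p.1 p.2.
Proof.
move=> fg p Up; congr Complex; apply: (eqon_dpart d oU) Up => r /fg /= h; by rewrite h.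
Qed.

Lemma dC2D d f g p : smC U f -> smC U g -> U p ->
  dC2 d (fun t s => f t s + g t s) p.1 p.2 = dC2 d f p.1 p.2 + dC2 d g p.1 p.2.
Proof.
move=> [f1 f2] [g1 g2] Up; apply: complexP; rewrite ?ReD ?ImD /=.
- have -> : (fun t s => Re (f t s + g t s)) = (fun t s => Re (f t s) + Re (g t s)).
    by apply/funext => t; apply/funext => s; rewrite ReD.
  exact: (dpartD d (smooth2_reg1 f1 Up) (smooth2_reg1 g1 Up)).
- have -> : (fun t s => Im (f t s + g t s)) = (fun t s => Im (f t s) + Im (g t s)).
    by apply/funext => t; apply/funext => s; rewrite ImD.
  exact: (dpartD d (smooth2_reg1 f2 Up) (smooth2_reg1 g2 Up)).
Qed.

Lemma dC2M d f g p : smC U f -> smC U g -> U p ->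
  dC2 d (fun t s => f t s * g t s) p.1 p.2 =
  dC2 d f p.1 p.2 * g p.1 p.2 + f p.1 p.2 * dC2 d g p.1 p.2.
Proof.
move=> [f1 f2] [g1 g2] Up.
have r1 := smooth2_reg1 f1 Up; have r2 := smooth2_reg1 f2 Up.
have r3 := smooth2_reg1 g1 Up; have r4 := smooth2_reg1 g2 Up.
have m13 := smooth2_reg1 (smooth2M oU f1 g1) Up.
have m24 := smooth2_reg1 (smooth2M oU f2 g2) Up.
have m24' := smooth2_reg1 (smooth2N oU (smooth2M oU f2 g2)) Up.
have m14 := smooth2_reg1 (smooth2M oU f1 g2) Up.
have m23 := smooth2_reg1 (smooth2M oU f2 g1) Up.
have reN h : reg1 h p -> dpart d (fun t s => - h t s) p.1 p.2 = - dpart d h p.1 p.2.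
  move=> [_ d1 d2]; rewrite /dpart; case: d.
    by rewrite !derive1E (deriveN d2).
  by rewrite !derive1E (deriveN d1).
apply: complexP; rewrite ?ReD ?ImD ?ReM ?ImM /=.
- have -> : (fun t s => Re (f t s * g t s)) =
    (fun t s => Re (f t s) * Re (g t s) + - (Im (f t s) * Im (g t s))).
    by apply/funext => t; apply/funext => s; rewrite ReM.
  by rewrite (dpartD d m13 m24') reN// !dpartM//; ring.
- have -> : (fun t s => Im (f t s * g t s)) =
    (fun t s => Re (f t s) * Im (g t s) + Im (f t s) * Re (g t s)).
    by apply/funext => t; apply/funext => s; rewrite ImM.
  by rewrite (dpartD d m14 m23) !dpartM//; ring.
Qed.

Lemma dC2J d f p : smC U f -> U p ->
  dC2 d (fun t s => conjc (f t s)) p.1 p.2 = conjc (dC2 d f p.1 p.2).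
Proof.
move=> [f1 f2] Up; apply: complexP; rewrite ?ReJ ?ImJ /=.
  by congr (dpart d _ _ _); apply/funext => t; apply/funext => s; rewrite ReJ.
have -> : (fun t s => Im (conjc (f t s))) = (fun t s => - Im (f t s)).
  by apply/funext => t; apply/funext => s; rewrite ImJ.
have [_ d1 d2] := smooth2_reg1 f2 Up.
by rewrite /dpart; case: d; rewrite !derive1E ?(deriveN d2) ?(deriveN d1).
Qed.

Lemma dC2_cst d (c : C) t s : dC2 d (fun _ _ => c) t s = 0.
Proof. by rewrite /dC2 /dpart; case: d; rewrite !derive1_cst. Qed.

(** Members vanish off [U], so that equality on [U] is equality, as the ring laws demand. *)
Record sf := Sf { sfun :> R -> R -> C;
  sf_smooth : smC U sfun; sf_off : forall p, ~ U p -> sfun p.1 p.2 = 0 }.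

Lemma sfext (x y : sf) : (forall p, U p -> x p.1 p.2 = y p.1 p.2) -> x = y.
Proof.
case: x y => [f f1 f2] [g g1 g2] /= fg.
have e : f = g.
  apply/funext => t; apply/funext => s.
  by have [/fg //|nU] := pselect (U (t, s)); rewrite (f2 (t, s))// (g2 (t, s)).
by subst g; congr Sf; exact: Prop_irrelevance.
Qed.

Definition cut f t s : C := if pselect (U (t, s)) then f t s else 0.
Lemma cutE f p : U p -> cut f p.1 p.2 = f p.1 p.2.
Proof. by case: p => t s Up; rewrite /cut; case: pselect. Qed.
Lemma cut_smooth f : smC U f -> smC U (cut f).
Proof. by apply: smC_eqon => p Up; rewrite cutE. Qed.
Lemma cut_off f p : ~ U p -> cut f p.1 p.2 = 0.
Proof. by case: p => t s Up; rewrite /cut; case: pselect. Qed.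
Definition sfmk f (h : smC U f) : sf := Sf (cut_smooth h) (@cut_off f).
Lemma sfmkE f (h : smC U f) p : U p -> sfmk h p.1 p.2 = f p.1 p.2.
Proof. exact: cutE. Qed.

Definition sf_add (x y : sf) := sfmk (smCD (sf_smooth x) (sf_smooth y)).
Definition sf_opp (x : sf) := sfmk (smCN (sf_smooth x)).
Definition sf_mul (x y : sf) := sfmk (smCM (sf_smooth x) (sf_smooth y)).
Definition sf_cst (c : C) := sfmk (smC_cst c).
Definition sf_cj (x : sf) := sfmk (smCJ (sf_smooth x)).
Definition sf_d d (x : sf) := sfmk (smC_d d (sf_smooth x)).

HB.instance Definition _ := gen_eqMixin sf.
HB.instance Definition _ := gen_choiceMixin sf.

Fact sf_addA : associative sf_add.
Proof. by move=> x y z; apply: sfext => p Up; rewrite !sfmkE// addrA. Qed.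
Fact sf_addC : commutative sf_add.
Proof. by move=> x y; apply: sfext => p Up; rewrite !sfmkE// addrC. Qed.
Fact sf_add0 : left_id (sf_cst 0) sf_add.
Proof. by move=> x; apply: sfext => p Up; rewrite !sfmkE// add0r. Qed.
Fact sf_addN : left_inverse (sf_cst 0) sf_opp sf_add.
Proof. by move=> x; apply: sfext => p Up; rewrite !sfmkE// addNr. Qed.
HB.instance Definition _ := GRing.isZmodule.Build sf sf_addA sf_addC sf_add0 sf_addN.

Fact sf_mulA : associative sf_mul.
Proof. by move=> x y z; apply: sfext => p Up; rewrite !sfmkE// mulrA. Qed.
Fact sf_mulC : commutative sf_mul.
Proof. by move=> x y; apply: sfext => p Up; rewrite !sfmkE// mulrC. Qed.
Fact sf_mul1 : left_id (sf_cst 1) sf_mul.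
Proof. by move=> x; apply: sfext => p Up; rewrite !sfmkE// mul1r. Qed.
Fact sf_mulDl : left_distributive sf_mul sf_add.
Proof. by move=> x y z; apply: sfext => p Up; rewrite !sfmkE// mulrDl. Qed.
HB.instance Definition _ := GRing.Zmodule_isComPzRing.Build sf sf_mulA sf_mulC sf_mul1 sf_mulDl.

Lemma sfD (x y : sf) p : U p -> (x + y) p.1 p.2 = x p.1 p.2 + y p.1 p.2.
Proof. exact: sfmkE. Qed.
Lemma sfN (x : sf) p : U p -> (- x) p.1 p.2 = - x p.1 p.2.
Proof. exact: sfmkE. Qed.
Lemma sfM (x y : sf) p : U p -> (x * y) p.1 p.2 = x p.1 p.2 * y p.1 p.2.
Proof. exact: sfmkE. Qed.
Lemma sf1 p : U p -> (1 : sf) p.1 p.2 = 1.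
Proof. exact: sfmkE. Qed.
Lemma sf0 p : U p -> (0 : sf) p.1 p.2 = 0.
Proof. exact: sfmkE. Qed.
Lemma sfn n p : U p -> (n%:R : sf) p.1 p.2 = n%:R.
Proof.
by move=> Up; elim: n => [|n IH]; rewrite ?mulr0n ?sf0// mulrS sfD// sf1// IH mulrS.
Qed.

Fact sf_dD d (x y : sf) : sf_d d (x + y) = sf_d d x + sf_d d y.
Proof.
apply: sfext => p Up; rewrite sfD// !sfmkE// -dC2D//; try exact: sf_smooth.
by apply: dC2_eqon Up => r Ur; rewrite sfD.
Qed.
Fact sf_dM d (x y : sf) : sf_d d (x * y) = sf_d d x * y + x * sf_d d y.
Proof.
apply: sfext => p Up; rewrite sfD// !sfM// !sfmkE// -dC2M//; try exact: sf_smooth.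
by apply: dC2_eqon Up => r Ur; rewrite sfM.
Qed.
Lemma sf_dE d (x : sf) p : U p -> sf_d d x p.1 p.2 = dC2 d x p.1 p.2.
Proof.
move=> Up.
change (cut (dC2 d x) p.1 p.2 = dC2 d x p.1 p.2).
exact (cutE (dC2 d x) Up).
Qed.
Lemma sf_ddE d e (x : sf) p : U p ->
  sf_d d (sf_d e x) p.1 p.2 = dC2 d (dC2 e x) p.1 p.2.
Proof.
move=> Up.
rewrite sf_dE.
2: exact Up.
have h : forall p, U p -> sf_d e x p.1 p.2 = dC2 e x p.1 p.2.
  move=> r Ur.
  exact (sf_dE e x Ur).
exact (dC2_eqon d h Up).
Qed.
Fact sf_dC (x : sf) : sf_d true (sf_d false x) = sf_d false (sf_d true x).
Proof.
apply: sfext => p Up.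
apply: etrans (sf_ddE true false x Up) _.
apply: etrans (esym (sf_ddE false true x Up)).
have [h1 h2] := sf_smooth x.
have e1 := dpartC oU h1 Up; have e2 := dpartC oU h2 Up.
by rewrite /dC2 e1 e2.
Qed.
Lemma sf_cjE (x : sf) p : U p -> sf_cj x p.1 p.2 = conjc (x p.1 p.2).
Proof.
by move=> Up; exact (cutE (fun t s => conjc (x t s)) Up).
Qed.
Fact sf_cjD (x y : sf) : sf_cj (x + y) = sf_cj x + sf_cj y.
Proof. by apply: sfext => p Up; rewrite sfD// !sf_cjE// sfD// rmorphD. Qed.
Fact sf_cjM (x y : sf) : sf_cj (x * y) = sf_cj x * sf_cj y.
Proof. by apply: sfext => p Up; rewrite sfM// !sf_cjE// sfM// rmorphM. Qed.
Fact sf_cjK (x : sf) : sf_cj (sf_cj x) = x.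
Proof. by apply: sfext => p Up; rewrite !sf_cjE//; case: (x _ _) => a b /=; rewrite opprK. Qed.
Fact sf_cj1 : sf_cj 1 = 1.
Proof. by apply: sfext => p Up; rewrite sf_cjE// sf1// rmorph1. Qed.
Fact sf_cj_d d (x : sf) : sf_cj (sf_d d x) = sf_d d (sf_cj x).
Proof.
apply: sfext => p Up.
apply: etrans (sf_cjE _ Up) _; rewrite (sf_dE d x Up).
apply: etrans (esym (sf_dE d (sf_cj x) Up)).
rewrite -(dC2J d (sf_smooth x) Up).
have h r : U r -> conjc (x r.1 r.2) = sf_cj x r.1 r.2 by move=> Ur; rewrite sf_cjE.
exact (dC2_eqon d h Up).
Qed.
Lemma sf_cstE c p : U p -> sf_cst c p.1 p.2 = c.
Proof. by move=> Up; exact (cutE (fun _ _ => c) Up). Qed.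
Fact sf_iiM : sf_cst (iC R) * sf_cst (iC R) = -1.
Proof.
apply: sfext => p Up; rewrite sfM// sf_cstE// sfN// sf1//.
by apply: complexP; rewrite ?ReM ?ImM ?ReN ?ImN /=; ring.
Qed.
Fact sf_cj_ii : sf_cj (sf_cst (iC R)) = - sf_cst (iC R).
Proof.
apply: sfext => p Up; rewrite sfN// sf_cjE// sf_cstE//.
by apply: complexP; rewrite ?ReN ?ImN /= ?oppr0.
Qed.
Fact sf_d_cst d c : sf_d d (sf_cst c) = 0.
Proof.
apply: sfext => p Up; rewrite sf0// (sf_dE _ _ Up) -(dC2_cst d c p.1 p.2).
have h r : U r -> sf_cst c r.1 r.2 = c by exact: sf_cstE.
exact (dC2_eqon d h Up).
Qed.
Fact sf_sixth : 6 * sf_cst (6^-1) = 1.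
Proof.
apply: sfext => p Up; by rewrite sfM// sf_cstE// sfn// sf1// divff//.
Qed.

Definition sfR : diffRing := DiffRing (sf_dD false) (sf_dM false) (sf_dD true)
  (sf_dM true) sf_dC sf_cjD sf_cjM sf_cjK sf_cj1 (sf_cj_d false) (sf_cj_d true)
  sf_iiM sf_cj_ii (sf_d_cst false _) (sf_d_cst true _) sf_sixth.

(** An interface to [sf]. Through [smoothRing_exists] only its inhabitation is known, so conversion
    cannot unfold ring operations into functions and partial derivatives. *)
Record smoothRing := SmoothRing {
  srsort :> diffRing;
  ev : srsort -> R -> R -> C;
  ev_smooth : forall x, smC U (ev x);
  ev_ext : forall x y, (forall p, U p -> ev x p.1 p.2 = ev y p.1 p.2) -> x = y;
  mk : forall f, smC U f -> srsort;
  ev_mk : forall f (h : smC U f) p, U p -> ev (mk h) p.1 p.2 = f p.1 p.2;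
  ev0 : forall p, U p -> ev 0 p.1 p.2 = 0;
  ev1 : forall p, U p -> ev 1 p.1 p.2 = 1;
  evD : forall x y p, U p -> ev (x + y) p.1 p.2 = ev x p.1 p.2 + ev y p.1 p.2;
  evN : forall x p, U p -> ev (- x) p.1 p.2 = - ev x p.1 p.2;
  evM : forall x y p, U p -> ev (x * y) p.1 p.2 = ev x p.1 p.2 * ev y p.1 p.2;
  ev_dt : forall x p, U p -> ev (dt x) p.1 p.2 = dC2 false (ev x) p.1 p.2;
  ev_ds : forall x p, U p -> ev (ds x) p.1 p.2 = dC2 true (ev x) p.1 p.2;
  ev_cj : forall x p, U p -> ev (cj x) p.1 p.2 = conjc (ev x p.1 p.2);
  ev_ii : forall p, U p -> ev ii p.1 p.2 = iC R
}.

Lemma smoothRing_exists : inhabited smoothRing.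
Proof.
constructor.
exact (@SmoothRing sfR sfun sf_smooth sfext (fun f h => sfmk h) (fun f h p Up => cutE f Up)
  sf0 sf1 sfD sfN sfM (sf_dE false) (sf_dE true) sf_cjE (sf_cstE (iC R))).
Qed.

End SmoothComplex.

(** * Ring maps compatible with the frame *)

Section Morphism.
Variables (A : diffRing) (f : A -> A).
Hypotheses (fD : forall x y, f (x + y) = f x + f y) (fM : forall x y, f (x * y) = f x * f y)
  (f1 : f 1 = 1) (f_dt : forall x, f (dt x) = dt (f x))
  (f_cj : forall x, f (cj x) = cj (f x)) (f_ii : f ii = ii).

Lemma mor0 : f 0 = 0.
Proof. by apply: (addrI (f 0)); rewrite -fD !addr0. Qed.
Lemma morN x : f (- x) = - f x.
Proof. by apply/eqP; rewrite -addr_eq0 -fD addNr mor0. Qed.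
Lemma morn n : f n%:R = n%:R.
Proof. by elim: n => [|n IH]; [rewrite mulr0n mor0|rewrite mulrS fD f1 IH]. Qed.
Lemma mor_sixth : f sixth = sixth.
Proof.
apply: (inv_uniq (x := 6)); last exact: sixthE.
by rewrite -[6](morn 6) -fM sixthE f1.
Qed.

Definition vmap (u : vec A) : vec A := (f u.1.1, f u.1.2, f u.2).

Lemma mor_hm u v : hm (vmap u) (vmap v) = f (hm u v).
Proof. by rewrite /hm -!lock /= !(fD, fM, morN, f_cj, f_ii). Qed.
Lemma mor_vdt u : vdt (vmap u) = vmap (vdt u).
Proof. by rewrite /vdt /vmap /= !f_dt. Qed.
Lemma mor_conn qi u : conn (f qi) (vmap u) = f (conn qi u).
Proof.
by rewrite /conn !mor_vdt !mor_hm !(morN, morn, mor_sixth, fM, fD).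
Qed.
Lemma mor_cov k u : cov (f k) (vmap u) = vmap (cov k u).
Proof. by rewrite !covE mor_vdt; apply: vecP; rewrite /= !(fD, fM). Qed.
Lemma mor_frame_b qi u : frame_b (f qi) (vmap u) = f (frame_b qi u).
Proof. by rewrite /frame_b /fr2 /fr1 /br mor_conn !mor_cov mor_hm fM. Qed.
Lemma mor_frame_p qi u : frame_p (f qi) (vmap u) = f (frame_p qi u).
Proof. by rewrite /frame_p /fr3 /fr2 /fr1 /br mor_conn !mor_cov mor_hm morN fM. Qed.

End Morphism.

(** * Pointwise properties of the Hermitian form *)

Section HermAlgebra.
Variable R : realType.
Local Notation C := (complex R).
Implicit Types (u v w : V3 R) (l : C).

(** The form has Lorentz signature, so it is positive on the orthogonal complement of the null
    vector [u] modulo its line. If the first coordinate of [u] is not 0, subtracting from [v] the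
    multiple of [u] with the same first coordinate leaves (0, w2, w3) with <v, v> = |w2|^2, and
    orthogonality to [u] forces w3 = 0 once w2 = 0. Otherwise [u] is a multiple of the third basis
    vector and the first coordinate of [v] is already 0. *)
Lemma herm_pos u v : nonzeroV3 u -> herm u u = 0 -> herm u v = 0 -> ~ in_line v u ->
  exists2 r : R, 0 < r & herm v v = Complex r 0.
Proof.
case: u v => [[u1 u2] u3] [[v1 v2] v3]; rewrite /nonzeroV3 /in_line /herm /scaleV3 /mkV3 /c1 /c2 /c3 /=.
move=> u0 huu huv nl.
have i0 : iC R != 0 by rewrite eq_complex /= oner_eq0 andbF.
have conj0 (x : C) : conjc x = 0 -> x = 0.
  by move=> h; apply/eqP; rewrite -conjc_eq0 h.
have nrm (x : C) : conjc x * x = Complex (Re x ^+ 2 + Im x ^+ 2) 0.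
  by case: x => x1 x2; apply: complexP => /=; ring.
have pos (x : C) : x != 0 -> 0 < Re x ^+ 2 + Im x ^+ 2.
  move=> x0; rewrite lt0r addr_ge0 ?sqr_ge0// andbT; apply: contra x0.
  by rewrite paddr_eq0 ?sqr_ge0// !sqrf_eq0 eq_complex.
have [l [w2 [h1 h2]]] : exists l (w2 : C), iC R * (conjc v1 * v3 - conjc v3 * v1) + conjc v2 * v2 = conjc w2 * w2
    /\ (w2 = 0 -> (v1, v2, v3) = (l * u1, l * u2, l * u3)).
  have [u10|u10] := eqVneq u1 0.
    subst u1; have u20 : u2 = 0.
      have : conjc u2 * u2 = 0 by move: huu; rewrite conjc0; move=> h; rewrite -[RHS]h; ring.
      by move/eqP; rewrite mulf_eq0 => /orP[/eqP/conj0|/eqP].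
    subst u2; have u30 : u3 != 0 by apply/eqP => h; apply: u0; rewrite h.
    have v10 : v1 = 0.
      have : iC R * conjc u3 * v1 = 0.
        by move: huv; rewrite !conjc0 => h; rewrite -[RHS]oppr0 -h; ring.
      move/eqP; rewrite !mulf_eq0 (negbTE i0) conjc_eq0 (negbTE u30) => /eqP //.
    subst v1; exists (v3 / u3), v2; split; first by rewrite conjc0; ring.
    by move=> ->; rewrite !mulr0 divfK.
  exists (v1 / u1), (v2 - v1 / u1 * u2).
  set l := v1 / u1; have v1E : v1 = l * u1 by rewrite divfK.
  pose w2 := v2 - l * u2; pose w3 := v3 - l * u3.
  have v2E : v2 = w2 + l * u2 by rewrite subrK.
  have v3E : v3 = w3 + l * u3 by rewrite subrK.
  clearbody l; rewrite -/w2; clearbody w2 w3; subst v1 v2 v3.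
  have huw : iC R * (conjc u1 * w3) + conjc u2 * w2 = 0.
    transitivity ((iC R * (conjc u1 * (w3 + l * u3) - conjc u3 * (l * u1)) +
        conjc u2 * (w2 + l * u2)) -
      l * (iC R * (conjc u1 * u3 - conjc u3 * u1) + conjc u2 * u2)); first by ring.
    by rewrite huv huu mulr0 subrr.
  have huw' : - iC R * (u1 * conjc w3) + u2 * conjc w2 = 0.
    have ci : conjc (iC R) = - iC R by apply: complexP; rewrite ?ReN ?ImN /= ?oppr0.
    have cD (x y : C) : conjc (x + y) = conjc x + conjc y by exact: rmorphD.
    have cM (x y : C) : conjc (x * y) = conjc x * conjc y by exact: rmorphM.
    by have := congr1 conjc huw; rewrite conjc0 cD !cM !conjcK ci.
  split.
    rewrite !rmorphD !rmorphM /=.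
    have e : iC R * (conjc l * conjc u1 * (w3 + l * u3) - (conjc w3 + conjc l * conjc u3) * (l * u1)) +
      (conjc w2 + conjc l * conjc u2) * (w2 + l * u2) = conjc w2 * w2 +
      conjc l * (iC R * (conjc u1 * w3) + conjc u2 * w2) + l * (- iC R * (u1 * conjc w3) + u2 * conjc w2)
      + conjc l * l * (iC R * (conjc u1 * u3 - conjc u3 * u1) + conjc u2 * u2) by ring.
    by rewrite e huw huw' huu !mulr0 !addr0.
  move=> w20; subst w2; have w30 : w3 = 0.
    move: huw; rewrite mulr0 addr0 => /eqP.
    by rewrite !mulf_eq0 (negbTE i0) conjc_eq0 (negbTE u10) => /eqP.
  by rewrite w30 !add0r.
exists (Re w2 ^+ 2 + Im w2 ^+ 2); last by rewrite h1 nrm.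
apply: pos; apply/eqP => w20; apply: nl; exists l; exact: h2.
Qed.

Lemma herm_real u : Im (herm u u) = 0.
Proof.
by case: u => [[[? ?] [? ?]] [? ?]]; rewrite /herm /c1 /c2 /c3 /= ; ring.
Qed.

Lemma herm_conj u v : conjc (herm u v) = herm v u.
Proof.
case: u v => [[[? ?] [? ?]] [? ?]] [[[? ?] [? ?]] [? ?]].
by apply: complexP; rewrite /herm /c1 /c2 /c3 /=; ring.
Qed.

Lemma herm_scale l u v : herm (scaleV3 l u) (scaleV3 l v) = conjc l * l * herm u v.
Proof.
by rewrite /herm /scaleV3 /mkV3 /c1 /c2 /c3 /= !rmorphM; ring.
Qed.

End HermAlgebra.

(** * Evaluation of ring elements at points *)

Section Evaluation.
Variable R : realType.
Local Notation C := (complex R).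
Variables (O : openset R) (S : smoothRing O).
Local Notation U := (oset O).
Let oU := osetP O.
Implicit Types (x y : S) (g u v w : vec S) (G : R -> R -> V3 R) (p : R * R).

Lemma evn n p : U p -> ev (n%:R : S) p.1 p.2 = n%:R.
Proof.
by move=> Up; elim: n => [|n IH]; [rewrite mulr0n ev0|rewrite !mulrS evD// ev1// IH].
Qed.

Lemma evX x n p : U p -> ev (x ^+ n) p.1 p.2 = ev x p.1 p.2 ^+ n.
Proof.
by move=> Up; elim: n => [|n IH]; [rewrite !expr0 ev1|rewrite !exprS evM// IH].
Qed.

Definition real_el x := forall p, U p -> Im (ev x p.1 p.2) = 0.

Lemma real_cj x : real_el x <-> cj x = x.
Proof.
split=> [h|h p Up].
  apply: ev_ext => p Up; rewrite ev_cj//; apply: complexP; rewrite ?ReJ ?ImJ//.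
  by rewrite h// oppr0.
have : Im (ev (cj x) p.1 p.2) = Im (ev x p.1 p.2) by rewrite h.
rewrite ev_cj// ImJ => /eqP.
by rewrite -subr_eq0 -opprD oppr_eq0 -mulr2n mulrn_eq0 /= => /eqP.
Qed.

Lemma mk_real (f : R -> R -> R) : sm2 U f ->
  exists y : S, forall p, U p -> ev y p.1 p.2 = Complex (f p.1 p.2) 0.
Proof.
move=> sf; have h : smC U (fun t s => Complex (f t s) 0).
  by split=> //=; exact: smooth2_cst.
by exists (mk S h) => p Up; rewrite ev_mk.
Qed.

Lemma pow_el x (r : R) : (forall p, U p -> 0 < Re (ev x p.1 p.2)) ->
  exists y : S, forall p, U p -> ev y p.1 p.2 = Complex (Re (ev x p.1 p.2) `^ r) 0.
Proof.
move=> x0; have [sx _] := ev_smooth x.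
exact: (mk_real (smooth2_comp oU (@open_gt R 0) (sm1_powR r) x0 sx)).
Qed.

Lemma inv_el x : real_el x -> (forall p, U p -> 0 < Re (ev x p.1 p.2)) ->
  exists y : S, x * y = 1.
Proof.
move=> rx x0; have [y yE] := pow_el (-1) x0; exists y.
apply: ev_ext => p Up; rewrite evM// ev1// yE// powR_inv1 ?ltW ?x0//.
move: (rx p Up) (x0 p Up); case: (ev x _ _) => a b /= -> a0.
have a0' : a != 0 by rewrite gt_eqF.
by apply: complexP; rewrite /= ?mulr0 ?mul0r ?subr0 ?addr0 ?divff.
Qed.

Definition vev u t s : V3 R := mkV3 (ev u.1.1 t s) (ev u.1.2 t s) (ev u.2 t s).
Definition represents u G := forall p, U p -> vev u p.1 p.2 = G p.1 p.2.

Lemma ev_hm u v p : U p -> ev (hm u v) p.1 p.2 = herm (vev u p.1 p.2) (vev v p.1 p.2).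
Proof.
by move=> Up; rewrite /hm -lock /herm /= !(evD, evM, evN, ev_ii, ev_cj).
Qed.

Lemma ev_det u v w p : U p ->
  ev (det u v w) p.1 p.2 = det3 (vev u p.1 p.2) (vev v p.1 p.2) (vev w p.1 p.2).
Proof. by move=> Up; rewrite /det /det3 /= !(evD, evM, evN). Qed.

Lemma vev_ext u v : (forall p, U p -> vev u p.1 p.2 = vev v p.1 p.2) -> u = v.
Proof.
move=> h; apply: vecP; apply: ev_ext => p /h; rewrite /vev /mkV3.
- by case.
- by case.
- by case.
Qed.

Lemma dC_near (h k : R -> C) t : (\forall s \near t, h s = k s) -> dC h t = dC k t.
Proof.
move=> hk; rewrite /dC; congr Complex; rewrite !derive1E; apply: near_eq_derive;
  by apply: filterS hk => s ->.
Qed.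

Lemma dV_near (h k : R -> V3 R) t : (\forall s \near t, h s = k s) -> dV h t = dV k t.
Proof.
by move=> hk; rewrite /dV; congr mkV3; apply: dC_near; apply: filterS hk => s ->.
Qed.

Lemma repr_dt u G : represents u G -> represents (vdt u) (fun t s => dV (fun t => G t s) t).
Proof.
move=> h p Up; rewrite /vev /= !ev_dt//.
rewrite -(@dV_near (fun t => vev u t p.2)); first by [].
by apply: filterS (open_near1 oU Up) => t; exact: (h (t, p.2)).
Qed.

Lemma repr_ds u G : represents u G -> represents (vds u) (dtauV G).
Proof.
move=> h p Up; rewrite /vev /= !ev_ds// /dtauV.
rewrite -(@dV_near (fun s => vev u p.1 s)); first by [].
by apply: filterS (open_near2 oU Up) => s; exact: (h (p.1, s)).
Qed.

Lemma repr_exists G : smoothV2 G U -> exists u, represents u G.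
Proof.
move=> sG.
have s (k : nat) : (k < 6)%N -> sm2 U (fun t s => Defs.coord k (G t s)) by move=> k6; split; exact: sG.
have h1 : smC U (fun t s => c1 (G t s)) by split; [exact: (s 0%N)|exact: (s 1%N)].
have h2 : smC U (fun t s => c2 (G t s)) by split; [exact: (s 2%N)|exact: (s 3%N)].
have h3 : smC U (fun t s => c3 (G t s)) by split; [exact: (s 4%N)|exact: (s 5%N)].
exists (mk S h1, mk S h2, mk S h3) => p Up; rewrite /vev /= !ev_mk//.
by case: (G _ _) => [[]].
Qed.

Lemma repr_smooth u G (I : set R) s : represents u G -> (forall t, I t -> U (t, s)) -> open I ->
  smoothV (fun t => G t s) I.
Proof.
move=> h IU oI k k6; apply: sm1P.
have sl (f : R -> R -> R) : sm2 U f -> sm1 I (fun t => f t s).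
  by move=> /(@smooth2_slice _ _ _ s); apply: sm1_sub => t /IU.
have e t : I t -> Defs.coord k (vev u t s) = Defs.coord k (G t s).
  by move=> /IU /h /= ->.
apply: (sm1_eq oI e).
have [a1 a2] := ev_smooth u.1.1; have [b1 b2] := ev_smooth u.1.2.
have [d1 d2] := ev_smooth u.2.
case: k k6 {e} => [|[|[|[|[|[|//]]]]]] _; rewrite /Defs.coord /=.
- exact: (sl _ a1).
- exact: (sl _ a2).
- exact: (sl _ b1).
- exact: (sl _ b2).
- exact: (sl _ d1).
- exact: (sl _ d2).
Qed.

End Evaluation.

(** * Families over an interval and restriction to one parameter *)

Section Rectangle.
Variable R : realType.
Local Notation C := (complex R).
Implicit Types (I J : set R).

Lemma open_setX I J : open I -> open J -> open (I `*` J).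
Proof.
move=> oI oJ; have -> : I `*` J = ((fun p : R * R => p.1) @^-1` I) `&` ((fun p => p.2) @^-1` J) by [].
apply: openI; apply: open_comp => // p _; [exact: cvg_fst|exact: cvg_snd].
Qed.

Definition rect I J (oI : open I) (oJ : open J) := OpenSet (open_setX oI oJ).

Variables (a b : \bar R) (J : set R) (oJ : open J).
Local Notation I := (oitv a b).
Local Notation O := (rect (@open_oitv R a b) oJ).
Local Notation U := (oset O).
Let oU := osetP O.
Variable S : smoothRing O.
Implicit Types (x y : S) (u v w : vec S).

Section Slice.
Variable tau : R.
Hypothesis Jt : J tau.

Lemma slice_smooth x : smC U (fun t _ => ev x t tau).
Proof.
have [h1 h2] := ev_smooth x.
have sl (f : R -> R -> R) : sm2 U f -> sm2 U (fun t _ => f t tau).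
  move=> /(@smooth2_slice _ _ _ tau) h; apply: (smooth2_lift oU _ h).
  by move=> [t s] [/= It _]; split.
by split; [exact: (sl _ h1)|exact: (sl _ h2)].
Qed.
(** Restriction to the parameter [tau], extended constantly to all parameters so as to stay in the
    same ring. It is a ring map commuting with [dt] and [cj], though not with [ds]; the frame of a
    lift uses only the former. *)
Definition slice x : S := mk S (slice_smooth x).
Lemma sliceE x t s : I t -> J s -> ev (slice x) t s = ev x t tau.
Proof. by move=> It Js; rewrite (@ev_mk _ _ S _ (slice_smooth x) (t, s)). Qed.

Lemma ext_slice x y : (forall t s, I t -> J s -> ev x t s = ev y t s) -> x = y.
Proof. by move=> h; apply: ev_ext => -[t s] [/= It Js]; exact: h. Qed.

Lemma sliceD x y : slice (x + y) = slice x + slice y.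
Proof.
apply: ext_slice => t s It Js; rewrite (@evD _ _ S _ _ (t, s))// !sliceE//.
by rewrite (@evD _ _ S _ _ (t, tau)).
Qed.
Lemma sliceM x y : slice (x * y) = slice x * slice y.
Proof.
apply: ext_slice => t s It Js; rewrite (@evM _ _ S _ _ (t, s))// !sliceE//.
by rewrite (@evM _ _ S _ _ (t, tau)).
Qed.
Lemma slice1 : slice 1 = 1.
Proof.
apply: ext_slice => t s It Js; rewrite (@ev1 _ _ S (t, s))// !sliceE//.
by rewrite (@ev1 _ _ S (t, tau)).
Qed.
Lemma slice_ii : slice ii = ii.
Proof.
apply: ext_slice => t s It Js; rewrite (@ev_ii _ _ S (t, s))// !sliceE//.
by rewrite (@ev_ii _ _ S (t, tau)).
Qed.
Lemma slice_cj x : slice (cj x) = cj (slice x).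
Proof.
apply: ext_slice => t s It Js; rewrite (@ev_cj _ _ S _ (t, s))// !sliceE//.
by rewrite (@ev_cj _ _ S _ (t, tau)).
Qed.
Lemma slice_dt x : slice (dt x) = dt (slice x).
Proof.
apply: ext_slice => t s It Js; rewrite (@ev_dt _ _ S _ (t, s))// !sliceE//.
rewrite (@ev_dt _ _ S _ (t, tau))//=.
apply: (@dC_near _ (fun t => ev x t tau) (fun t => ev (slice x) t s)).
have := open_nbhs_nbhs (conj (@open_oitv R a b) It).
by apply: filterS => r Ir; rewrite sliceE.
Qed.
End Slice.

Lemma dt0_constant x tau t t' : J tau -> dt x = 0 -> I t -> I t' -> ev x t tau = ev x t' tau.
Proof.
move=> Jt dx; have [x1 x2] := ev_smooth x.
have sl (f : R -> R -> R) : sm2 U f -> sm1 I (fun t => f t tau).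
  by move=> /(@smooth2_slice _ _ _ tau); apply: sm1_sub => r Ir; split.
have z r : I r -> dC2 false (ev x) r tau = 0.
  move=> Ir; have Up : U (r, tau) by [].
  by have := ev_dt x Up; rewrite dx (ev0 _ Up) => <-.
have cI (u v r : R) : I u -> I v -> u <= r <= v -> I r by exact: oitv_between.
move=> It It'; apply: complexP.
- apply: (derive1_0_cst (f := fun t => Re (ev x t tau)) cI) => // r Ir.
    exact: smooth1_derivable (sl _ x1) Ir.
  by have /(congr1 (@complex.Re R)) := z r Ir.
- apply: (derive1_0_cst (f := fun t => Im (ev x t tau)) cI) => // r Ir.
    exact: smooth1_derivable (sl _ x2) Ir.
  by have /(congr1 (@complex.Im R)) := z r Ir.
Qed.

Lemma cst_smooth (c : C) : smC U (fun _ _ => c).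
Proof. by split; exact: smooth2_cst. Qed.
Definition cstS (c : C) : S := mk S (cst_smooth c).

End Rectangle.

(** * Normalized lifts *)

Section Euclidean.
Variable R : realType.
Local Notation C := (complex R).
Implicit Types (u v : V3 R) (l : C).

(** An auxiliary positive definite product. Lifts are null for [herm], so it is this product that
    recovers the factor between two proportional lifts as a smooth function. *)
Definition eucl u v : C :=
  conjc (c1 u) * c1 v + conjc (c2 u) * c2 v + conjc (c3 u) * c3 v.

Lemma eucl_pos u : nonzeroV3 u -> exists2 r : R, 0 < r & eucl u u = Complex r 0.
Proof.
case: u => [[[a1 a2] [b1 b2]] [d1 d2]] nz.
exists (a1 ^+ 2 + a2 ^+ 2 + b1 ^+ 2 + b2 ^+ 2 + d1 ^+ 2 + d2 ^+ 2); last first.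
  by rewrite /eucl /c1 /c2 /c3 /=; apply: complexP => /=; ring.
rewrite lt0r !addr_ge0 ?sqr_ge0// andbT; apply/negP => h; apply: nz; move: h.
rewrite !paddr_eq0 ?addr_ge0 ?sqr_ge0// !sqrf_eq0.
by move=> /andP[/andP[/andP[/andP[/andP[/eqP-> /eqP->] /eqP->] /eqP->] /eqP->] /eqP->].
Qed.

Lemma eucl_scale u l : eucl u (scaleV3 l u) = l * eucl u u.
Proof. by rewrite /eucl /scaleV3 /mkV3 /c1 /c2 /c3 /=; ring. Qed.

Lemma scaleV3A l l' u : scaleV3 l (scaleV3 l' u) = scaleV3 (l * l') u.
Proof. by rewrite /scaleV3 /mkV3 /c1 /c2 /c3 /= !mulrA. Qed.

Lemma scale1V3 u : scaleV3 1 u = u.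
Proof. by case: u => [[? ?] ?]; rewrite /scaleV3 /mkV3 /c1 /c2 /c3 /= !mul1r. Qed.

Lemma proj_eq_sym u v : proj_eq u v -> proj_eq v u.
Proof.
move=> [l [l0 ->]]; exists l^-1; rewrite invr_neq0//; split=> //.
by rewrite scaleV3A mulVf// scale1V3.
Qed.

Lemma proj_eq_trans u v w : proj_eq u v -> proj_eq v w -> proj_eq u w.
Proof.
by move=> [l [l0 ->]] [m [m0 ->]]; exists (l * m); rewrite mulf_neq0// scaleV3A.
Qed.
End Euclidean.

Section LegendrianFamily.
Variable R : realType.
Local Notation C := (complex R).
Variables (a b : \bar R) (J : set R) (oJ : open J).
Local Notation I := (oitv a b).
Local Notation O := (rect (@open_oitv R a b) oJ).
Local Notation U := (oset O).
Let oU := osetP O.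
Variable S : smoothRing O.
Implicit Types (x y : S) (u v w : vec S).
Variables (G : R -> R -> V3 R) (g : vec S).
Hypotheses (gG : represents g G) (legG : forall tau, J tau -> legendrian_lift I (fun t => G t tau)).

Lemma leg_h00 : hm g g = 0.
Proof.
apply: ev_ext => -[t s] [/= It Js]; rewrite (ev_hm _ _ (p := (t, s)))// gG// (ev0 S (p := (t, s)))//.
by have [_ /(_ t It) []] := legG Js.
Qed.

Lemma leg_h01 : hm g (vdt g) = 0.
Proof.
apply: ev_ext => -[t s] [/= It Js]; rewrite (ev_hm _ _ (p := (t, s)))// gG// (repr_dt gG)//.
rewrite (ev0 S (p := (t, s)))//.
by have [_ /(_ t It) []] := legG Js.
Qed.

Lemma leg_q : forall p, U p ->
  exists2 r : R, 0 < r & ev (hm (vdt g) (vdt g)) p.1 p.2 = Complex r 0.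
Proof.
move=> [t s] [/= It Js]; rewrite (ev_hm _ _ (p := (t, s)))// (repr_dt gG)//=.
have [_ /(_ t It) [h1 h2 h3 h4]] := legG Js.
exact: herm_pos h1 h2 h3 h4.
Qed.

Lemma leg_qi : exists qi : S, hm (vdt g) (vdt g) * qi = 1.
Proof.
apply: inv_el => p Up; first by have [r _ ->] := leg_q Up.
by have [r r0 ->] := leg_q Up.
Qed.

Variable qi : S.
Hypothesis qqi : hm (vdt g) (vdt g) * qi = 1.

Section Slice.
Variable tau : R.
Hypothesis Jt : J tau.
Local Notation sl := (slice (S := S) Jt).
Local Notation gs := (vmap sl g).
(* These facts discharge, by assumption, the side conditions of the lemmas on morphisms. *)
Let slD := @sliceD R a b J oJ S tau Jt.
Let slM := @sliceM R a b J oJ S tau Jt.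
Let sl1 := slice1 S Jt.
Let sldt := @slice_dt R a b J oJ S tau Jt.
Let slcj := @slice_cj R a b J oJ S tau Jt.
Let slii := slice_ii S Jt.

Lemma gs_h00 : hm gs gs = 0.
Proof. by rewrite mor_hm// leg_h00 mor0. Qed.
Lemma gs_h01 : hm gs (vdt gs) = 0.
Proof. by rewrite mor_vdt// mor_hm// leg_h01 mor0. Qed.
Lemma gs_q : hm (vdt gs) (vdt gs) = sl (hm (vdt g) (vdt g)).
Proof. by rewrite mor_vdt// mor_hm. Qed.
Lemma gs_qqi : sl (hm (vdt g) (vdt g)) * sl qi = 1.
Proof. by rewrite -slM qqi. Qed.

Lemma gsE t s : I t -> J s -> vev gs t s = G t tau.
Proof.
move=> It Js; rewrite /vev /= !sliceE//.
exact: (gG (p := (t, tau))).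
Qed.

Lemma frame_p_slice : frame_p (sl qi) gs = sl (frame_p qi g).
Proof. exact: mor_frame_p. Qed.
Lemma frame_b_slice : frame_b (sl qi) gs = sl (frame_b qi g).
Proof. exact: mor_frame_b. Qed.

(** The lift [N] is given as pointwise proportional to the curve; once the factor is known to be a
    smooth invertible function, gauge invariance carries [frame_p] and [frame_b] over to [N], where
    the connection is 0. *)
Lemma normalized_frame (N : R -> V3 R) : normalized_lift I (fun t => G t tau) N ->
  exists n : vec S, [/\ represents n (fun t _ => N t), hm n n = 0, hm n (vdt n) = 0,
    hm (vdt n) (vdt n) = 1 & sl (frame_p qi g) = - hm (vdt (vdt n)) (vdt (vdt (vdt n))) /\
      sl (frame_b qi g) = hm (vdt (vdt n)) (vdt (vdt n))].
Proof.
move=> [sN HN].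
have [n nN] : exists n : vec S, represents n (fun t _ => N t).
  apply: repr_exists => k k6; apply: sm2P; apply: (smooth2_lift oU _ (Sm1 (sN k k6))).
  by move=> p [].
have nN' t s : I t -> J s -> vev n t s = N t by move=> It Js; exact: (nN (t, s)).
pose E u v : S := cj u.1.1 * v.1.1 + cj u.1.2 * v.1.2 + cj u.2 * v.2.
have evE u v p : U p -> ev (E u v) p.1 p.2 = eucl (vev u p.1 p.2) (vev v p.1 p.2).
  by move=> Up; rewrite /E /eucl /= !(evD, evM, ev_cj).
have inv u : (forall p, U p -> nonzeroV3 (vev u p.1 p.2)) -> exists y : S, E u u * y = 1.
  move=> nz; apply: inv_el => p Up; rewrite evE//; have [r r0 ->] := eucl_pos (nz p Up) => //.
have nzG p : U p -> nonzeroV3 (G p.1 tau).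
  by move=> [Ip _]; have [_ /(_ _ Ip) []] := legG Jt.
have [ei eiE] : exists y : S, E gs gs * y = 1.
  by apply: inv => -[t s] [/= It Js]; rewrite gsE//; exact: (nzG (t, s)).
have [ni niE] : exists y : S, E n n * y = 1.
  apply: inv => -[t s] [/= It Js]; rewrite nN'// => N0.
  have [[l [l0 NG]] _] := HN t It; apply: (nzG (t, s)) => //=.
  by move: N0; rewrite -[G t tau]scale1V3 -(mulVf l0) -scaleV3A -NG => ->;
    rewrite /scaleV3 /mkV3 /c1 /c2 /c3 /= !mulr0.
(* The factors between [gs] and [n] in both directions, as quotients of Euclidean products;
   smoothness is visible from this form. *)
pose l := E gs n * ei; pose li := E n gs * ni.
have key t s : I t -> J s -> exists2 m : C, m != 0 & [/\ N t = scaleV3 m (G t tau),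
    ev l t s = m & ev li t s = m^-1].
  move=> It Js; have Up : U (t, s) by [].
  have [[m [m0 NG]] _] := HN t It; exists m => //; split=> //.
    rewrite /l (evM _ _ Up) (evE _ _ _ Up) /= gsE// nN'// NG eucl_scale -mulrA.
    have := congr1 (fun x => ev x t s) eiE; rewrite (evM _ _ Up) (ev1 _ Up) (evE _ _ _ Up) /= gsE//.
    by move=> ->; rewrite mulr1.
  rewrite /li (evM _ _ Up) (evE _ _ _ Up) /= gsE// nN'//.
  have -> : G t tau = scaleV3 m^-1 (N t) by rewrite NG scaleV3A mulVf// scale1V3.
  rewrite eucl_scale -mulrA.
  have := congr1 (fun x => ev x t s) niE; rewrite (evM _ _ Up) (ev1 _ Up) (evE _ _ _ Up) /= nN'//.
  by move=> ->; rewrite mulr1.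
clearbody l li.
have lli : l * li = 1.
  apply: ev_ext => -[t s] Up; rewrite evM// ev1//=; case: (Up) => /= It Js.
  by have [m m0 [_ -> ->]] := key t s It Js; rewrite divff.
have nE : n = vZ l gs.
  apply: vev_ext => -[t s] Up; case: (Up) => /= It Js; rewrite nN'//.
  have [m m0 [-> le _]] := key t s It Js.
  have := gsE It Js; rewrite /vev /= !(evM _ _ Up) /= le => <-.
  by rewrite /scaleV3 /mkV3 /c1 /c2 /c3 /=.
have [n00 n01 n11] := hm_vdtZ l gs_h00 gs_h01.
have hd : det n (vdt n) (vdt (vdt n)) = ii.
  apply: ev_ext => -[t s] Up; rewrite ev_det// ev_ii//; case: (Up) => /= It Js.
  rewrite nN'// (repr_dt nN (p := (t, s)))// (repr_dt (repr_dt nN) (p := (t, s)))//=.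
  by have [_] := HN t It.
rewrite -nE in n00 n01 n11.
have q3 := normalized_q3 n00 n01 (erefl _) hd.
(* The norm is real, being a Hermitian square, and 1 is the only real cube root of 1. *)
have q1 : hm (vdt n) (vdt n) = 1.
  apply: ev_ext => -[t s] Up; rewrite ev1//.
  have := congr1 (fun x => ev x t s) q3; rewrite (evX _ _ Up) (ev1 _ Up) /=.
  have : Im (ev (hm (vdt n) (vdt n)) t s) = 0.
    by rewrite (ev_hm _ _ Up) herm_real.
  case: (ev _ _ _) => r i /= -> h.
  have {}h : r ^+ 3 = 1.
    have e3 : (Complex r 0 : C) ^+ 3 = Complex (r ^+ 3) 0.
      by rewrite !exprS !expr0; apply: complexP => /=; ring.
    by move: h; rewrite e3 => -[].
  have : (r - 1) * (r ^+ 2 + r + 1) = r ^+ 3 - 1 by ring.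
  rewrite h subrr => /eqP; rewrite mulf_eq0 subr_eq0 => /orP[/eqP -> //|/eqP h2].
  have : 0 < r ^+ 2 + r + 1 by nra.
  by rewrite h2 ltxx.
have qi1 : cj li * li * sl qi = 1.
  transitivity (hm (vdt n) (vdt n) * (cj li * li * sl qi)); first by rewrite q1 mul1r.
  rewrite n11 gs_q.
  have c : cj l * cj li = 1 by rewrite -cjM lli cj1.
  transitivity ((cj l * cj li) * (l * li) * (sl (hm (vdt g) (vdt g)) * sl qi)); first by ring.
  by rewrite c lli gs_qqi !mulr1.
have pE : sl (frame_p qi g) = - hm (vdt (vdt n)) (vdt (vdt (vdt n))).
  rewrite -(normalized_p n00 n01 (erefl _) hd q1) -frame_p_slice.
  rewrite -(frame_p_gauge gs_h00 gs_h01 gs_q gs_qqi lli).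
  by rewrite qi1 -nE.
have bE : sl (frame_b qi g) = hm (vdt (vdt n)) (vdt (vdt n)).
  rewrite -(normalized_b n00 n01 (erefl _) hd q1) -frame_b_slice.
  rewrite -(frame_b_gauge gs_h00 gs_h01 gs_q gs_qqi lli).
  by rewrite qi1 -nE.
by exists n; split.
Qed.

(** The left sides depend smoothly on the parameter and do not mention [N]. Hence the Fubini
    densities are independent of the cube root of unity in the normalized lift, in particular of the
    lift that [strain_density] selects. *)
Lemma normalized_values (N : R -> V3 R) : normalized_lift I (fun t => G t tau) N ->
  forall t, I t -> ev (alpha g qi) t tau = Complex 0 (2 * fub_a N t) /\
    ev (frame_b qi g) t tau = Complex (2 * fub_b N t) 0.
Proof.
move=> NN; have [n [nN n00 n01 n11 [pE bE]]] := normalized_frame NN.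
move=> t It; have Up : U (t, tau) by [].
have r2 := repr_dt (repr_dt nN) Up; have r3 := repr_dt (repr_dt (repr_dt nN)) Up.
rewrite /= in r2 r3; split.
  have e : ev (frame_p qi g) t tau = - herm (dVn 2 N t) (dVn 3 N t).
    by rewrite -(sliceE Jt _ It Jt) pE (evN _ Up) (ev_hm _ _ Up) /= r2 r3.
  rewrite /alpha (evD _ _ Up) (evN _ Up) (ev_cj _ Up) /= e.
  rewrite /fub_a -[in RHS]herm_conj; case: (herm _ _) => x y.
  by apply: complexP => /=; ring.
rewrite -(sliceE Jt _ It Jt) bE (ev_hm _ _ Up) /= r2 /fub_b -/(dVn 2 N t).
have := herm_real (dVn 2 N t); case: (herm _ _) => x y /= ->.
by apply: complexP => //=; field.
Qed.

(* A lift is parallel for the connection iff it is normalized up to a constant: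
   its modulus is [q^(-1/2)] and its phase is a primitive of [Im (conn)]. *)
Lemma parallel_exists : exists l : S,
  dt l = conn (sl qi) gs * l /\ cj l * l = sl qi.
Proof.
set k := conn (sl qi) gs; pose q := sl (hm (vdt g) (vdt g)).
have q_pos p : U p -> 0 < Re (ev q p.1 p.2) /\ Im (ev q p.1 p.2) = 0.
  move=> [Ip Jp]; rewrite (sliceE Jt _ Ip Jp).
  have [|r r0 ->] := leg_q (p := (p.1, tau)) => //.
have kmet : cj k + k = - (dt q * sl qi) := conn_metric gs_q gs_qqi.
have cqi : cj (sl qi) = sl qi := cj_qi gs_q gs_qqi.
have [rho rhoE] : exists y : S, forall p, U p ->
    ev y p.1 p.2 = Complex (Re (ev q p.1 p.2) `^ (- 2^-1)) 0.
  by apply: pow_el => p Up; have [] := q_pos p Up.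
have crho : cj rho = rho by apply/real_cj => p Up; rewrite rhoE.
have rho2 : rho * rho = sl qi.
  apply: (inv_uniq (x := q)); last exact: gs_qqi.
  apply: ev_ext => p Up; rewrite !(evM _ _ Up) !(rhoE _ Up) (ev1 _ Up).
  have [] := q_pos p Up; case: (ev q _ _) => r i /= r0 ->.
  have e : r `^ (- 2^-1) * r `^ (- 2^-1) = r^-1.
    rewrite -powRD; last by rewrite (gt_eqF r0) implybT.
    by rewrite -(powR_inv1 (ltW r0)); congr (_ `^ _); field.
  apply: complexP => /=; rewrite ?mulr0 ?mul0r ?subr0 ?addr0 ?mul0r ?mulr0 //.
  by rewrite e divff// gt_eqF.
pose f t := Im (ev k t tau).
have sf : sm1 I f.
  have [_ /(@smooth2_slice _ _ _ tau)] := ev_smooth k.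
  by apply: sm1_sub => t It; split.
have [th thE] := primitive_exists (fun t It => smooth1_continuous sf It).
have oI := @open_oitv R a b.
have sth : sm1 I th.
  by apply: (sm1_prim _ oI _ sf) => t /thE [].
have [scos ssin] := sm1_trig R.
have s1 : sm1 I (fun t => cos (th t)) by apply: (sm1_comp oI openT scos _ sth).
have s2 : sm1 I (fun t => sin (th t)) by apply: (sm1_comp oI openT ssin _ sth).
have hw : smC U (fun t _ => Complex (cos (th t)) (sin (th t))).
  split => /=.
  - by apply: (smooth2_lift oU _ s1) => p [].
  - by apply: (smooth2_lift oU _ s2) => p [].
pose om := mk S hw.
have omE t s : I t -> J s -> ev om t s = Complex (cos (th t)) (sin (th t)).
  by move=> It Js; rewrite (ev_mk S hw (p := (t, s))).
have [ka kaE] : exists y : S, forall p, U p -> ev y p.1 p.2 = Complex (f p.1) 0.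
  apply: (mk_real S (f := fun t _ => f t)); apply: (smooth2_lift oU _ sf) => p; by case.
have kfull t s : I t -> J s -> ev k t s = ev k t tau.
  move=> It Js; rewrite /k mor_conn//.
  by rewrite !sliceE.
have kka : k - cj k = 2 * ii * ka.
  apply: ev_ext => -[t s] Up; case: (Up) => /= It Js.
  rewrite (evD _ _ Up) (evN _ Up) (ev_cj _ Up) !(evM _ _ Up) (ev_ii _ Up) (kaE _ Up) (evn _ _ Up) /=.
  rewrite kfull// /f; case: (ev k t tau) => x y.
  have -> : (2 : C) = Complex 2 0 by apply: complexP => //=; rewrite addr0.
  by apply: complexP => /=; ring.
have dom : dt om = ii * ka * om.
  apply: ev_ext => -[t s] Up; case: (Up) => /= It Js.
  rewrite (ev_dt _ Up) !(evM _ _ Up) (ev_ii _ Up) (kaE _ Up) /= omE//.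
  have -> : dC2 false (ev om) t s = dC (fun t => Complex (cos (th t)) (sin (th t))) t.
    apply: (@dC_near _ (fun t => ev om t s)).
    by apply: filterS (open_nbhs_nbhs (conj oI It)) => r Ir; rewrite omE.
  have [d1 d2] := thE t It; rewrite /dC /=.
  rewrite (derive1_comp1 d1 (@derivable_cos R (th t))) (derive1_comp1 d1 (@derivable_sin R (th t))).
  rewrite d2 !(derive1E cos) !(derive1E sin) !derive_val.
  by apply: complexP => /=; ring.
have com : cj om * om = 1.
  apply: ev_ext => -[t s] Up; case: (Up) => /= It Js.
  rewrite (evM _ _ Up) (ev_cj _ Up) (ev1 _ Up) /= omE//.
  have := cos2Dsin2 (th t) => h.
  by apply: complexP => /=; [rewrite -h; ring|ring].
exists (rho * om); split; last first.
  rewrite cjM crho; transitivity (rho * rho * (cj om * om)); first by ring.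
  by rewrite com rho2 mulr1.
have drho : 2 * dt rho = (cj k + k) * rho.
  have e1 : 2 * dt rho * rho = - (sl qi * sl qi * dt q).
    by rewrite -(dt_inv gs_qqi) -rho2 dtM; ring.
  have e2 : rho * rho * q = 1 by rewrite rho2 mulrC; exact: gs_qqi.
  transitivity (2 * dt rho * rho * (rho * q)); first by rewrite -[LHS]mulr1 -e2; ring.
  rewrite e1 kmet; transitivity (- ((q * sl qi) * sl qi * dt q * rho)); first by ring.
  by rewrite gs_qqi; ring.
have two x : 2 * x = 0 -> x = 0.
  move=> h; transitivity (6 * sixth * x); first by rewrite sixthE mul1r.
  transitivity (3 * sixth * (2 * x)); first by ring.
  by rewrite h mulr0.
apply/eqP; rewrite -subr_eq0; apply/eqP; apply: two.
rewrite dtM dom.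
transitivity ((2 * dt rho) * om + rho * om * (2 * ii * ka) - 2 * k * (rho * om)); first by ring.
by rewrite drho -kka; ring.
Qed.

(** For the parallel factor [l] the determinant of the lift and its first two derivatives is a
    nonzero constant c; multiplication by a cube root of i/c brings it to i. *)
Lemma normalized_exists : exists N, normalized_lift I (fun t => G t tau) N.
Proof.
have [l [dl cl]] := parallel_exists.
have oI := @open_oitv R a b.
pose n := vZ l gs.
have [n00 n01 n11] := hm_vdtZ l gs_h00 gs_h01.
pose d := det n (vdt n) (vdt (vdt n)).
have dd : dt d = 0 := det_parallel gs_h00 gs_h01 gs_q gs_qqi dl.
have cd : cj d * d = 1 := det_parallel_norm gs_h00 gs_h01 gs_q gs_qqi dl cl.
have dcst t t' : I t -> I t' -> ev d t tau = ev d t' tau by exact: dt0_constant.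
have [[t0 It0]|nI] := pselect (exists t, I t); last first.
  exists (fun t => vev n t tau); split=> [k k6|t It]; last by case: nI; exists t.
  by apply: sm1P; split=> m t It; case: nI; exists t.
pose c := ev d t0 tau.
have Up0 : U (t0, tau) by [].
have c0 : c != 0.
  apply/eqP => h; have := congr1 (fun x => ev x t0 tau) cd.
  rewrite (evM _ _ Up0) (ev1 _ Up0) /= -/c h mulr0 => /eqP.
  by rewrite eq_sym oner_eq0.
have [w w3] : exists w : C, w ^+ 3 = iC R / c by exists (3.-root (iC R / c)); rewrite rootCK.
have w0 : w != 0.
  apply/eqP => h; move: w3; rewrite h expr0n /= => /esym/eqP.
  rewrite mulf_eq0 invr_eq0 (negbTE c0) orbF.
  by rewrite eq_complex /= oner_eq0 andbF.
pose m := vZ (cstS S w) n.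
have wE t s : I t -> J s -> ev (cstS S w) t s = w.
  by move=> It Js; exact: (@ev_mk _ _ S _ (@cst_smooth R a b J oJ w) (t, s) (conj It Js)).
have mm : represents m (vev m) by [].
exists (fun t => vev m t tau); split.
  exact: (repr_smooth mm (fun t It => conj It Jt) oI).
move=> t It; have Up : U (t, tau) by [].
have nzl : ev l t tau != 0.
  apply/eqP => h; have := congr1 (fun x => ev x t tau) gs_qqi.
  rewrite -cl !(evM _ _ Up) (ev1 _ Up) /= h !mulr0 => /eqP.
  by rewrite eq_sym oner_eq0.
split.
  exists (w * ev l t tau); split; first by rewrite mulf_neq0.
  rewrite /vev /= !(evM _ _ Up) /= wE// -(gsE It Jt) /vev /scaleV3 /mkV3 /c1 /c2 /c3 /=.
  by rewrite !mulrA.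
have e : det m (vdt m) (vdt (vdt m)) = cstS S w ^+ 3 * d.
  have dw : dt (cstS S w) = 0.
    apply: ev_ext => -[r s] [Ir Js]; rewrite (ev_dt _ (p := (r, s)))// (ev0 _ (p := (r, s)))//=.
    rewrite /dC2 /dpart; apply: etrans (_ : dC (fun _ => w) r = _).
      apply: (@dC_near _ (fun t => ev (cstS S w) t s)).
      by apply: filterS (open_nbhs_nbhs (conj oI Ir)) => r' Ir'; rewrite wE.
    by rewrite /dC !derive1_cst.
  rewrite /d /det /m /= !(dtM, dtD) !dw dt0; ring.
have r1 := repr_dt mm Up; have r2 := repr_dt (repr_dt mm) Up; rewrite /= in r1 r2.
have := ev_det m (vdt m) (vdt (vdt m)) Up; rewrite /= r1 r2 => <-.
rewrite e (evM _ _ Up) (evX _ _ Up) /= wE// w3 (dcst t t0)// -/c divfK//.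
Qed.

Lemma strain_densityE t : I t ->
  strain_density I (fun t => G t tau) t = `|Im (ev (alpha g qi) t tau) / 2| `^ (3^-1).
Proof.
move=> It; rewrite /strain_density; case: pselect => [H|]; last by case; exact: normalized_exists.
have [-> _] := normalized_values (proj2_sig (cid H)) It.
by congr (`|_| `^ _) => /=; field.
Qed.

End Slice.

End LegendrianFamily.

(** * Strain and stress as ring elements *)

Section StrainElements.
Variable R : realType.
Local Notation C := (complex R).
Variables (a b : \bar R) (J : set R) (oJ : open J).
Local Notation I := (oitv a b).
Local Notation O := (rect (@open_oitv R a b) oJ).
Local Notation U := (oset O).
Let oU := osetP O.
Variable S : smoothRing O.
Implicit Types (x y : S) (u v w : vec S).

Section Jets.
Variable tau : R.
Hypothesis Jt : J tau.

Lemma ev_dt_local x (h : R -> C) (Z : set R) : open Z ->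
  (forall t, I t -> Z t -> ev x t tau = h t) ->
  forall t, I t -> Z t -> ev (dt x) t tau = dC h t.
Proof.
move=> oZ xh t It Zt; rewrite (ev_dt x (p := (t, tau)))//=.
apply: (@dC_near _ (fun t => ev x t tau)).
have nI := open_nbhs_nbhs (conj (@open_oitv R a b) It).
have nZ := open_nbhs_nbhs (conj oZ Zt).
by apply: filterS (filterI nI nZ) => s [Is Zs]; exact: xh.
Qed.

Lemma ev_dtk_re x (f : R -> R) : (forall t, I t -> ev x t tau = Complex (f t) 0) ->
  forall n t, I t -> ev (dtk n x) t tau = Complex (derive1n n f t) 0.
Proof.
move=> xf; elim=> [|n IH] t It; first exact: xf.
have h := @ev_dt_local (dtk n x) (fun t => Complex (derive1n n f t) 0) setT openT
  (fun s Is _ => IH s Is) t It Logic.I.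
by rewrite dtk1 h /dC /= derive1_cst.
Qed.

Lemma ev_dtk_im x (f : R -> R) : (forall t, I t -> ev x t tau = Complex 0 (f t)) ->
  forall n t, I t -> ev (dtk n x) t tau = Complex 0 (derive1n n f t).
Proof.
move=> xf; elim=> [|n IH] t It; first exact: xf.
have h := @ev_dt_local (dtk n x) (fun t => Complex 0 (derive1n n f t)) setT openT
  (fun s Is _ => IH s Is) t It Logic.I.
by rewrite dtk1 h /dC /= derive1_cst.
Qed.

Lemma ev_dtk_zero x (Z : set R) : open Z -> (forall t, I t -> Z t -> ev x t tau = 0) ->
  forall n t, I t -> Z t -> ev (dtk n x) t tau = 0.
Proof.
move=> oZ xf; elim=> [|n IH] t It Zt; first exact: xf.
have h := @ev_dt_local (dtk n x) (fun _ => 0) Z oZ IH t It Zt.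
by rewrite dtk1 h /dC /= derive1_cst.
Qed.
End Jets.

Lemma derive1n_scale (k : R) (f : R -> R) n t : sm1 I f -> I t ->
  derive1n n (fun s => k * f s) t = k * derive1n n f t.
Proof.
move=> sf; elim: n t => [//|n IH] t It.
rewrite !derive1nS !derive1E.
have oI := @open_oitv R a b.
have -> : 'D_1 (derive1n n (fun s => k * f s)) t = 'D_1 (fun s => k * derive1n n f s) t.
  by apply: near_eq_derive; apply: filterS (open_nbhs_nbhs (conj oI It)) => s /IH.
have dk : derivable (fun _ : R => k) t 1 by exact: derivable_cst.
rewrite (deriveM dk (@smooth1E _ _ _ n _ sf It)) -!derive1E derive1_cst.
by rewrite scaler0 addr0.
Qed.

Variables (G : R -> R -> V3 R) (g : vec S).
Hypotheses (gG : represents g G) (legG : forall tau, J tau -> legendrian_lift I (fun t => G t tau)).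
Variable qi : S.
Hypothesis qqi : hm (vdt g) (vdt g) * qi = 1.
Local Notation al := (alpha g qi).
Local Notation be := (frame_b qi g).
Let h00 := leg_h00 gG legG.
Let h01 := leg_h01 gG legG.

Lemma al_im p : U p -> ev al p.1 p.2 = Complex 0 (Im (ev al p.1 p.2)).
Proof.
move=> Up; have := congr1 (fun x => Re (ev x p.1 p.2)) (cj_alpha g qi).
rewrite (ev_cj _ Up) (evN _ Up) ReJ ReN => /eqP.
rewrite -addr_eq0 -mulr2n mulrn_eq0 /= => /eqP r0.
by apply: complexP.
Qed.

(** With al = 2ix, the strain |x|^(1/3) is taken as the sixth root of the positive smooth function
    x^2, which covers both signs of x. *)
Lemma strain_elements : (forall p, U p -> Im (ev al p.1 p.2) != 0) ->
  exists ai s : S, [/\ al * ai = 1, s ^+ 6 * - 4 = al * al &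
    forall p, U p -> ev s p.1 p.2 = Complex (`|Im (ev al p.1 p.2) / 2| `^ (3^-1)) 0].
Proof.
move=> nz; have [_ sIm] := ev_smooth al.
have s2 : sm2 U (fun t s => Im (ev al t s) * 2^-1).
  by apply: (smooth2M oU sIm); exact: smooth2_cst.
have [x xE] := mk_real S s2.
have alE : al = 2 * ii * x.
  apply: ev_ext => p Up; rewrite !(evM _ _ Up) (evn _ _ Up) (ev_ii _ Up) (xE _ Up) (al_im Up).
  have -> : (2 : C) = Complex 2 0 by apply: complexP => //=; rewrite addr0.
  by apply: complexP => /=; field.
have xxE p : U p -> ev (x * x) p.1 p.2 = Complex ((Im (ev al p.1 p.2) / 2) ^+ 2) 0.
  by move=> Up; rewrite (evM _ _ Up) !(xE _ Up); apply: complexP => /=; ring.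
have xx0 p : U p -> 0 < (Im (ev al p.1 p.2) / 2) ^+ 2.
  by move=> Up; rewrite exprn_even_gt0//= mulf_neq0 ?nz// invr_eq0 pnatr_eq0.
have [y yE] : exists y : S, x * x * y = 1.
  by apply: inv_el => p Up; rewrite xxE//=; exact: xx0.
have [s sE] : exists s : S, forall p, U p ->
    ev s p.1 p.2 = Complex (Re (ev (x * x) p.1 p.2) `^ (6^-1)) 0.
  by apply: pow_el => p Up; rewrite xxE//=; exact: xx0.
(* The inverse of 2ix is -i/(2x), that is -(1/2) i x y with y = 1/x^2; the factor [3 * sixth] is
   1/2. *)
exists (- (3 * sixth * ii * x * y)), s; split.
- rewrite alE; transitivity (- (ii * ii) * (6 * sixth) * (x * x * y)); first by ring.
  by rewrite iiM yE sixthE opprK !mulr1.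
- rewrite alE; transitivity (ii * ii * (4 * (x * x))); last by ring.
  rewrite iiM; have -> : s ^+ 6 = x * x; last by ring.
  apply: ev_ext => p Up; rewrite (evX _ _ Up) (sE _ Up) xxE//=.
  set r := _ ^+ 2.
  have -> : (Complex (r `^ 6^-1) 0 : C) ^+ 6 = Complex ((r `^ 6^-1) ^+ 6) 0.
    by rewrite !exprS !expr0; apply: complexP => /=; ring.
  rewrite -powR_mulrn ?powR_ge0// -powRrM mulVf ?pnatr_eq0//.
  by rewrite powRr1// ltW// xx0.
- move=> p Up; rewrite sE// xxE//=; congr Complex.
  by rewrite -real_normK ?num_real// -powR_mulrn// -powRrM; congr (_ `^ _); field.
Qed.

Section StressEL.
Variables (tau : R) (N : R -> V3 R) (ai : S).
Hypotheses (Jt : J tau) (nN : normalized_lift I (fun t => G t tau) N) (ala : al * ai = 1).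
Local Notation m := (strain_m al ai).

Lemma cj_m : cj m = m.
Proof.
have ca : cj al = - al := cj_alpha g qi.
have cai : cj ai = - ai.
  apply: (inv_uniq (x := - al)); last by rewrite mulrNN ala.
  by rewrite -ca -cjM ala cj1.
by rewrite /strain_m !cjM cj_dt cai ca cj_sixth cjn dtN; ring.
Qed.

Lemma fub_smooth : sm1 I (fub_a N) /\ sm1 I (fub_b N).
Proof.
have nv := normalized_values gG legG qqi Jt nN.
have oI := @open_oitv R a b.
have [_ s1] := ev_smooth al; have [s2 _] := ev_smooth be.
have sl (f : R -> R -> R) : sm2 U f -> sm1 I (fun t => 2^-1 * f t tau).
  move=> /(@smooth2_slice _ _ _ tau) h; apply: (sm1M oI); first exact: smooth1_cst.
  by apply: sm1_sub h => r Ir; split.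
split.
- by apply: sm1_eq (sl _ s1) => // t It; have [-> _] := nv t It => /=; field.
- by apply: sm1_eq (sl _ s2) => // t It; have [_ ->] := nv t It => /=; field.
Qed.

(** The stress density is homogeneous of degree 5 in a and its derivatives, so after division by a^5
    only the ratios a^(n)/a remain. These are polynomials in the jets of m by [alpha_derivs]; the
    argument [be] is twice the second Fubini density. *)
Lemma stress_EL t : I t ->
  ev (EL m be) t tau = Complex (4 * stress N t / fub_a N t ^+ 5) 0.
Proof.
move=> It; have Up : U (t, tau) by [].
have nv := normalized_values gG legG qqi Jt nN.
have [sa sb] := fub_smooth.
have alk n : ev (dtk n al) t tau = Complex 0 (2 * derive1n n (fub_a N) t).
  rewrite (@ev_dtk_im tau Jt al (fun t => 2 * fub_a N t))//; last by move=> s /nv [].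
  by rewrite derive1n_scale.
have bek n : ev (dtk n be) t tau = Complex (2 * derive1n n (fub_b N) t) 0.
  rewrite (@ev_dtk_re tau Jt be (fun t => 2 * fub_b N t))//; last by move=> s /nv [].
  by rewrite derive1n_scale.
pose f s := Re (ev m s tau).
have mk n : ev (dtk n m) t tau = Complex (derive1n n f t) 0.
  apply: (@ev_dtk_re tau Jt) => // s Is; apply: complexP => //=.
  by have /real_cj /(_ (s, tau)) := cj_m; apply.
have a0 : fub_a N t != 0.
  apply/eqP => h; have := congr1 (fun x => ev x t tau) ala.
  rewrite (evM _ _ Up) (ev1 _ Up) /=; have := alk 0%N; rewrite /dtk /= => ->.
  by rewrite h mulr0 => /eqP; rewrite -[Complex 0 0]/(0 : C) mul0r eq_sym oner_eq0.
have [rc [rcE [rcn rcX rcM rcN rcD]]] : exists rc : R -> C, (forall r, rc r = Complex r 0) /\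
    [/\ forall n, rc n%:R = n%:R, forall r n, rc (r ^+ n) = rc r ^+ n,
      forall r s, rc (r * s) = rc r * rc s, forall r, rc (- r) = - rc r &
      forall r s, rc (r + s) = rc r + rc s].
  exists (real_complex R); split=> //; split=> *.
  - by rewrite rmorph_nat.
  - by rewrite rmorphXn.
  - by rewrite rmorphM.
  - by rewrite rmorphN.
  - by rewrite rmorphD.
have rcE' := (rcn, rcX, rcM, rcN, rcD).
have i0 : iC R != 0 by rewrite eq_complex /= oner_eq0 andbF.
have := alpha_derivs ala; clearbody f; move: alk bek mk.
move: al be (strain_m al ai) => al0 be0 m0 alk bek mk [e1 e2 e3 e4 e5].
(* Opaque names for the derivatives: comparing them up to conversion is very slow. *)
have [m_ mE] : exists m_ : nat -> R, forall n, derive1n n f t = m_ n by exists (fun n => derive1n n f t).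
have [b_ bE] : exists b_ : nat -> R, forall n, derive1n n (fub_b N) t = b_ n.
  by exists (fun n => derive1n n (fub_b N) t).
have [a_ aE] : exists a_ : nat -> R, forall n, derive1n n (fub_a N) t = a_ n.
  by exists (fun n => derive1n n (fub_a N) t).
have aE0 : fub_a N t = a_ 0%N := aE 0%N.
have bE0 : fub_b N t = b_ 0%N := bE 0%N.
have key n x (r : R) : dtk n al0 = al0 * x -> ev x t tau = rc r -> a_ n = a_ 0%N * r.
  move=> /(congr1 (fun x => ev x t tau)); rewrite alk aE (evM _ _ Up) /= => + xr.
  have := alk 0%N; rewrite /dtk /= => ->; rewrite xr rcE aE0.
  move=> /(congr1 (@complex.Im R)) /=; rewrite mul0r add0r -mulrA => h.
  by apply: (@mulfI _ 2); rewrite ?pnatr_eq0.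
have eD x y : ev (x + y) t tau = ev x t tau + ev y t tau := evD x y Up.
have eN x : ev (- x) t tau = - ev x t tau := evN x Up.
have eM x y : ev (x * y) t tau = ev x t tau * ev y t tau := evM x y Up.
have eX x n : ev (x ^+ n) t tau = ev x t tau ^+ n := evX x n Up.
have en n : ev (n%:R : S) t tau = n%:R := evn S n Up.
have ef := (en, eX, eN, eD, eM).
have real2 n : ev (dtk n m0) t tau = rc (m_ n) by rewrite mk mE rcE.
have real3 n : ev (dtk n be0) t tau = rc (2 * b_ n) by rewrite bek bE rcE.
have rm0 : ev m0 t tau = rc (m_ 0%N) by exact: (real2 0%N).
have rb0 : ev be0 t tau = rc (2 * b_ 0%N) by exact: (real3 0%N).
have rm1 : ev (dt m0) t tau = rc (m_ 1%N) by exact: (real2 1%N).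
have rb1 : ev (dt be0) t tau = rc (2 * b_ 1%N) by exact: (real3 1%N).
(* Small numerals: the unary representation of large ones makes rewriting slow. *)
have e3' : dtk 3 al0 = al0 * ((3 * 9) * m0 * dt m0 + (3 * 9) * m0 ^+ 3 + 3 * dtk 2 m0) by rewrite e3; ring.
have e4' : dtk 4 al0 = al0 * ((4 * 9) * m0 * dtk 2 m0 + (2 * 9 * 9) * m0 ^+ 2 * dt m0 + (9 * 9) * m0 ^+ 4
        + (3 * 9) * dt m0 ^+ 2 + 3 * dtk 3 m0) by rewrite e4; ring.
have e5' : dtk 5 al0 = al0 * ((5 * 9 * 9) * m0 * dt m0 ^+ 2 + (5 * 9) * m0 * dtk 3 m0 + (3 * 9 * 10) * m0 ^+ 2 * dtk 2 m0
        + (9 * 9 * 10) * m0 ^+ 3 * dt m0 + (3 * 9 * 9) * m0 ^+ 5 + (9 * 10) * dt m0 * dtk 2 m0 + 3 * dtk 4 m0) by rewrite e5; ring.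
have ELE : EL m0 be0 =
  8 * be0 * dt be0 + (10 * 12) * be0 * m0 * dt m0 - (8 * 10) * be0 * m0 ^+ 3 - (2 * 10) * be0 * dtk 2 m0
  - (2 * 8) * be0 ^+ 2 * m0 + (6 * 10) * dt be0 * m0 ^+ 2 - (3 * 10) * dt be0 * dt m0 - (2 * 9) * dtk 2 be0 * m0
  + 2 * dtk 3 be0 - (2 * 10 * 12) * m0 * dt m0 ^+ 2 + (4 * 10) * m0 * dtk 3 m0 - (2 * 8 * 10) * m0 ^+ 2 * dtk 2 m0
  + (4 * 8 * 10) * m0 ^+ 3 * dt m0 - (8 * 8) * m0 ^+ 5 + (8 * 10) * dt m0 * dtk 2 m0 - 4 * dtk 4 m0.
  by rewrite /EL; ring.
have A1 : a_ 1%N = a_ 0%N * (3 * m_ 0%N).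
  by apply: (key 1%N _ _ e1); rewrite !ef rm0 !rcE'.
have A2 : a_ 2 = a_ 0%N * (9 * m_ 0%N ^+ 2 + 3 * m_ 1%N).
  apply: (key 2 _ _ e2).
  rewrite !ef.
  rewrite ?rm1 ?real2 rm0.
  by rewrite !rcE'.
have A3 : a_ 3 = a_ 0%N * ((3 * 9) * m_ 0%N * m_ 1%N + (3 * 9) * m_ 0%N ^+ 3 + 3 * m_ 2).
  apply: (key 3 _ _ e3').
  rewrite !ef.
  rewrite ?rm1 ?real2 rm0.
  by rewrite !rcE'.
have A4 : a_ 4 = a_ 0%N * ((4 * 9) * m_ 0%N * m_ 2 + (2 * 9 * 9) * m_ 0%N ^+ 2 * m_ 1%N + (9 * 9) * m_ 0%N ^+ 4
        + (3 * 9) * m_ 1%N ^+ 2 + 3 * m_ 3).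
  apply: (key 4 _ _ e4').
  rewrite !ef.
  rewrite ?rm1 ?real2 rm0.
  by rewrite !rcE'.
have A5 : a_ 5 = a_ 0%N * ((5 * 9 * 9) * m_ 0%N * m_ 1%N ^+ 2 + (5 * 9) * m_ 0%N * m_ 3
        + (3 * 9 * 10) * m_ 0%N ^+ 2 * m_ 2 + (9 * 9 * 10) * m_ 0%N ^+ 3 * m_ 1%N + (3 * 9 * 9) * m_ 0%N ^+ 5
        + (9 * 10) * m_ 1%N * m_ 2 + 3 * m_ 4).
  apply: (key 5 _ _ e5').
  rewrite !ef.
  rewrite ?rm1 ?real2 rm0.
  by rewrite !rcE'.
have EE : ev (EL m0 be0) t tau = rc (
  8 * (2 * b_ 0%N) * (2 * b_ 1%N) + (10 * 12) * (2 * b_ 0%N) * m_ 0%N * m_ 1%N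
  - (8 * 10) * (2 * b_ 0%N) * m_ 0%N ^+ 3 - (2 * 10) * (2 * b_ 0%N) * m_ 2
  - (2 * 8) * (2 * b_ 0%N) ^+ 2 * m_ 0%N + (6 * 10) * (2 * b_ 1%N) * m_ 0%N ^+ 2
  - (3 * 10) * (2 * b_ 1%N) * m_ 1%N - (2 * 9) * (2 * b_ 2) * m_ 0%N
  + 2 * (2 * b_ 3) - (2 * 10 * 12) * m_ 0%N * m_ 1%N ^+ 2 + (4 * 10) * m_ 0%N * m_ 3 - (2 * 8 * 10) * m_ 0%N ^+ 2 * m_ 2
  + (4 * 8 * 10) * m_ 0%N ^+ 3 * m_ 1%N - (8 * 8) * m_ 0%N ^+ 5 + (8 * 10) * m_ 1%N * m_ 2 - 4 * m_ 4).
  rewrite ELE.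
  by rewrite !(eD, eN) !eM !en ?rm1 ?rb1 ?real2 ?real3 rm0 rb0 !(rcD, rcN) !rcM !rcn.
rewrite EE rcE; congr Complex.
rewrite /stress !aE !bE aE0 bE0 A1 A2 A3 A4 A5.
rewrite aE0 in a0.
move: (a_ 0%N) (b_ 0%N) (b_ 1%N) (b_ 2) (b_ 3) (m_ 0%N) (m_ 1%N) (m_ 2) (m_ 3) (m_ 4) a0.
by move=> r *; field.
Qed.

End StressEL.

End StrainElements.

(** * The derivative of the strain functional *)

Section Compactness.
Variable R : realType.

Lemma tube (c d : R) (Q : set (R * R)) :
  (forall t, c <= t <= d -> \forall p \near (t, (0 : R)), Q p) ->
  exists2 eta : R, 0 < eta & forall t s, c <= t <= d -> `|s| < eta -> Q (t, s).
Proof.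
move=> H.
have /compact_near_coveringP cov : compact `[c, d] := @segment_compact R c d.
have /= := cov R (nbhs (0 : R)) (fun s t => Q (t, s)) _ _.
case.
  move=> t /=; rewrite in_itv /= => tcd.
  have := H t tcd; case => -[A B] [/= A0 B0] AB.
  exists (A, B) => //= -[x y] [/= Ax By]; exact: (AB (x, y)).
move=> e /= e0 He; exists e => // t s tcd se.
apply: (He s); last by rewrite /= in_itv.
by rewrite /ball /= sub0r normrN.
Qed.

Lemma bounded_rectangle (c d e : R) (f : R -> R -> R) : c <= d -> 0 <= e ->
  (forall t s, c <= t <= d -> `|s| <= e -> {for (t, s), continuous (fun q : R * R => f q.1 q.2)}) ->
  exists M : R, forall t s, c <= t <= d -> `|s| <= e -> `|f t s| <= M.
Proof.
move=> cd e0 cf.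
pose K : set (R * R) := `[c, d] `*` `[- e, e].
have cK : compact K by apply: compact_setX; exact: segment_compact.
have inK t s : c <= t <= d -> `|s| <= e -> K (t, s).
  by move=> tcd se; split; rewrite /= in_itv //= -ler_norml.
have [||p _ Hp] := @compact_EVT_max _ R (fun q : R * R => `|f q.1 q.2|) K _ cK.
- by exists (c, 0); apply: inK; rewrite ?lexx ?cd ?normr0.
- apply: continuous_in_subspaceT => -[t s]; rewrite inE => -[/=].
  rewrite !in_itv /= => tcd se.
  have c1 := cf t s tcd; rewrite ler_norml in c1.
  exact: (continuous_comp (c1 se) (@norm_continuous _ _ _)).
exists `|f p.1 p.2| => t s tcd se.
by apply: (Hp (t, s)); rewrite inE; exact: inK.
Qed.

Lemma Rintegral_restrict (K : set R) (c d : R) (h : R -> R) :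
  (forall t, K t -> c <= t <= d) -> (forall t, c <= t <= d -> ~ K t -> h t = 0) ->
  measurable K ->
  \int[lebesgue_measure]_(t in K) h t = \int[lebesgue_measure]_(t in `[c, d]) h t.
Proof.
move=> Kcd h0 mK; rewrite /Rintegral; congr fine.
rewrite [LHS]integral_mkcond [RHS]integral_mkcond; apply: eq_integral => t _.
rewrite /patch; case: ifPn => tK; case: ifPn => tcd //.
- move: tK tcd; rewrite !inE notin_setE /= in_itv /= => /Kcd ->; by case.
- rewrite h0//; first by move: tcd; rewrite inE /= in_itv.
  by move: tK; rewrite notin_setE.
Qed.

Lemma FTC2_segment (c d : R) (F h : R -> R) : c < d ->
  (forall t, c <= t <= d -> derivable F t 1 /\ derive1 F t = h t) ->
  (forall t, c <= t <= d -> {for t, continuous h}) ->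
  \int[lebesgue_measure]_(t in `[c, d]) h t = F d - F c.
Proof.
move=> cd dF ch.
have cF t : c <= t <= d -> {for t, continuous F}.
  by move=> /dF[/derivable1_diffP/differentiable_continuous].
rewrite /Rintegral (@continuous_FTC2 _ h F)//.
- by apply: continuous_in_subspaceT => t; rewrite inE /= in_itv; exact: ch.
- split.
  + by move=> t; rewrite in_itv /= => /andP[/ltW ct /ltW td]; have [] := dF t; rewrite ?ct ?td.
  + by apply: cvg_at_right_filter; apply: cF; rewrite lexx ltW.
  + by apply: cvg_at_left_filter; apply: cF; rewrite lexx ltW.
- by move=> t; rewrite in_itv /= => /andP[/ltW ct /ltW td]; have [] := dF t; rewrite ?ct ?td.
Qed.

End Compactness.

Section FunctionalDerivative.
Variable R : realType.
Local Notation C := (complex R).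

Lemma open_norm_lt (e : R) : open [set s : R | `|s| < e].
Proof.
have -> : [set s : R | `|s| < e] = (fun s : R => `|s|) @^-1` [set x | x < e] by [].
by apply: open_comp; [move=> s _; exact: norm_continuous|exact: open_lt].
Qed.

Lemma legendrian_lift_sub (I J : set R) (Gam : R -> V3 R) : (forall t, J t -> I t) ->
  legendrian_lift I Gam -> legendrian_lift J Gam.
Proof.
by move=> JI [sG H]; split=> [k k6 n t /JI|t /JI]; [exact: sG|exact: H].
Qed.

Lemma normalized_lift_sub (I J : set R) (Gam N : R -> V3 R) : (forall t, J t -> I t) ->
  normalized_lift I Gam N -> normalized_lift J Gam N.
Proof.
by move=> JI [sG H]; split=> [k k6 n t /JI|t /JI]; [exact: sG|exact: H].
Qed.

Variables (a b : \bar R) (eps : R) (G : R -> R -> V3 R) (N : R -> V3 R).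
Local Notation I := (oitv a b).
Local Notation K := (var_support I G).
Hypotheses (e0 : 0 < eps) (sG : smoothV2 G [set p | I p.1 /\ `|p.2| < eps])
  (legG : forall tau, `|tau| < eps -> legendrian_lift I (fun t => G t tau))
  (nN : normalized_lift I (fun t => G t 0) N).
Variables (c' c d d' : R).
Hypotheses (cc : c' < c) (cd : c < d) (dd : d < d')
  (cI : forall t, c' <= t <= d' -> I t) (Kcd : forall t, K t -> c < t < d)
  (cK : compact K) (Na : forall t, c' <= t <= d' -> fub_a N t != 0).

(** The imaginary number v0 = <G, dG/ds>/q at parameter 0, divided by i; the term nu <G, G> coming
    from [covs] is 0 because the lift is null. *)
Definition field_height (t : R) : R :=
  Im (herm (G t 0) (dtauV G t 0)) /
  Re (herm (dV (fun t => G t 0) t) (dV (fun t => G t 0) t)).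

(** The term z [EL] v0 of [strain_variation], with z = |a|^(1/3)/(2ia), [EL] = 4 t/a^5 for the
    stress density t, and v0 = i [field_height]. *)
Definition EL_density (t : R) : R :=
  2 * `|fub_a N t| `^ (3^-1) * stress N t / fub_a N t ^+ 6 * field_height t.

Let J := [set s : R | `|s| < eps].
Let oJ : open J := @open_norm_lt eps.
Let oI := @open_oitv R a b.

(** No condition on a is imposed, so this serves cycles as well. Joint continuity comes from the
    imaginary part of [alpha], computed from [G] itself, while normalized lifts are taken for one
    parameter at a time. *)
Lemma strain_density_values : exists al : R -> R -> R,
  [/\ forall t s : R, I t -> `|s| < eps -> {for (t, s), continuous (fun q : R * R => al q.1 q.2)},
      forall t, I t -> al t 0 = 2 * fub_a N t &
      forall s : R, `|s| < eps -> exists2 M, normalized_lift I (fun t => G t s) M &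
      forall t, I t -> al t s = 2 * fub_a M t /\
        strain_density I (fun t => G t s) t = `|al t s / 2| `^ (3^-1)].
Proof.
have [S] := smoothRing_exists (rect oI oJ).
have [g gG] := repr_exists S sG.
have [qi qqi] := leg_qi gG legG.
exists (fun t s => Im (ev (alpha g qi) t s)); split.
- move=> t s It Js; have [_ h] := ev_smooth (alpha g qi).
  by have [] := smooth2_reg1 h (conj It Js : (oset (rect oI oJ)) (t, s)).
- move=> t It; have J0 : J 0 by rewrite /J /= normr0.
  by have [-> _] := normalized_values gG legG qqi J0 nN It.
- move=> s Js; have [M nM] := normalized_exists gG legG qqi Js; exists M => // t It.
  have [eM _] := normalized_values gG legG qqi Js nM It; split; first by rewrite eM.
  exact: (strain_densityE gG legG qqi Js It).
Qed.

Let I' := oitv c'%:E d'%:E.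
Let oI' := @open_oitv R c'%:E d'%:E.
Let I'E t : I' t <-> c' < t < d'.
Proof. by rewrite /I' /oitv /= !lte_fin; split=> [[-> ->]|/andP[]]. Qed.
Let I'I t : I' t -> I t.
Proof. by move=> /I'E /andP[h1 h2]; apply: cI; rewrite !ltW. Qed.

(** Differentiation under the integral sign over K leaves the integral of h, the parameter
    derivative of the strain at 0. The fundamental theorem does not apply to the compact set K, but
    h vanishes on [c, d] off K, and over [c, d] the identity of [strain_variation] can be
    integrated. The margins between c' and c and between d and d' leave room for the open rectangle
    on which the frame lives. *)
Lemma strain_functional_derivative : exists P : R -> R,
  [/\ forall t, c' < t < d' -> derivable P t 1 /\ derive1 P t = EL_density t,
      derivable (strain_functional I G) 0 1 &
      derive1 (strain_functional I G) 0 = (P d - P c) / 18].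
Proof.
have [al [cal al0 alM]] := strain_density_values.
have J0 : `|0 : R| < eps by rewrite normr0.
(* By compactness of [c', d'] the first Fubini density stays nonzero for small parameters, so
   [alpha] is invertible over a smaller rectangle. *)
have [eta eta0 Heta] : exists2 eta : R, 0 < eta &
    forall t s : R, c' <= t <= d' -> `|s| < eta -> (`|s| < eps) /\ al t s != 0.
  apply: (@tube R c' d' (fun p => (`|p.2| < eps) /\ al p.1 p.2 != 0)) => t tcd.
  have It := cI tcd.
  have n1 := open_nbhs_nbhs (conj (open_setX openT oJ) (conj Logic.I J0 : (setT `*` J) (t, 0))).
  suff n2 : \forall p \near (t, (0 : R)), al p.1 p.2 != 0.
    by apply: filterS (filterI n1 n2) => -[x y] [[_ /= Jy] ayx]; split.
  have c0 := cal t 0 It J0; apply: (cvgr_neq0 (al t 0)) c0 _.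
  by rewrite al0// mulf_neq0 ?Na// pnatr_eq0.
have eta_eps (s : R) : `|s| < eta -> `|s| < eps.
  move=> h; have [] := Heta c' s _ h => //; rewrite lexx /=.
  by apply: ltW; apply: lt_trans cc _; apply: lt_trans cd dd.
pose J' := [set s : R | `|s| < eta].
have oJ' : open J' := @open_norm_lt eta.
have [S] := smoothRing_exists (rect oI' oJ').
have sG' : smoothV2 G (oset (rect oI' oJ')).
  move=> k k6; apply: sm2P; apply: smooth2_sub (Sm2 (sG k6)) => -[t s] [/= /I'I It Js].
  by split=> //=; exact: eta_eps.
have legG' tau : J' tau -> legendrian_lift I' (fun t => G t tau).
  by move=> /eta_eps Jt; apply: legendrian_lift_sub (legG Jt) => t /I'I.
have J'0 : J' 0 by rewrite /J' /= normr0.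
have [g gG] := repr_exists S sG'.
have [qi qqi] := leg_qi gG legG'.
have alE t s : I' t -> J' s -> Im (ev (alpha g qi) t s) = al t s.
  move=> It Js; have [M nM aM] := alM s (eta_eps _ Js).
  have nM' : normalized_lift I' (fun t => G t s) M by apply: normalized_lift_sub nM => r /I'I.
  have [-> _] := normalized_values gG legG' qqi Js nM' It.
  by have [-> _] := aM t (I'I It).
have nN' : normalized_lift I' (fun t => G t 0) N by apply: normalized_lift_sub nN => r /I'I.
have h00 := leg_h00 gG legG'; have h01 := leg_h01 gG legG'.
have nz p : oset (rect oI' oJ') p -> Im (ev (alpha g qi) p.1 p.2) != 0.
  case: p => t r [/= It Jr]; rewrite alE//.
  by have [] := Heta t r _ Jr => //; have /I'E /andP[h1 h2] := It; rewrite !ltW.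
have [ai [s [ala s6 sE]]] := strain_elements nz.
set q := hm (vdt g) (vdt g) in qqi.
(* The real solution -(ds q)/(2q) of the metric condition, as [3 * sixth] is 1/2. *)
pose nu : S := - (3 * sixth * ds q * qi).
have cq : cj q = q := cj_q (erefl q).
have cqi : cj qi = qi := cj_qi (erefl q) qqi.
have hnu : cj nu + nu = - (ds q * qi).
  rewrite /nu cjN !cjM cjn cj_sixth cj_ds cq cqi.
  transitivity (- (6 * sixth * (ds q * qi))); first by ring.
  by rewrite sixthE mul1r.
set m := strain_m (alpha g qi) ai.
pose z := s * ai; pose be := frame_b qi g.
pose v0 := br qi g (covs nu g); pose v1 := br qi (fr1 qi g) (covs nu g).
pose W := 9 * s * tangent_part g qi nu - bilin z be v0.
have main : 18 * ds s = dt W + z * EL m be * v0.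
  apply: (strain_variation h00 h01 (erefl q) qqi hnu).
  - exact: strain_dt.
  - exact: strain_dal.
  - exact: strain_z.
  - exact: strain_dz.
  - exact: strain_ds.
pose sR t r := Re (ev s t r).
have [ssR _] := ev_smooth s.
have dens t r : I' t -> J' r -> strain_density I (fun t => G t r) t = sR t r.
  move=> It Jr; have [M nM aM] := alM r (eta_eps _ Jr).
  have [_ ->] := aM t (I'I It).
  by rewrite /sR (sE (t, r))//= alE.
have KI' t : K t -> I' t.
  by move=> /Kcd /andP[h1 h2]; apply/I'E; rewrite (lt_trans cc)// (lt_trans h2).
have cdI' t : c <= t <= d -> I' t.
  by move=> /andP[h1 h2]; apply/I'E; rewrite (lt_le_trans cc)// (le_lt_trans h2).
have clK : closed K by exact: closed_closure.
have mK : measurable K by exact: measurable_realfun.compact_measurable.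
have e20 : 0 < eta / 2 by lra.
have in2 r : `|r| <= eta / 2 -> J' r by move=> h; rewrite /J' /=; apply: le_lt_trans h _; lra.
have [M HM] : exists M : R, forall t r, c <= t <= d -> `|r| <= eta / 2 ->
    `|dpart true sR t r| <= M.
  apply: bounded_rectangle; [exact: ltW|exact: ltW|].
  move=> t r tcd /in2 Jr.
  have U : oset (rect oI' oJ') (t, r) by split; [exact: cdI'|exact: Jr].
  have [ct _ _] := smooth2_reg1 (smooth2_dpart true ssR) U.
  exact ct.
have icst (k : R -> R) : (forall t, K t -> {for t, continuous k}) ->
    lebesgue_measure.-integrable K (EFin \o k).
  move=> ck; apply: continuous_compact_integrable => //.
  by apply: continuous_in_subspaceT => t; rewrite inE; exact: ck.
have sl r : J' r -> sm1 I' (fun t => sR t r).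
  move=> Jr; have := @smooth2_slice _ _ _ r ssR; apply: sm1_sub => t It; by split.
pose F r := \int[lebesgue_measure]_(t in K) sR t r.
pose V : set R := `](- (eta / 2)), (eta / 2)[%classic.
have in2' x : V x -> `|x| <= eta / 2.
  by rewrite /V /= in_itv /= => /andP[h1 h2]; rewrite ler_norml !ltW.
have under1 : forall x, V x ->
    lebesgue_measure.-integrable K (EFin \o (fun t => sR t x)).
  move=> x /in2' /in2 Jx; apply: icst => t /KI' It.
  exact: smooth1_continuous (sl x Jx) It.
have under2 : forall x y, V x -> K y ->
    derivable ((fun x t => sR t x) ^~ y) x 1.
  move=> x y /in2' /in2 Jx /KI' Iy.
  by have [_ _] := smooth2_reg1 ssR (conj Iy Jx : oset (rect oI' oJ') (y, x)).
have under3 : lebesgue_measure.-integrable K (EFin \o (fun _ => `|M|)).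
  by apply: icst => t _; exact: cst_continuous.
have under4 : forall x y, V x -> K y ->
    `|partial1of2 (fun x t => sR t x) x y| <= `|M|.
  move=> x y /in2' hx /Kcd /andP[/ltW h1 /ltW h2].
  by apply: le_trans (ler_norm M); apply: HM => //; rewrite h1 h2.
have x00 : V 0 by rewrite /V /= in_itv /= oppr_lt0 e20.
have dF := @derivable_under_integral R _ _ lebesgue_measure (fun x t => sR t x) K mK 0
  (- (eta / 2)) (eta / 2) x00 under1 under2 (fun _ => `|M|) (fun _ => normr_ge0 M) under3 under4.
have dF' := @differentiation_under_integral R _ _ lebesgue_measure (fun x t => sR t x) K mK 0
  (- (eta / 2)) (eta / 2) x00 under1 under2 (fun _ => `|M|) (fun _ => normr_ge0 M) under3 under4.
have FE : \forall r \near (0 : R), F r = strain_functional I G r.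
  apply: filterS (open_nbhs_nbhs (conj oJ' J'0)) => r Jr.
  by apply: eq_Rintegral => t; rewrite inE => /KI' It; rewrite dens.
have dS : derivable (strain_functional I G) 0 1 by apply: near_eq_derivable dF.
have eS : derive1 (strain_functional I G) 0 = \int[lebesgue_measure]_(t in K)
    derive1 (fun r => sR t r) 0.
  transitivity (derive1 F 0); last exact: dF'.
  by rewrite !derive1E; apply: near_eq_derive; apply: filterS FE => r ->.
pose h t := derive1 (fun r => sR t r) 0.
pose w t := Re (ev W t 0).
have Up t : I' t -> oset (rect oI' oJ') (t, 0) by move=> It; split.
have hE t : I' t -> 18 * h t = derive1 w t + EL_density t.
  move=> It; have U := Up t It.
  have E1 : 18 * ev (ds s) t 0 = ev (dt W) t 0 + ev (z * EL m be * v0) t 0.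
    by have := congr1 (fun x => ev x t 0) main; rewrite (evM _ _ U) (evn _ _ U) (evD _ _ U).
  have re18 (x : C) : Re (18 * x) = 18 * Re x.
    by rewrite -(rmorph_nat (real_complex R)); case: x => x1 x2 /=; ring.
  have -> : 18 * h t = Re (18 * ev (ds s) t 0) by rewrite re18 (ev_ds _ U).
  have -> : derive1 w t = Re (ev (dt W) t 0) by rewrite (ev_dt _ U).
  rewrite E1 ReD; congr (_ + _).
  rewrite (evM (z * EL m be) v0 U) (evM z _ U) (evM s ai U) /= (sE _ U) (stress_EL gG legG' qqi J'0 nN' ala It) /=.
  have [alN _] := normalized_values gG legG' qqi J'0 nN' It.
  have tcd : c' <= t <= d' by have /I'E /andP[h1 h2] := It; rewrite !ltW.
  have a0 := Na tcd.
  have aiE : ev ai t 0 = Complex 0 (- (2 * fub_a N t)^-1).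
    have := congr1 (fun x => ev x t 0) ala; rewrite (evM _ _ U) (ev1 _ U) /= alN.
    have n0 : Complex 0 (2 * fub_a N t) != 0 :> C.
      by rewrite eq_complex /= negb_and mulf_neq0 ?orbT ?pnatr_eq0.
    move=> e1; apply: (mulfI n0); rewrite e1.
    apply: complexP => /=; last by ring.
    by field; rewrite a0.
  rewrite aiE alN /=.
  have v0E : ev v0 t 0 = Complex 0 (field_height t).
    have cv : cj v0 = - v0 := cj_v0 h00 (erefl q) qqi hnu.
    have re0 : Re (ev v0 t 0) = 0.
      have := congr1 (fun x => Re (ev x t 0)) cv; rewrite (ev_cj _ U) (evN _ U) ReJ ReN => /eqP.
      by rewrite -addr_eq0 -mulr2n mulrn_eq0 /= => /eqP.
    have ev0E : ev v0 t 0 = ev qi t 0 * herm (G t 0) (dtauV G t 0).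
      have -> : v0 = qi * hm g (vds g).
        by rewrite /v0 /br covsE hmDr hmZr h00 mulr0 addr0.
      by rewrite (evM _ _ U) (ev_hm _ _ U) /= (gG _ U) (repr_ds gG U).
    have [r r0 qE] := leg_q gG legG' U.
    have qiE : ev qi t 0 = Complex r^-1 0.
      have := congr1 (fun x => ev x t 0) qqi; rewrite (evM _ _ U) (ev1 _ U) /= qE.
      have n0 : Complex r 0 != 0 :> C by rewrite eq_complex /= negb_and gt_eqF.
      move=> e1; apply: (mulfI n0); rewrite e1.
      by apply: complexP => /=; [rewrite divff ?gt_eqF//; ring|ring].
    have rE : Re (herm (dV (fun t => G t 0) t) (dV (fun t => G t 0) t)) = r.
      have h1 := ev_hm (vdt g) (vdt g) U; rewrite (repr_dt gG U) qE in h1.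
      exact: (esym (congr1 (@complex.Re R) h1)).
    apply: complexP => //=; rewrite ev0E qiE /field_height rE.
    by case: (herm _ _) => x y /=; ring.
  rewrite v0E /EL_density /= mulrC.
  have -> : 2 * fub_a N t / 2 = fub_a N t by field.
  by field; rewrite a0.
have oZ : open (~` K) by exact: closed_openC.
have line t : I' t -> ~ K t -> in_line (dtauV G t 0) (G t 0).
  move=> It nK; apply: contrapT => nl; apply: nK; apply: subset_closure.
  by split; first exact: I'I.
(* At parameter 0 and off K, both the variation and its covariant form are multiples of [g], so
   their products with vectors orthogonal to [g] vanish: here [g] itself and [fr1]. The complement
   of K is open, so derivatives along the curve vanish too. *)
have vz u t : I' t -> ~ K t -> br qi u g = 0 -> ev (br qi u (covs nu g)) t 0 = 0.
  move=> It nK ug; have U := Up t It; have [l lE] := line t It nK.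
  have -> : br qi u (covs nu g) = br qi u (vds g) + nu * br qi u g.
    by rewrite covsE /br hmDr hmZr; ring.
  rewrite ug mulr0 addr0 (evM _ _ U) (ev_hm _ _ U) (repr_ds gG U) /= lE -(gG _ U) /=.
  have -> (y : V3 R) : herm y (scaleV3 l (vev g t 0)) = l * herm y (vev g t 0).
    by rewrite /herm /scaleV3 /mkV3 /c1 /c2 /c3 /=; ring.
  have := congr1 (fun x => ev x t 0) ug; rewrite (evM _ _ U) (ev_hm _ _ U) (ev0 _ U) /= => e1.
  by rewrite mulrCA e1 mulr0.
have b0 : br qi g g = 0 by exact: br00.
have b1 : br qi (fr1 qi g) g = 0 by exact: (br10 h00 h01 (erefl q) qqi).
have v0z t : I' t -> ~ K t -> ev v0 t 0 = 0 by move=> It nK; exact: vz.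
have v1z t : I' t -> ~ K t -> ev v1 t 0 = 0 by move=> It nK; exact: vz.
have v0k n t : I' t -> ~ K t -> ev (dtk n v0) t 0 = 0.
  by move=> It nK; exact: (@ev_dtk_zero _ _ _ _ _ _ 0 J'0 v0 _ oZ v0z n t).
have Wz t : I' t -> ~ K t -> ev W t 0 = 0.
  move=> It nK; have U := Up t It.
  have eM x y : ev (x * y) t 0 = ev x t 0 * ev y t 0 := evM x y U.
  have eD x y : ev (x + y) t 0 = ev x t 0 + ev y t 0 := evD x y U.
  have eN x : ev (- x) t 0 = - ev x t 0 := evN x U.
  have k1 := v0k 1%N t It nK; have k0 := v0z t It nK; have kv1 := v1z t It nK.
  rewrite /dtk /= in k1.
  have kz : ev (tangent_part g qi nu) t 0 = 0.
    by rewrite /tangent_part -/v0 -/v1 eD eN eM kv1 k1 mulr0 oppr0 addr0.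
  rewrite /W eD eN eM kz mulr0 add0r.
  rewrite /bilin; move: (z * (8 * be ^+ 2 + _)) (z * (15 * dt be)) (z * (10 * be)) (z * 2).
  move=> d1 d2 d3 d5.
  have vk n := v0k n t It nK.
  by rewrite !(k0, k1, vk, eD, eN, eM) !mulr0 !oppr0 !addr0 oppr0.
have hz t : c <= t <= d -> ~ K t -> h t = 0.
  move=> tcd nK; have It := cdI' t tcd.
  apply: (@mulfI _ 18); rewrite ?pnatr_eq0// mulr0 hE//.
  have U := Up t It.
  have -> : derive1 w t = Re (ev (dt W) t 0) by rewrite (ev_dt _ U).
  have -> : ev (dt W) t 0 = 0.
    exact: (@ev_dtk_zero _ _ _ _ _ _ 0 J'0 W _ oZ Wz 1%N t It nK).
  rewrite /EL_density; have [l lE] := line t It nK.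
  suff -> : field_height t = 0 by rewrite mulr0 addr0.
  rewrite /field_height lE.
  have -> : herm (G t 0) (scaleV3 l (G t 0)) = l * herm (G t 0) (G t 0).
    by rewrite /herm /scaleV3 /mkV3 /c1 /c2 /c3 /=; ring.
  have [_ /(_ t (I'I It)) [_ -> _ _]] := legG J0.
  by rewrite mulr0 mul0r.
have nKc : ~ K c by move=> /Kcd; rewrite ltxx.
have nKd : ~ K d by move=> /Kcd; rewrite ltxx andbF.
have sW : sm1 I' w.
  have [sW _] := ev_smooth W; have := @smooth2_slice _ _ _ 0 sW.
  by apply: sm1_sub => t It; split.
have sh : sm1 I' h.
  have := @smooth2_slice _ _ _ 0 (smooth2_dpart true ssR).
  by apply: sm1_sub => t It; split.
(* Smoothness of [EL_density] is obtained from its expression as 18 h - w'. *)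
have sE' : sm1 I' EL_density.
  have dw := smooth1_derive1 sW.
  apply: (sm1_eq oI' _ (sm1D oI' (sm1M oI' (smooth1_cst I' 18) sh) (sm1N oI' dw))) => t It.
  by rewrite /= hE// addrAC subrr add0r.
have [P dP] := primitive_exists (fun t It => smooth1_continuous sE' It).
exists P; split; [by move=> t /I'E; exact: dP|exact: dS|rewrite eS].
have Kcd' t : K t -> c <= t <= d by move=> /Kcd /andP[/ltW -> /ltW ->].
(* (w + P)/18 is a primitive of h, and the boundary term w is 0 at [c] and [d], which lie outside
   K. *)
have D1 t : c <= t <= d -> derivable (fun t => 18^-1 * (w t + P t)) t 1 /\
    derive1 (fun t => 18^-1 * (w t + P t)) t = h t.
  move=> tcd; have It := cdI' t tcd; have /I'E tcd' := It.
  have [dPt ePt] := dP t It; have dw := smooth1_derivable sW It.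
  have dk : derivable (fun _ : R => (18^-1 : R)) t 1 by exact: derivable_cst.
  have dwp := derivableD dw dPt.
  split; first exact: (derivableM dk dwp).
  rewrite derive1E (deriveM dk dwp) -!derive1E derive1_cst scaler0 addr0.
  rewrite derive1E (deriveD dw dPt) -!derive1E ePt -hE//.
  by rewrite /GRing.scale /= mulrA mulVf ?mul1r ?pnatr_eq0.
have C1 t : c <= t <= d -> {for t, continuous h}.
  by move=> tcd; exact: smooth1_continuous sh (cdI' t tcd).
have E1 := @Rintegral_restrict R K c d h Kcd' hz mK.
have E2 := @FTC2_segment R c d _ h cd D1 C1.
have wc : w c = 0 by rewrite /w Wz//; apply: cdI'; rewrite lexx ltW.
have wd : w d = 0 by rewrite /w Wz//; apply: cdI'; rewrite lexx ltW.
transitivity (\int[lebesgue_measure]_(t in K) h t); first by [].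
by rewrite E1 E2 wc wd; field.
Qed.

End FunctionalDerivative.

(** * A single curve and its normalized lift *)

Section NormalizedLift.
Variable R : realType.
Local Notation C := (complex R).
Variables (a b : \bar R).
Local Notation I := (oitv a b).
Let oI := @open_oitv R a b.
Let O := rect oI (@openT R).

(** A single curve is treated as a family constant in the parameter, so that the results on families
    apply to it. *)
Lemma constant_family (S : smoothRing O) (Gam : R -> V3 R) : smoothV Gam I ->
  exists g : vec S, represents g (fun t _ => Gam t).
Proof.
move=> sG; apply: repr_exists => k k6; apply: sm2P.
by apply: (smooth2_lift (osetP O) _ (Sm1 (sG k k6))) => p [].
Qed.

Lemma constant_legendrian (Gam : R -> V3 R) : legendrian_lift I Gam ->
  forall tau, (setT : set R) tau -> legendrian_lift I (fun t => (fun t (_ : R) => Gam t) t tau).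
Proof. by []. Qed.

Variables (Gam N : R -> V3 R).
Hypotheses (legG : legendrian_lift I Gam) (nN : normalized_lift I Gam N).

Lemma normalized_herm t : I t -> [/\ herm (N t) (N t) = 0, herm (N t) (dV N t) = 0
  & herm (dV N t) (dV N t) = 1].
Proof.
move=> It; have [S] := smoothRing_exists O.
have [g gG] := constant_family S (proj1 legG).
have lG := constant_legendrian legG.
have [qi qqi] := leg_qi gG lG.
have [n [nN' n00 n01 n11 _]] := @normalized_frame _ _ _ _ _ _ _ _ gG lG qi qqi 0 Logic.I N nN.
have Up : oset O (t, 0) by split.
have r1 := repr_dt nN' Up; have r0 := nN' _ Up; rewrite /= in r0 r1.
have h00 := ev_hm n n Up; have h01 := ev_hm n (vdt n) Up; have h11 := ev_hm (vdt n) (vdt n) Up.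
rewrite /= r0 n00 (ev0 _ Up) in h00; rewrite /= r0 r1 n01 (ev0 _ Up) in h01.
by rewrite /= r1 n11 (ev1 _ Up) in h11.
Qed.

Lemma normalized_legendrian : legendrian_lift I N.
Proof.
split; first by have [] := nN.
move=> t It; have [h00 h01 h11] := normalized_herm It; split=> //.
- have [_ /(_ t It) [[l [l0 ->]] _]] := nN.
  have [_ /(_ t It) [nz _ _ _]] := legG; move=> e; apply: nz.
  rewrite -[Gam t]scale1V3 -(mulVf l0) -scaleV3A e.
  by rewrite /scaleV3 /mkV3 /c1 /c2 /c3 /= !mulr0.
- move=> [l lE]; move: h11; rewrite lE herm_scale h00 mulr0 => /eqP.
  by rewrite eq_sym oner_eq0.
Qed.

Lemma normalized_self : normalized_lift I N N.
Proof.
have [sN H] := nN; split=> // t It; have [_ ->] := H t It; split=> //.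
by exists 1; rewrite oner_eq0 scale1V3.
Qed.

Lemma normalized_fub_smooth : sm1 I (fub_a N) /\ sm1 I (fub_b N).
Proof.
have [S] := smoothRing_exists O.
have [g gG] := constant_family S (proj1 legG).
have lG := constant_legendrian legG.
have [qi qqi] := leg_qi gG lG.
exact: (@fub_smooth _ _ _ _ _ _ _ _ gG lG qi qqi 0 N Logic.I nN).
Qed.

Lemma sm1_derive1n (f : R -> R) n : sm1 I f -> sm1 I (derive1n n f).
Proof. by move=> sf; elim: n => [//|n IH]; rewrite derive1nS; exact: smooth1_derive1. Qed.

Lemma sm1X (f : R -> R) n : sm1 I f -> sm1 I (fun t => f t ^+ n).
Proof.
move=> sf; elim: n => [|n IH]; first exact: (smooth1_cst I 1).
apply: (sm1_eq oI _ (sm1M oI sf IH)) => t _; by rewrite exprS.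
Qed.

Lemma stress_smooth : sm1 I (stress N).
Proof.
have [sa sb] := normalized_fub_smooth.
have A0 n := sm1_derive1n n sa; have B0 n := sm1_derive1n n sb.
rewrite /stress.
have [al alE] : exists al : nat -> R -> R, forall n, derive1n n (fub_a N) = al n.
  by exists (fun n => derive1n n (fub_a N)).
have [be beE] : exists be : nat -> R -> R, forall n, derive1n n (fub_b N) = be n.
  by exists (fun n => derive1n n (fub_b N)).
have A n : sm1 I (al n) by rewrite -alE.
have B n : sm1 I (be n) by rewrite -beE.
have a0 : fub_a N = al 0%N by rewrite -alE.
have b0 : fub_b N = be 0%N by rewrite -beE.
rewrite a0 b0 in alE beE *; cbv zeta.
under [X in sm1 _ X]funext => t do rewrite !alE !beE.
have D2 (f g : R -> R) : sm1 I f -> sm1 I g -> sm1 I (fun t => f t + g t) := sm1D oI.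
have N2 (f : R -> R) : sm1 I f -> sm1 I (fun t => - f t) := sm1N oI.
have M2 (f g : R -> R) : sm1 I f -> sm1 I g -> sm1 I (fun t => f t * g t) := sm1M oI.
have X2 (f : R -> R) n : sm1 I f -> sm1 I (fun t => f t ^+ n) := @sm1X f n.
have K2 (k : R) : sm1 I (fun=> k) := smooth1_cst I k.
repeat lazymatch goal with
| |- sm1 _ (fun _ => ?k) => exact (K2 k)
| |- sm1 _ (fun t => _ + _) => refine (D2 _ _ _ _)
| |- sm1 _ (fun t => - _) => refine (N2 _ _)
| |- sm1 _ (fun t => _ * _) => refine (M2 _ _ _ _)
| |- sm1 _ (fun t => _ ^+ _) => refine (X2 _ _ _)
| |- sm1 _ (al _) => exact (A _)
| |- sm1 _ (be _) => exact (B _)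
end.
Qed.

Lemma sm1_neq0 (f : R -> R) t : sm1 I f -> I t -> f t != 0 -> \forall s \near t, f s != 0.
Proof.
move=> sf It ft; have c := smooth1_continuous sf It.
by apply: (cvgr_neq0 (f t)) c _.
Qed.

Lemma c1_norm_smooth : sm1 I (fun t => Re (c1 (N t)) ^+ 2 + Im (c1 (N t)) ^+ 2).
Proof.
have [sN _] := nN.
have s0 : sm1 I (fun t => Re (c1 (N t))) := Sm1 (sN 0%N isT).
have s1 : sm1 I (fun t => Im (c1 (N t))) := Sm1 (sN 1%N isT).
exact: (sm1D oI (sm1X 2 s0) (sm1X 2 s1)).
Qed.

Lemma c1_norm_neq0 (x : C) : (Re x ^+ 2 + Im x ^+ 2 != 0) = (x != 0).
Proof.
case: x => x y; rewrite paddr_eq0 ?sqr_ge0//= !sqrf_eq0.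
by rewrite eq_complex.
Qed.

(** Each monomial of the stress density contains a or a', so the values of the higher derivatives
    are irrelevant. *)
Lemma stress_cycle t : I t -> (\forall s \near t, fub_a N s = 0) -> stress N t = 0.
Proof.
move=> It z; rewrite /stress; cbv zeta.
have -> : derive1n 1 (fub_a N) t = 0.
  rewrite derive1n1 derive1E (near_eq_derive (1 : R) (g := fun _ => 0)) //.
  by rewrite -derive1E derive1_cst.
rewrite (nbhs_singleton z).
repeat match goal with |- context [derive1n ?n ?f t] => generalize (derive1n n f t) => ? end.
generalize (fub_b N t) => ?; ring.
Qed.

(** The stress is nonzero near [t0]. If a vanished at all those points, [stress_cycle] would give
    stress 0 at [t0]. If the first coordinate of N vanished near a point, <N, N> = 0 would make the
    second vanish as well; N' would then have only a third coordinate, against <N', N'> = 1. *)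
Lemma regular_point t0 : I t0 -> stress N t0 != 0 ->
  exists t1, [/\ I t1, stress N t1 != 0, fub_a N t1 != 0 & c1 (N t1) != 0].
Proof.
move=> It0 st0.
have nI t : I t -> \forall s \near t, I s by move=> It; exact: open_nbhs_nbhs (conj oI It).
have [sa _] := normalized_fub_smooth; have ss := stress_smooth.
have [t2 [It2 st2 at2]] : exists t, [/\ I t, stress N t != 0 & fub_a N t != 0].
  apply: contrapT => no; case/eqP: (st0); apply: (stress_cycle It0).
  apply: filterS (filterI (nI _ It0) (sm1_neq0 ss It0 st0)) => s [Is ssn].
  by apply/eqP; apply/negPn/negP => h; apply: no; exists s.
apply: contrapT => no.
have z1 : \forall s \near t2, I s /\ c1 (N s) = 0.
  apply: filterS (filterI (nI _ It2) (filterI (sm1_neq0 ss It2 st2) (sm1_neq0 sa It2 at2))) => s.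
  move=> [Is [h1 h2]]; split=> //.
  by apply/eqP; apply/negPn/negP => h; apply: no; exists s.
have z2 : \forall s \near t2, c2 (N s) = 0.
  apply: filterS z1 => s [Is e1]; have [h00 _ _] := normalized_herm Is.
  move: h00; rewrite /herm e1 conjc0 !(mul0r, mulr0) subr0 mulr0 add0r => /eqP.
  by rewrite mulf_eq0 conjc_eq0 orbb => /eqP.
have [_ _] := normalized_herm It2.
have d1 : c1 (dV N t2) = 0.
  rewrite /dV /mkV3 /c1 /= -/c1 (@dC_near _ _ (fun _ => 0)); last by apply: filterS z1 => s [].
  by rewrite /dC /= !derive1_cst.
have d2 : c2 (dV N t2) = 0.
  rewrite /dV /mkV3 /c2 /= -/c2 (@dC_near _ _ (fun _ => 0))//.
  by rewrite /dC /= !derive1_cst.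
rewrite /herm d1 d2 conjc0 !(mul0r, mulr0) subr0 mulr0 add0r => /eqP.
by rewrite eq_sym oner_eq0.
Qed.

Lemma regular_interval t0 : I t0 -> stress N t0 != 0 -> exists t1 r : R, 0 < r /\
  forall t, `|t - t1| <= r -> [/\ I t, 0 < stress N t1 * stress N t, fub_a N t != 0 & c1 (N t) != 0].
Proof.
move=> It0 /(regular_point It0) [t1 [It1 st1 at1 ct1]]; exists t1.
have nI : \forall s \near t1, I s by exact: open_nbhs_nbhs (conj oI It1).
have [sa _] := normalized_fub_smooth; have ss := stress_smooth.
have n1 : \forall t \near t1, 0 < stress N t1 * stress N t.
  have sp := sm1M oI (smooth1_cst I (stress N t1)) ss.
  have c := smooth1_continuous sp It1.
  apply: (cvgr_gt (stress N t1 * stress N t1)) c _ _.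
  by rewrite -expr2 exprn_even_gt0.
have n2 := sm1_neq0 sa It1 at1.
have n3 : \forall t \near t1, c1 (N t) != 0.
  rewrite -c1_norm_neq0 in ct1.
  by apply: filterS (sm1_neq0 c1_norm_smooth It1 ct1) => t; rewrite c1_norm_neq0.
have : nbhs t1 [set t | [/\ I t, 0 < stress N t1 * stress N t, fub_a N t != 0 & c1 (N t) != 0]].
  by apply: filterS (filterI nI (filterI n1 (filterI n2 n3))) => t [h1 [h2 [h3 h4]]]; split.
move=> /nbhs_ballP[e /= e0 H].
exists (e / 2); split; first by lra.
move=> t te; apply: H; rewrite /ball /= distrC; apply: le_lt_trans te _; lra.
Qed.

End NormalizedLift.

(** * A non-stationary variation *)

Section Shear.
Variable A : diffRing.
Variables (z w e T lam h : A).
Hypotheses (z00 : ii * (w - cj w) + cj z * z = 0) (z01 : ii * dt w + cj z * dt z = 0).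
Hypotheses (ee : cj e * e = 1) (dte : dt e = 0) (dse : ds e = 0).
Hypotheses (cT : cj T = T) (dtT : dt T = 0) (dsT : ds T = 1).
Hypotheses (clam : cj lam = lam) (ch : cj h = h).
Hypotheses (dsz : ds z = 0) (dsw : ds w = 0) (dslam : ds lam = 0) (dsh : ds h = 0).
Hypothesis lamh : lam * (cj e * dt z - e * cj (dt z)) + ii * dt h = 0.

Let half : A := 3 * sixth.
Let hh : half + half = 1.
Proof. by rewrite /half -[RHS](sixthE A); ring. Qed.
Let dthalf : dt half = 0.
Proof. by rewrite /half dtM dtn dt_sixth; ring. Qed.
Let chalf : cj half = half.
Proof. by rewrite /half cjM cjn cj_sixth. Qed.
Let dshalf : ds half = 0.
Proof.
rewrite /half dsM dsn.
suff -> : ds (sixth : A) = 0 by ring.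
transitivity (6 * sixth * ds (sixth : A)); first by rewrite sixthE mul1r.
have : ds (6 * sixth : A) = 0 by rewrite sixthE ds1.
by rewrite dsM dsn mul0r add0r => e6; rewrite mulrAC e6 mul0r.
Qed.

(* In the chart [1 : z : w] the horizontal projection z is moved by T lam e; the other
   terms in w keep the curve on the quadric and Legendrian. *)
Definition sheared : vec A := (1, z + T * (lam * e),
  w + T * (ii * (cj z * (lam * e)) + h) + T * (T * (ii * (lam * (lam * half))))).

Lemma sheared00 : hm sheared sheared = 0.
Proof.
rewrite /hm -lock /sheared /=; move: half hh chalf => k kk ck.
rewrite !(cjD, cjM) cT clam ch cj_ii cjK ck cj1.
transitivity (ii * (w - cj w) + cj z * z + (1 + ii * ii) * (T * lam * (e * cj z + z * cj e))
  + (T * T * lam * lam) * (ii * ii * (k + k) + cj e * e)); first by ring.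
by rewrite z00 iiM kk ee; ring.
Qed.

Lemma sheared01 : hm sheared (vdt sheared) = 0.
Proof.
rewrite /hm -lock /sheared /vdt /=; move: half hh chalf dthalf => k kk ck dk.
rewrite dt1 !(cjD, cjM) cT clam ch cj_ii cjK ck cj1.
rewrite !(dtD, dtM) dtT dte dt_ii dk -!cj_dt.
transitivity (ii * dt w + cj z * dt z + T * (lam * (cj e * dt z - e * cj (dt z)) + ii * dt h)
  + (1 + ii * ii) * (T * lam * (e * cj (dt z))) + (1 + ii * ii) * (T * dt lam * (e * cj z))
  + (T * T * lam * dt lam) * (ii * ii * (k + k) + cj e * e)); first by ring.
by rewrite z01 lamh iiM kk ee; ring.
Qed.

Lemma sheared0s : hm sheared (vds sheared) = ii * h.
Proof.
rewrite /hm -lock /sheared /vds /=; move: half hh chalf dshalf => k kk ck dk.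
rewrite ds1 !(cjD, cjM) cT clam ch cj_ii cjK ck cj1.
rewrite !(dsD, dsM) dsT dse ds_ii dk dslam dsh -!cj_ds dsz dsw cj0.
transitivity (ii * h + (1 + ii * ii) * (lam * (e * cj z))
  + (T * lam * lam) * (ii * ii * (k + k) + cj e * e)); first by ring.
by rewrite iiM kk ee; ring.
Qed.

End Shear.

(** * The sheared lift of a given curve *)

Section Deformation.
Variable A : diffRing.
Variables (n : vec A) (ni e T eta : A).
Hypotheses (nni : n.1.1 * ni = 1) (h00 : hm n n = 0) (h01 : hm n (vdt n) = 0).
Hypotheses (nds : vds n = (0, 0, 0)) (ee : cj e * e = 1) (dte : dt e = 0) (dse : ds e = 0).
Hypotheses (cT : cj T = T) (dtT : dt T = 0) (dsT : ds T = 1) (ceta : cj eta = eta) (dseta : ds eta = 0).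

Definition chart2 : A := n.1.2 * ni.
Definition chart3 : A := n.2 * ni.
Local Notation z := chart2.
Local Notation w := chart3.

(** This is 2i Im(conj(e) z'), which vanishes where z' is a real multiple of the direction [e].
    Being imaginary it has a nonpositive square, whence the sign in [height], which is then
    nonnegative together with the bump. *)
Definition twist : A := cj e * dt z - e * cj (dt z).
Local Notation D := twist.
(* With the factor twist^2 in front of the bump eta, the equation
   [shear * twist + ii * dt height = 0] is solved without dividing by twist. *)
Definition height : A := - (D * D * eta).
Definition shear : A := ii * (2 * dt D * eta + D * dt eta).
Definition deformed : vec A := vZ n.1.1 (sheared z w e T shear height).

Lemma chartE : vZ ni n = (1, z, w).
Proof. by rewrite /vZ mulrC nni mulrC (mulrC ni n.2). Qed.

Let hz := hm_vdtZ ni h00 h01.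

(** In the chart [1 : z : w] the derivative of the lift is (0, z', w'), with norm |z'|^2. So z' does
    not vanish on an immersed Legendrian curve, and some constant direction [e] has a nonzero twist
    at a given point. *)
Lemma twist_dtz : cj (dt z) * dt z = cj ni * ni * hm (vdt n) (vdt n).
Proof.
by have [_ _ <-] := hz; rewrite chartE /hm -lock /vdt /= dt1 cj0; move: (dt z) (dt w) => *; ring.
Qed.

Lemma cj_twist : cj D = - D.
Proof. by rewrite /twist cjB !cjM !cjK; ring. Qed.

Lemma deformed_legendrian : [/\ hm deformed deformed = 0, hm deformed (vdt deformed) = 0 &
  hm deformed (vds deformed) = ii * (cj n.1.1 * n.1.1 * height)].
Proof.
have [ds1' ds2' ds3'] : [/\ ds n.1.1 = 0, ds n.1.2 = 0 & ds n.2 = 0] by case: nds.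
have dsni : ds ni = 0 by rewrite (ds_inv nni) ds1' mulr0 oppr0.
have dsz' : ds z = 0 by rewrite /chart2 dsM ds2' dsni mulr0 mul0r addr0.
have dsw' : ds w = 0 by rewrite /chart3 dsM ds3' dsni mulr0 mul0r addr0.
have z00 : ii * (w - cj w) + cj z * z = 0.
  by have [<- _ _] := hz; rewrite chartE /hm -lock /= cj1; move: z w => *; ring.
have z01 : ii * dt w + cj z * dt z = 0.
  by have [_ <- _] := hz; rewrite chartE /hm -lock /vdt /= cj1 dt1; move: z (dt z) (dt w) => *; ring.
have dstw : ds D = 0 by rewrite /twist dsB !dsM -!cj_ds !dsdt dse dsz' dt0 cj0; ring.
have dsh : ds height = 0 by rewrite /height dsN !dsM dstw dseta; ring.
have dslam : ds shear = 0 by rewrite /shear dsM dsD !dsM ds_ii !dsdt dstw dseta dsn dt0; ring.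
have ch : cj height = height by rewrite /height cjN !cjM cj_twist ceta; ring.
have clam : cj shear = shear.
  by rewrite /shear cjM cjD !cjM cj_ii !cj_dt cj_twist dtN ceta cjn; ring.
have lamh : shear * D + ii * dt height = 0.
  by rewrite /shear /height dtN !dtM; move: D (dt D) => *; ring.
have g00 := sheared00 z00 ee cT clam ch.
have g01 := sheared01 z01 ee dte cT dtT clam ch lamh.
have g0s := sheared0s (z := z) (w := w) ee dse cT dsT clam ch dsz' dsw' dslam dsh.
have [e0 e1 _] := hm_vdtZ n.1.1 g00 g01; split=> //.
have -> : vds deformed = vZ n.1.1 (vds (sheared z w e T shear height)).
  by rewrite /deformed /vds /vZ /= !(dsM n.1.1) ds1' !mul0r !add0r.
by rewrite /deformed hmZl hmZr g0s; move: height => ?; ring.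
Qed.

End Deformation.

Section LocalVariation.
Variable R : realType.
Local Notation C := (complex R).
Variables (a b : \bar R) (N : R -> V3 R).
Local Notation I := (oitv a b).
Hypotheses (legN : legendrian_lift I N) (nN : normalized_lift I N N).

Let oI := @open_oitv R a b.
Local Notation O := (rect oI (@openT R)).

(** The conclusions are those needed to glue [B] to [N]: agreement away from [t1], and an unchanged
    first coordinate, which keeps the lift nonzero. Immersivity is absent because it holds only for
    small parameters; it is deduced later from the continuity in the last clause. *)
Lemma local_deformation (t1 rho : R) : 0 < rho -> I t1 -> (forall t, I t -> c1 (N t) != 0) ->
  exists B : R -> R -> V3 R, exists h : R -> R,
  [/\ smoothV2 B (oset O),
      forall t s, I t -> [/\ c1 (B t s) = c1 (N t), herm (B t s) (B t s) = 0 &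
        herm (B t s) (dV (B^~ s) t) = 0],
      forall t, I t -> 0 <= h t /\ herm (B t 0) (dtauV B t 0) = Complex 0 (h t),
      0 < h t1 &
    [/\ forall t s, I t -> rho < `|t - t1| \/ s = 0 -> B t s = N t &
      forall t s, I t -> {for (t, s), continuous (fun q : R * R => Re (herm (dV (B^~ q.2) q.1) (dV (B^~ q.2) q.1)))}]].
Proof.
move=> rho0 It1 Nc.
have [S] := smoothRing_exists O.
have [n nG] := constant_family S (proj1 legN).
have UP t s : I t -> oset O (t, s) by [].
have n00 : hm n n = 0.
  apply: ev_ext => -[t s] Up; rewrite (ev_hm _ _ Up) (nG _ Up) (ev0 _ Up) /=.
  by have [_ /(_ _ (proj1 Up)) []] := legN.
have n01 : hm n (vdt n) = 0.
  apply: ev_ext => -[t s] Up; rewrite (ev_hm _ _ Up) (nG _ Up) (repr_dt nG Up) (ev0 _ Up) /=.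
  by have [_ /(_ _ (proj1 Up)) []] := legN.
have n11 : hm (vdt n) (vdt n) = 1.
  apply: ev_ext => -[t s] Up; rewrite (ev_hm _ _ Up) (repr_dt nG Up) (ev1 _ Up) /=.
  by have [] := normalized_herm legN nN (proj1 Up).
have evn1 t s : I t -> ev n.1.1 t s = c1 (N t) by move=> It; have := nG _ (UP t s It); case: (N t) => [[? ?] ?] [].
have nn_pos p : oset O p -> 0 < Re (ev (cj n.1.1 * n.1.1) p.1 p.2) /\ Im (ev (cj n.1.1 * n.1.1) p.1 p.2) = 0.
  case: p => t s Up; rewrite (evM _ _ Up) (ev_cj _ Up) /= (evn1 _ _ (proj1 Up)).
  have := Nc t (proj1 Up); case: (c1 (N t)) => x y; rewrite eq_complex negb_and /= => xy.
  split; last by ring.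
  have -> : x * x - - y * y = x ^+ 2 + y ^+ 2 by ring.
  by rewrite lt0r paddr_eq0 ?sqr_ge0// !sqrf_eq0 negb_and xy addr_ge0 ?sqr_ge0.
have [y yE] : exists y : S, cj n.1.1 * n.1.1 * y = 1.
  have [np1 np2] : (forall p, oset O p -> Im (ev (cj n.1.1 * n.1.1) p.1 p.2) = 0) /\
      (forall p, oset O p -> 0 < Re (ev (cj n.1.1 * n.1.1) p.1 p.2)).
    by split=> p /nn_pos [].
  exact: (inv_el np1 np2).
pose ni := cj n.1.1 * y.
have nni : n.1.1 * ni = 1 by rewrite /ni mulrCA mulrA.
have nds : vds n = (0, 0, 0).
  apply: vev_ext => -[t s] Up; rewrite (repr_ds nG Up) /= /vev /= !(ev0 _ Up) /dtauV /dV /dC.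
  by rewrite !derive1_cst.
have tz := twist_dtz nni n00 n01; rewrite n11 mulr1 in tz.
set z := chart2 n ni in tz.
have Up1 := UP t1 0 It1.
have dz0 : ev (dt z) t1 0 != 0.
  apply/eqP => dz; have := congr1 (fun x => ev (x * (cj n.1.1 * n.1.1)) t1 0) tz.
  rewrite (evM _ _ Up1) [in LHS](evM _ _ Up1) /= dz mulr0 mul0r.
  have -> : cj ni * ni * (cj n.1.1 * n.1.1) = 1.
    transitivity (cj (n.1.1 * ni) * (n.1.1 * ni)); first by rewrite cjM; ring.
    by rewrite nni cj1 mulr1.
  by rewrite (ev1 _ Up1) => /eqP; rewrite eq_sym oner_eq0.
(* The twist is 2i Im z' for e = 1 and -2i Re z' for e = i, so one of these two directions works at
   [t1]. *)
have [e [ee dte dse eD]] : exists e : S, [/\ cj e * e = 1, dt e = 0, ds e = 0 &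
    ev (twist n ni e) t1 0 != 0].
  have [re|im] : Im (ev (dt z) t1 0) != 0 \/ Re (ev (dt z) t1 0) != 0.
  - apply/orP; rewrite -negb_and; apply: contra dz0 => /andP[h1 h2].
    by rewrite eq_complex /= h1 h2.
  - exists 1; rewrite cj1 mulr1 dt1 ds1; split=> //.
    rewrite /twist -/z cj1 !mul1r (evD _ _ Up1) (evN _ Up1) (ev_cj _ Up1) /=.
    move: re; case: (ev (dt z) t1 0) => x x' /= x0.
    by rewrite eq_complex /= opprK negb_and -mulr2n mulrn_eq0 x0 orbT.
  - exists ii; rewrite cj_ii mulNr iiM opprK dt_ii ds_ii; split=> //.
    rewrite /twist -/z cj_ii (evD _ _ Up1) (evN _ Up1) !(evM _ _ Up1) (evN _ Up1) (ev_ii _ Up1) (ev_cj _ Up1) /=.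
    move: im; case: (ev (dt z) t1 0) => x x' /= x0.
    rewrite eq_complex /= negb_and; apply/orP; right.
    rewrite (_ : _ + _ = - (x *+ 2)); last by rewrite mulr2n; ring.
    by rewrite oppr_eq0 mulrn_eq0 x0.
have [u [su u0 ut1 uoff]] := bump_exists t1 rho0.
have oU := osetP O.
have [eta etaE] : exists x : S, forall p, oset O p -> ev x p.1 p.2 = Complex (u p.1) 0.
  by apply: (mk_real S (f := fun t _ => u t)); apply: (smooth2_lift oU _ su).
have [T TE] : exists x : S, forall p, oset O p -> ev x p.1 p.2 = Complex p.2 0.
  by apply: (mk_real S (f := fun _ s => s)); apply: (smooth2_liftr oU _ (sm1_id R)).
have ceta : cj eta = eta by apply/real_cj => p Up; rewrite etaE.
have cT : cj T = T by apply/real_cj => p Up; rewrite TE.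
have dC0 (k : C) (f : R -> C) t : (\forall s \near t, f s = k) -> dC f t = 0.
  by move=> nk; rewrite (dC_near nk) /dC !derive1_cst.
have dseta : ds eta = 0.
  apply: ev_ext => -[t s] Up; rewrite (ev_ds _ Up) (ev0 _ Up) /=.
  apply: (dC0 (Complex (u t) 0) (ev eta t)).
  by apply: filterS (open_near2 oU Up) => r Ur; exact: (etaE (t, r)).
have dtT : dt T = 0.
  apply: ev_ext => -[t s] Up; rewrite (ev_dt _ Up) (ev0 _ Up) /=.
  apply: (dC0 (Complex s 0) (fun t => ev T t s)).
  by apply: filterS (open_near1 oU Up) => r Ur; exact: (TE (r, s)).
have dsT : ds T = 1.
  apply: ev_ext => -[t s] Up; rewrite (ev_ds _ Up) (ev1 _ Up) /=.
  transitivity (dC (fun r => Complex r 0) s).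
    apply: (@dC_near _ (ev T t)).
    by apply: filterS (open_near2 oU Up) => r Ur; exact: (TE (t, r)).
  by rewrite /dC /= derive1_cst derive1_id.
have [b00 b01 b0s] := deformed_legendrian nni n00 n01 nds ee dte dse cT dtT dsT ceta dseta.
have Dim p : oset O p -> Re (ev (twist n ni e) p.1 p.2) = 0.
  move=> Up; have := congr1 (fun x => Re (ev x p.1 p.2)) (cj_twist n ni e).
  rewrite (ev_cj _ Up) (evN _ Up) ReJ ReN => /eqP.
  by rewrite -addr_eq0 -mulr2n mulrn_eq0 /= => /eqP.
have [g gE] : exists g : vec S, g = deformed n ni e T eta by exists (deformed n ni e T eta).
have evh p : oset O p -> ev (height n ni e eta) p.1 p.2 = Complex (Im (ev (twist n ni e) p.1 p.2) ^+ 2 * u p.1) 0.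
  move=> Up; rewrite /height (evN _ Up) (evM _ _ Up) (evM _ _ Up) (etaE _ Up).
  have := Dim _ Up; case: (ev (twist n ni e) p.1 p.2) => x x' /= ->.
  by apply: complexP => /=; ring.
pose B := vev g.
have gB : represents g B by [].
exists B; exists (fun t => (Re (c1 (N t)) ^+ 2 + Im (c1 (N t)) ^+ 2) * (Im (ev (twist n ni e) t 0) ^+ 2 * u t)).
have sB : smoothV2 B (oset O).
  move=> k k6; have [s1 s2] := ev_smooth g.1.1; have [s3 s4] := ev_smooth g.1.2.
  have [s5 s6] := ev_smooth g.2; apply: sm2P.
  by case: k k6 => [|[|[|[|[|[|//]]]]]] _.
split.
- exact: sB.
- move=> t s It; have Up := UP t s It; split.
  + have -> : c1 (B t s) = ev g.1.1 t s by [].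
    by rewrite gE /deformed /= mulr1 evn1.
  + by have := ev_hm g g Up; rewrite gE b00 (ev0 _ Up) /= -gE.
  + have := ev_hm g (vdt g) Up; rewrite {1 2}gE b01 (ev0 _ Up) /= => h1.
    by have := repr_dt gB Up => /= <-.
- move=> t It; have Up := UP t 0 It; split.
    have ut := u0 t; have sqr (x : R) : 0 <= x ^+ 2 by exact: sqr_ge0.
    by rewrite mulr_ge0 ?addr_ge0// mulr_ge0.
  have := repr_ds gB Up => /= <-; rewrite -(ev_hm g (vds g) Up) {1 2}gE b0s.
  rewrite !(evM _ _ Up) (ev_ii _ Up) (ev_cj _ Up) (evh _ Up) /= (evn1 t 0 It).
  by case: (c1 (N t)) => x x'; apply: complexP => /=; ring.
- have := Nc t1 It1; rewrite -c1_norm_neq0 => c1n.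
  rewrite mulr_gt0//; first by rewrite lt0r c1n addr_ge0 ?sqr_ge0.
  rewrite mulr_gt0// exprn_even_gt0//=.
  apply: contra eD => /eqP e0; rewrite eq_complex /= e0 eqxx andbT; apply/eqP.
  exact: (Dim (t1, 0) Up1).
- split.
  + move=> t s It ts; have Up := UP t s It.
    have [Tl Th] : ev T t s * ev (shear n ni e eta) t s = 0 /\
        ev T t s * ev (height n ni e eta) t s = 0.
      case: ts => [ts|->]; last by rewrite (TE _ (UP t 0 It)) /= -[Complex 0 0]/(0 : C) !mul0r.
      have far : \forall r \near t, rho < `|r - t1|.
        have c : {for t, continuous (fun r : R => `|r - t1|)}.
          apply: continuous_comp; last exact: norm_continuous.
          by apply: continuousB; [exact: cvg_id|exact: cst_continuous].
        by apply: (cvgr_gt `|t - t1|) c _ _.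
      have e0 : ev eta t s = 0 by rewrite (etaE _ Up) /= uoff// ltW.
      have e1 : ev (dt eta) t s = 0.
        rewrite (ev_dt _ Up) /=; apply: (dC0 0 (fun t => ev eta t s)).
        apply: filterS (filterI far (open_near1 oU Up)) => r [fr Ur].
        by rewrite (etaE _ Ur) /= uoff// ltW.
      rewrite /shear /height (evN _ Up) !(evM _ _ Up) (evD _ _ Up) !(evM _ _ Up) /= e0 e1.
      by rewrite !(mulr0, addr0, oppr0).
    have k2 : ev (n.1.1 * chart2 n ni) t s = c2 (N t).
      have -> : n.1.1 * chart2 n ni = n.1.2.
        by rewrite /chart2 mulrCA nni mulr1.
      by rewrite -(nG _ Up).
    have k3 : ev (n.1.1 * chart3 n ni) t s = c3 (N t).
      have -> : n.1.1 * chart3 n ni = n.2.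
        by rewrite /chart3 mulrCA nni mulr1.
      by rewrite -(nG _ Up).
    rewrite (evM _ _ Up) /= in k2; rewrite (evM _ _ Up) /= in k3.
    rewrite /B gE /vev /deformed /sheared /vZ /= mulr1 (evn1 t s It).
    have -> : N t = mkV3 (c1 (N t)) (c2 (N t)) (c3 (N t)) by case: (N t) => [[]].
    move: Tl Th k2 k3.
    move: (chart2 n ni) (chart3 n ni) (shear n ni e eta) (height n ni e eta) (3 * sixth).
    move=> z0 w0 lam h k Tl Th k2 k3.
    rewrite !((evM _ _ Up), (evD _ _ Up)) /= -k2 -k3; congr mkV3.
    * by rewrite mulrA Tl mul0r addr0.
    * move: Tl Th; move: (ev T t s) (ev lam t s) (ev h t s) => T0 l0 h0 Tl Th.
      set i := ev ii t s; set k0 := ev k t s; set e0 := ev e t s; set z1 := ev (cj z0) t s.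
      set n1 := ev n.1.1 t s.
      transitivity (n1 * ev w0 t s + n1 * (i * z1 * e0 + T0 * i * l0 * k0) * (T0 * l0) + n1 * (T0 * h0)).
        by ring.
      by rewrite Tl Th; ring.
  + move=> t s It; have Up := UP t s It.
    have [s1 _] := ev_smooth (hm (vdt g) (vdt g)).
    have [c _ _] := smooth2_reg1 s1 Up.
    have E q : oset O q -> Re (ev (hm (vdt g) (vdt g)) q.1 q.2) = Re (herm (dV (B^~ q.2) q.1) (dV (B^~ q.2) q.1)).
      by move=> Uq; rewrite (ev_hm _ _ Uq) (repr_dt gB Uq).
    rewrite /prop_for /continuous_at -(E _ Up); apply: cvg_trans c.
    apply: near_eq_cvg; apply: filterS (open_nbhs_nbhs (conj oU Up)) => q Uq.
    by rewrite E.
Qed.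
End LocalVariation.

(** * Monotonicity and the glued variation *)

Section Monotone.
Variable R : realType.
Implicit Types (f g : R -> R).

Lemma derive1_ge0_le f (x y : R) : x <= y ->
  (forall t, x <= t <= y -> derivable f t 1 /\ 0 <= derive1 f t) -> f x <= f y.
Proof.
rewrite le_eqVlt => /orP[/eqP->//|xy] df.
have [||z] := @MVT _ f (derive1 f) _ _ xy.
- move=> z; rewrite in_itv /= => /andP[xz zy]; rewrite derive1E; apply/derivableP.
  by have [] := df z; rewrite ?(ltW xz) ?(ltW zy).
- apply: derivable_within_continuous => z; rewrite in_itv /= => xzy.
  by have [] := df z.
rewrite in_itv /= => /andP[/ltW xz /ltW zy] e.
have [|_ d0] := df z; first by rewrite xz zy.
by rewrite -subr_ge0 e mulr_ge0// subr_ge0 ltW.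
Qed.

Lemma derive1_gt0_lt f (x y z : R) : x < z < y ->
  (forall t, x <= t <= y -> derivable f t 1 /\ 0 <= derive1 f t) -> 0 < derive1 f z -> f x < f y.
Proof.
move=> /andP[xz zy] df; apply: contraTT; rewrite -!leNgt => yx.
have cst t : x <= t <= y -> f t = f x.
  move=> /andP[xt ty]; apply/eqP; rewrite eq_le; apply/andP; split.
    apply: le_trans yx; apply: derive1_ge0_le => // s /andP[ts sy].
    by apply: df; rewrite (le_trans xt ts).
  by apply: derive1_ge0_le => // s /andP[ts sy]; apply: df; rewrite ts (le_trans sy).
rewrite derive1E (near_eq_derive (1 : R) (g := fun _ => f x)).
  by rewrite -derive1E derive1_cst.
have : z \in `]x, y[%R by rewrite in_itv /= xz zy.
by move/near_in_itvoo; apply: filterS => t; rewrite in_itv /= => /andP[/ltW h1 /ltW h2];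
  rewrite cst// h1.
Qed.

End Monotone.

Section Variation.
Variable R : realType.
Local Notation C := (complex R).
Variables (a b : \bar R) (Gam N : R -> V3 R).
Local Notation I := (oitv a b).
Hypotheses (legN : legendrian_lift I N) (nN : normalized_lift I N N)
  (pN : forall t, I t -> proj_eq (N t) (Gam t)).

Let oI := @open_oitv R a b.

(** The bump lives within distance rho of [t1], the gluing takes place at distance 2 rho, and the
    sign, nonvanishing and chart conditions hold up to 3 rho. The integrated density is then a
    positive function times the stress and a nonnegative height that is positive at [t1]. *)
Lemma nonstationary_variation t0 : I t0 -> stress N t0 != 0 -> exists G eps,
  admissible_variation I Gam G eps /\ derive1 (strain_functional I G) 0 != 0.
Proof.
move=> It0 st0; have [t1 [r [r0 H]]] := regular_interval legN nN It0 st0.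
pose rho := r / 3; have rho0 : 0 < rho by rewrite /rho; lra.
have r3 : r = 3 * rho by rewrite /rho; field.
clearbody rho; subst r.
pose I' := oitv (t1 - 3 * rho)%:E (t1 + 3 * rho)%:E.
have oI' : open I' := @open_oitv R _ _.
have I'E t : I' t <-> `|t - t1| < 3 * rho.
  by rewrite /I' /oitv /= !lte_fin ltr_distl; split=> [[-> ->]//|/andP[]].
have HI' t : I' t -> [/\ I t, 0 < stress N t1 * stress N t, fub_a N t != 0 & c1 (N t) != 0].
  by move=> /I'E /ltW /H.
have I'I t : I' t -> I t by move=> /HI' [].
have I'1 : I' t1 by apply/I'E; rewrite subrr normr0; lra.
have [B [h [sB B1 B0 h1 [BN cB]]]] := @local_deformation R _ _ N (legendrian_lift_sub I'I legN)
  (normalized_lift_sub I'I nN) t1 rho rho0 I'1 (fun t It => let: And4 _ _ _ z := HI' t It in z).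
(* [B] and [N] agree for rho < |t - t1| < 3 rho, and 2 rho is the middle of this overlap. So the
   glued family is [B] on one open set and [N] on another, and the two sets cover the interval. *)
pose G t s := if `|t - t1| < 2 * rho then B t s else N t.
have GB t s : I' t -> G t s = B t s.
  by move=> It; rewrite /G; case: ltP => // tr; rewrite BN//; left; lra.
have GN t s : rho < `|t - t1| -> G t s = N t.
  by move=> tr; rewrite /G; case: ltP => // t2; rewrite BN//; [apply/I'E; lra|left].
have G0 : (fun t => G t 0) = N.
  apply/funext => t; rewrite /G; case: ltP => // t2; rewrite BN//; last by right.
  by apply/I'E; lra.
have oF : open [set t : R | rho < `|t - t1|].
  have -> : [set t : R | rho < `|t - t1|] = (fun t => `|t - t1|) @^-1` [set x | rho < x] by [].
  apply: open_comp; last exact: open_gt.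
  move=> t _; apply: (@continuous_comp _ _ _ (fun t : R => t - t1) (fun x => `|x|)).
    by apply: continuousB; [exact: cvg_id|exact: cst_continuous].
  exact: norm_continuous.
have cover t : I' t /\ `|t - t1| <= 2 * rho \/ rho < `|t - t1|.
  case: (leP `|t - t1| (2 * rho)) => h2; [left; split=> //; apply/I'E; lra|right; lra].
have nI' t : I' t -> \forall s \near t, I' s by move=> It; exact: open_nbhs_nbhs (conj oI' It).
have nF t : rho < `|t - t1| -> \forall s \near t, rho < `|s - t1|.
  by move=> It; exact: open_nbhs_nbhs (conj oF It).
have I'cd t : t1 - 2 * rho <= t <= t1 + 2 * rho -> I' t /\ `|t - t1| <= 2 * rho.
  by rewrite -ler_distl => h2; split=> //; apply/I'E; lra.
have dB0 t : I' t -> dV (B^~ 0) t = dV N t.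
  by move=> It; apply: dV_near; apply: filterS (nI' _ It) => s Is; rewrite BN//; right.
(* At parameter 0 the norm of the derivative is 1, and by compactness it stays nonzero for small
   parameters. This gives immersivity, since a derivative in the line of the lift would be null. *)
have [eps eps0 Heps] : exists2 eps : R, 0 < eps & forall t s, t1 - 2 * rho <= t <= t1 + 2 * rho ->
    `|s| < eps -> Re (herm (dV (B^~ s) t) (dV (B^~ s) t)) != 0.
  apply: (@tube R _ _ (fun p => Re (herm (dV (B^~ p.2) p.1) (dV (B^~ p.2) p.1)) != 0)) => t.
  move=> /I'cd [It _]; have c := cB t 0 It.
  apply: (cvgr_neq0 (Re (herm (dV (B^~ 0) t) (dV (B^~ 0) t)))) c _.
  by rewrite dB0//; have [_ _ ->] := normalized_herm legN nN (I'I t It); exact: oner_neq0.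
have oJ := @open_norm_lt R eps.
have sG : smoothV2 G [set p | I p.1 /\ `|p.2| < eps].
  move=> k k6 ds p [Ip _]; have [[I'p _]|Fp] := cover p.1.
  - have oU : open (I' `*` (setT : set R)) := open_setX oI' (@openT R).
    have s1 : sm2 (I' `*` (setT : set R)) (fun t s => Defs.coord k (G t s)).
      apply: smooth2_eqon (Sm2 (sB k k6)) => // -[t s] [/= It _]; by rewrite GB.
    exact: (smooth2E ds s1).
  - have oU : open ((I `&` [set t : R | rho < `|t - t1|]) `*` (setT : set R)) := open_setX (openI oI oF) (@openT R).
    have s1 : sm2 ((I `&` [set t : R | rho < `|t - t1|]) `*` (setT : set R)) (fun t s => Defs.coord k (G t s)).
      have sN : sm1 I (fun t => Defs.coord k (N t)) := Sm1 (proj1 legN k k6).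
      have UI (p0 : R * R) : ((I `&` [set t : R | rho < `|t - t1|]) `*` (setT : set R)) p0 -> I p0.1 by case=> -[].
      apply: smooth2_eqon (smooth2_lift oU UI sN) => // -[t s] [/= [It Ft] _]; by rewrite GN.
    exact: (smooth2E ds s1).
have legG tau : `|tau| < eps -> legendrian_lift I (fun t => G t tau).
  move=> te; split.
    move=> k k6; apply: sm1P.
    have := @smooth2_slice _ _ _ tau (Sm2 (sG k k6)); apply: sm1_sub => t It; by split.
  move=> t It; have [[I't t2]|Ft] := cover t.
  - have dG : dV (fun t => G t tau) t = dV (B^~ tau) t.
      by apply: dV_near; apply: filterS (nI' _ I't) => s Is; exact: GB.
    rewrite dG GB//; have [b1 b2 b3] := B1 t tau I't; split=> //.
    + by move=> e; have [_ _ _] := HI' t I't; rewrite -b1 e /c1 /= eqxx.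
    + rewrite ler_distl in t2.
      move=> [l lE]; have := Heps t tau t2 te; rewrite lE herm_scale b2 mulr0.
      by rewrite eqxx.
  - have dG : dV (fun t => G t tau) t = dV N t.
      by apply: dV_near; apply: filterS (nF _ Ft) => s Fs; exact: GN.
    by rewrite dG GN//; have [_ /(_ t It)] := legN.
have Ksub : var_support I G `<=` `[t1 - rho, t1 + rho].
  have cl : closed `[t1 - rho, t1 + rho] by exact: itv_closed.
  rewrite [X in _ `<=` X](closure_id _).1//; apply: closure_subset => t [It nl].
  rewrite /= in_itv /= -ler_distl leNgt; apply/negP => Ft; apply: nl.
  exists 0; rewrite /dtauV.
  have -> : (fun s => G t s) = (fun _ => N t) by apply/funext => s; exact: GN.
  by rewrite /dV /dC !derive1_cst /scaleV3 !mul0r.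
have cK : compact (var_support I G).
  exact: (subclosed_compact (@closed_closure _ _) (@segment_compact _ _ _) Ksub).
have Kr t : var_support I G t -> `|t - t1| <= rho.
  by move=> /Ksub; rewrite /= in_itv /= -ler_distl.
have nG0 : normalized_lift I (fun t => G t 0) N by rewrite G0.
have [P [dP dS eS]] : exists P : R -> R,
  [/\ forall t, t1 - 3 * rho < t < t1 + 3 * rho -> derivable P t 1 /\ derive1 P t = EL_density G N t,
      derivable (strain_functional I G) 0 1 &
      derive1 (strain_functional I G) 0 = (P (t1 + 2 * rho) - P (t1 - 2 * rho)) / 18].
  apply: (strain_functional_derivative eps0 sG legG nG0) => //; try lra.
  - by move=> t; rewrite -ler_distl => /H [].
  - by move=> t /Kr tr; rewrite -ltr_distl; lra.
  - by move=> t; rewrite -ler_distl => /H [].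
exists G, eps; split.
  split=> //; split=> //; split.
    by move=> t It; rewrite -[G t 0]/((fun t => G t 0) t) G0; exact: pN.
  split=> //; split=> //; split=> // t /Kr tr; apply: I'I; apply/I'E; lra.
rewrite eS mulf_neq0 ?invr_eq0 ?pnatr_eq0// subr_eq0.
have fh t : I' t -> field_height G t = h t.
  move=> It; rewrite /field_height G0; have [_ _ ->] := normalized_herm legN nN (I'I t It).
  rewrite divr1 GB// /dtauV; have -> : (fun s => G t s) = B t by apply/funext => s; exact: GB.
  by have [_ ->] := B0 t It.
(* Multiplication by the constant stress at [t1], which has the sign of the stress on the whole
   interval, treats both signs at once. *)
have dQ t : I' t -> derivable (fun t => stress N t1 * P t) t 1 /\
    derive1 (fun t => stress N t1 * P t) t = stress N t1 * EL_density G N t.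
  move=> /I'E; rewrite ltr_distl => /dP [d1 e1].
  have dk : derivable (fun _ : R => (stress N t1 : R)) t 1 by exact: derivable_cst.
  split; first exact: (derivableM dk d1).
  by rewrite derive1E (deriveM dk d1) -!derive1E derive1_cst scaler0 addr0 e1.
have sE t : I' t -> exists2 k : R, 0 < k & stress N t1 * EL_density G N t = k * h t.
  move=> It; have [_ s1 a0 _] := HI' t It.
  exists (2 * `|fub_a N t| `^ 3^-1 / fub_a N t ^+ 6 * (stress N t1 * stress N t)).
    rewrite mulr_gt0// mulr_gt0 ?invr_gt0 ?exprn_even_gt0 ?a0// mulr_gt0// powR_gt0 ?normr_gt0//.
  rewrite /EL_density (fh t It); move: (stress N t) (stress N t1) (h t) (fub_a N t ^+ 6) (_ `^ _).
  by move=> *; ring.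
have lt : stress N t1 * P (t1 - 2 * rho) < stress N t1 * P (t1 + 2 * rho).
  apply: (@derive1_gt0_lt _ (fun t => stress N t1 * P t) _ _ t1).
  - by apply/andP; split; lra.
  - move=> t /I'cd [It _]; have [d1 ->] := dQ t It; split=> //.
    by have [k k0 ->] := sE t It; rewrite mulr_ge0 ?(ltW k0)//; have [] := B0 t It.
  - have [_ ->] := dQ t1 I'1; have [k k0 ->] := sE t1 I'1; by rewrite mulr_gt0.
by apply: contraTneq lt => ->; rewrite ltxx.
Qed.

Lemma critical_stress : strain_critical I Gam -> forall t, I t -> stress N t = 0.
Proof.
move=> crit t It; apply/eqP; apply/negPn/negP => /(nonstationary_variation It) [G [eps [adm]]].
by rewrite (crit _ _ adm) eqxx.
Qed.

End Variation.

(** * The dichotomy *)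

Section Riccati.
Variable R : realType.
Implicit Types (f m : R -> R).

(* m is bounded above by some M near c, so that f^2 exp(- 6 M t) is nonincreasing there. *)
Lemma riccati_left f m (c d K : R) : c < d -> {for c, continuous f} ->
  (forall t, c < t < d -> [/\ derivable f t 1, derive1 f t = 3 * m t * f t, derivable m t 1,
     - K <= derive1 m t & f t != 0]) -> f c != 0.
Proof.
move=> cd cf H; pose e := (c + d) / 2.
have ce : c < e by rewrite /e; lra.
have ed : e < d by rewrite /e; lra.
clearbody e.
pose M := m e + `|K| * (d - c).
have mM t : c < t <= e -> m t <= M.
  move=> /andP[ct te]; have le : m t + K * t <= m e + K * e.
    apply: (@derive1_ge0_le _ (fun t => m t + K * t)) => // s /andP[ts se].
    have [|_ _ dm Km _] := H s; first by rewrite (lt_le_trans ct ts) (le_lt_trans se).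
    have dk : derivable (fun _ : R => (K : R)) s 1 by exact: derivable_cst.
    have di : derivable (@id R) s 1 by exact: derivable_id.
    have dK := derivableM dk di.
    split; first exact: (derivableD dm dK).
    rewrite derive1E (deriveD dm dK) (deriveM dk di) -!derive1E derive1_cst derive1_id.
    by rewrite scaler0 addr0 /GRing.scale /= mulr1 -lerBlDr sub0r.
  have : K * (e - t) <= `|K| * (d - c).
    apply: le_trans (_ : `|K| * (e - t) <= _).
      by rewrite ler_wpM2r ?ler_norm// subr_ge0.
    by rewrite ler_wpM2l//; lra.
  rewrite /M; lra.
pose F t := f t ^+ 2 * expR (- (6 * M) * t).
have dE t : derivable (fun t : R => expR (- (6 * M) * t)) t 1 /\
    derive1 (fun t : R => expR (- (6 * M) * t)) t = - (6 * M) * expR (- (6 * M) * t).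
  have dk : derivable (fun _ : R => (- (6 * M) : R)) t 1 by exact: derivable_cst.
  have di : derivable (@id R) t 1 by exact: derivable_id.
  have dK := derivableM dk di; split.
    exact: (derivable_comp1 dK (@derivable_expR R _)).
  rewrite (derive1_comp1 dK (@derivable_expR R _)) (derive1E expR) derive_val mulrC.
  by rewrite derive1E (deriveM dk di) -!derive1E derive1_cst derive1_id scaler0 addr0 /GRing.scale /= mulr1.
have F_le t : c < t <= e -> F e <= F t.
  move=> /andP[ct te]; rewrite -lerN2.
  apply: (@derive1_ge0_le _ (fun t => - F t)) => // s /andP[ts se].
  have [|df ef _ _ f0] := H s; first by rewrite (lt_le_trans ct ts) (le_lt_trans se).
  have [d1 e1] := dE s; have d2 := derivableM df df.
  have FE : F = (fun t => f t * f t * expR (- (6 * M) * t)) by apply/funext => x; rewrite /F expr2.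
  have dF : derivable F s 1 by rewrite FE; exact: (derivableM d2 d1).
  split; first exact: (derivableN dF).
  rewrite derive1E (deriveN dF) FE (deriveM d2 d1) (deriveM df df) -!derive1E e1 ef /GRing.scale /=.
  have -> : - (f s * f s * (- (6 * M) * expR (- (6 * M) * s)) +
      expR (- (6 * M) * s) * (f s * (3 * m s * f s) + f s * (3 * m s * f s))) =
      6 * (M - m s) * (f s ^+ 2) * expR (- (6 * M) * s) by ring.
  rewrite mulr_ge0 ?expR_ge0// mulr_ge0 ?sqr_ge0// mulr_ge0// subr_ge0 mM//.
  by rewrite (lt_le_trans ct ts).
have F0 : 0 < F e.
  have [|_ _ _ _ f0] := H e; first by rewrite ce.
  by rewrite /F mulr_gt0 ?expR_gt0// exprn_even_gt0.
have cF : {for c, continuous F}.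
  have cE : {for c, continuous (fun t : R => expR (- (6 * M) * t))}.
    by apply: differentiable_continuous; apply/derivable1_diffP; have [] := dE c.
  have cf2 : {for c, continuous (fun t => f t ^+ 2)}.
    rewrite (_ : (fun t => _) = (fun t => f t * f t)); last by apply/funext => t; rewrite expr2.
    exact: (cvgM cf cf).
  exact: (cvgM cf2 cE).
apply/eqP => fc0.
have Fc : F c = 0 by rewrite /F fc0 expr0n /= mul0r.
have : \forall t \near c, F t < F e by apply: (cvgr_lt (F c)) cF _ _; rewrite Fc.
move=> /nbhs_ballP[r /= r0 Hr].
pose s := Num.min r (e - c); have s0 : 0 < s by rewrite lt_min r0 subr_gt0.
have sr : s <= r by rewrite ge_min lexx.
have se : s <= e - c by rewrite ge_min lexx orbT.
have /Hr : ball c r (c + s / 2).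
  by rewrite /ball /= opprD addrA subrr add0r normrN gtr0_norm; lra.
by rewrite ltNge F_le//; apply/andP; split; lra.
Qed.

(** The reflection t -> -t replaces m by -m(-t), whose derivative is m'(-t), so the lower bound on
    m' survives and [riccati_left] applies. *)
Lemma riccati_right f m (c d K : R) : c < d -> {for d, continuous f} ->
  (forall t, c < t < d -> [/\ derivable f t 1, derive1 f t = 3 * m t * f t, derivable m t 1,
     - K <= derive1 m t & f t != 0]) -> f d != 0.
Proof.
move=> cd cf H; rewrite -[d]opprK.
have dN (t : R) : derivable (fun t : R => - t) t 1 /\ derive1 (fun t : R => - t) t = -1.
  have di : derivable (@id R) t 1 by exact: derivable_id.
  by split; [exact: (derivableN di)|rewrite derive1E (deriveN di) -derive1E derive1_id].
apply: (@riccati_left (fun t => f (- t)) (fun t => - m (- t)) _ (- c) K).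
- by rewrite ltrN2.
- apply: (@continuous_comp _ _ _ (fun t : R => - t) f); last by rewrite opprK.
  by apply: differentiable_continuous; apply/derivable1_diffP; have [] := dN (- d).
- move=> t; rewrite ltrNl ltrNr => /andP[h1 h2].
  have [|df ef dm em f0] := H (- t); first by rewrite h1 h2.
  have [d1 e1] := dN t; have dm' := derivable_comp1 d1 dm.
  split; [|  | |  |exact: f0].
  + exact: (derivable_comp1 d1 df).
  + by rewrite (derive1_comp1 d1 df) e1 ef; ring.
  + exact: (derivableN dm').
  + by rewrite derive1E (deriveN dm') -derive1E (derive1_comp1 d1 dm) e1 mulrN1 opprK.
Qed.

Lemma last_zero f (x y : R) : x <= y -> (forall t, x <= t <= y -> {for t, continuous f}) ->
  f x = 0 -> f y != 0 ->
  exists c, [/\ x <= c < y, f c = 0 & forall t, c < t <= y -> f t != 0].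
Proof.
move=> xy cf fx fy; pose Z := `[x, y] `&` [set t | f t = 0].
have cZ : closed Z.
  rewrite closedE => t nZ; have tx : `[x, y]%classic t.
    apply: contrapT => nt; apply: nZ.
    have o : open (~` `[x, y]%classic) by apply: closed_openC; exact: itv_closed.
    by apply: filterS (open_nbhs_nbhs (conj o nt)) => s ns [].
  split=> //=; apply/eqP/negPn/negP => ft; apply: nZ.
  have c : {for t, continuous f} by apply: cf; move: tx; rewrite /= in_itv.
  have : \forall s \near t, f s != 0 by apply: (cvgr_neq0 (f t)) c _.
  by apply: filterS => s fs [_ /= fs0]; rewrite fs0 eqxx in fs.
have kZ : compact Z.
  by apply: (subclosed_compact cZ (@segment_compact _ x y)) => t [].
have [||c] := @compact_EVT_max _ R id Z _ kZ.
- by exists x; split=> //=; rewrite in_itv /= lexx.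
- by apply: continuous_subspaceT => t; exact: cvg_id.
rewrite inE => -[/=]; rewrite in_itv /= => /andP[xc cy] fc Hc; exists c; split=> //.
  rewrite xc lt_neqAle cy andbT; apply/eqP => e; by rewrite -e fc eqxx in fy.
move=> t /andP[ct ty]; apply/eqP => ft.
have : t <= c by apply: Hc; rewrite inE; split=> //=; rewrite in_itv /= ty andbT (le_trans xc)// ltW.
by rewrite leNgt ct.
Qed.

Lemma first_zero f (x y : R) : x <= y -> (forall t, x <= t <= y -> {for t, continuous f}) ->
  f x != 0 -> f y = 0 ->
  exists c, [/\ x < c <= y, f c = 0 & forall t, x <= t < c -> f t != 0].
Proof.
move=> xy cf fx fy.
have [||| |c [/andP[h1 h2] fc Hc]] := @last_zero (fun t => f (- t)) (- y) (- x).
- by rewrite lerN2.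
- move=> t; rewrite lerNl lerNr => /andP[h1 h2].
  apply: (@continuous_comp _ _ _ (fun t : R => - t) f).
    by apply: continuousN; exact: cvg_id.
  by apply: cf; rewrite h1 h2.
- by rewrite opprK.
- by rewrite opprK.
exists (- c); split=> //.
  by rewrite ltrNr h2 lerNl h1.
move=> t /andP[h3 h4]; rewrite -[t]opprK; apply: Hc.
by rewrite ltrNr h4 lerN2 h3.
Qed.

(** Between a zero and a point where [f] does not vanish there is a zero at the end of an interval
    free of zeros; on this interval [riccati_left] or [riccati_right] yields a contradiction. *)
Lemma riccati_dichotomy f (a b : \bar R) : (forall t, oitv a b t -> {for t, continuous f}) ->
  (forall c d, c < d -> oitv a b c -> oitv a b d -> (forall t, c < t < d -> f t != 0) ->
     exists m K, forall t, c < t < d -> [/\ derivable f t 1, derive1 f t = 3 * m t * f t,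
       derivable m t 1 & - K <= derive1 m t]) ->
  (forall t, oitv a b t -> f t = 0) \/ (forall t, oitv a b t -> f t != 0).
Proof.
move=> cf H; apply: contrapT => /not_orP[/existsNP[y /not_implyP[Iy /eqP fy]]
  /existsNP[x /not_implyP[Ix /negP/negPn/eqP fx]]].
have K c d : c < d -> oitv a b c -> oitv a b d -> (forall t, c < t < d -> f t != 0) ->
    f c != 0 /\ f d != 0.
  move=> cd Ic Id f0; have [m [k Hm]] := H c d cd Ic Id f0.
  have Hm' t : c < t < d -> [/\ derivable f t 1, derive1 f t = 3 * m t * f t, derivable m t 1,
     - k <= derive1 m t & f t != 0].
    by move=> tcd; have [h1 h2 h3 h4] := Hm t tcd; split; [exact: h1|exact: h2|exact: h3|exact: h4|exact: f0].
  by split; [exact: (riccati_left cd (cf c Ic) Hm')|exact: (riccati_right cd (cf d Id) Hm')].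
have cI u v t : oitv a b u -> oitv a b v -> u <= t <= v -> {for t, continuous f}.
  by move=> Iu Iv tuv; apply: cf; exact: (oitv_between Iu Iv).
have [xy|xy] := leP x y.
- have [c [/andP[xc cy] fc Hc]] := last_zero xy (fun t => cI x y t Ix Iy) fx fy.
  have Ic : oitv a b c by apply: (oitv_between Ix Iy); rewrite xc ltW.
  have [|+ _] := K c y cy Ic Iy; last by rewrite fc eqxx.
  by move=> t /andP[ct /ltW ty]; apply: Hc; rewrite ct.
- have [c [/andP[yc cx] fc Hc]] := first_zero (ltW xy) (fun t => cI y x t Iy Ix) fy fx.
  have Ic : oitv a b c by apply: (oitv_between Iy Ix); rewrite cx ltW.
  have [|_] := K y c yc Iy Ic; last by rewrite fc eqxx.
  by move=> t /andP[/ltW yt tc]; apply: Hc; rewrite yt.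
Qed.

End Riccati.

(** * First integrals of the equation for B *)

Section FirstIntegrals.
Variable A : diffRing.
Variables (m b w s : A).
Hypotheses (dw : dt w = - 1 * m * w) (ws : w * s = 1) (EL0 : EL m b = 0).
Let B := w ^+ 2 * (b - 2 * dt m + m ^+ 2).
Let C1 := w * dt B.
Let C2 := w * dt C1.
Let k := 2 * C2 + 4 * B * B.

Lemma first_integral1 : dt k = 0.
Proof.
have h : 2 * w * dt C2 + 8 * B * (w * dt B) = 0.
  by transitivity (w ^+ 5 * EL m b); [exact: EL_natural|rewrite EL0 mulr0].
rewrite /k; move: C2 B h => c2 x h.
rewrite dtD !dtM !dtn.
transitivity (s * (2 * w * dt c2 + 8 * x * (w * dt x)) - (w * s - 1) * (2 * dt c2 + 8 * x * dt x)); first by ring.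
by rewrite h ws subrr mul0r mulr0 subr0.
Qed.

(** From w C1' = C2 and w B' = C1 follows C1 C1' = C2 B', so the derivative is 3 B' (2 C2 + 4 B^2 -
    k) = 0. *)
Lemma first_integral2 : dt (3 * C1 * C1 + 4 * B * B * B - 3 * k * B) = 0.
Proof.
have dk := first_integral1.
have e1 : w * dt C1 = C2 by [].
have e2 : w * dt B = C1 by [].
have e3 : 2 * C2 + 4 * B * B = k by [].
move: k C2 C1 B dk e1 e2 e3 => k0 c2 c1 x dk e1 e2 e3.
have e4 : c1 * dt c1 = c2 * dt x by rewrite -e1 -[X in X * _ = _]e2; ring.
rewrite dtB dtD !dtM !dtn dk.
transitivity (6 * (c1 * dt c1) + 12 * x * x * dt x - 3 * k0 * dt x); first by ring.
by rewrite e4 -e3; ring.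
Qed.

End FirstIntegrals.

Section Dichotomy.
Variable R : realType.
Local Notation C := (complex R).

(** Beyond the bound, 3kx <= |3k| x <= x^2 <= x^3, so the left side is at least 3 x^3, which exceeds
    e. *)
Lemma cubic_bounded (c1 k e x : R) : 3 * c1 ^+ 2 + 4 * x ^+ 3 - 3 * k * x = e ->
  x <= 1 + `|3 * k| + `|e|.
Proof.
move=> h; rewrite leNgt; apply/negP => xb.
have X0 := normr_ge0 (3 * k); have Y0 := normr_ge0 e.
have kX := ler_norm (3 * k); have eY := ler_norm e.
move: (`|3 * k|) (`|e|) X0 Y0 kX eY xb => X Y X0 Y0 kX eY xb.
have x1 : 1 < x by lra.
have x2 : 0 < x ^+ 2 by rewrite exprn_gt0; lra.
have h1 : X * x <= x ^+ 2 by rewrite [leRHS]expr2 ler_wpM2r; lra.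
have h2 : 3 * k * x <= X * x by rewrite ler_wpM2r; lra.
have h3 : x ^+ 2 <= x ^+ 3 by rewrite [leRHS]exprSr ler_peMr; lra.
have h4 : x <= x ^+ 2 by rewrite [leRHS]expr2 ler_peMr; lra.
have h5 := sqr_ge0 c1.
lra.
Qed.

Lemma bounded_on (f : R -> R) (c d : R) : c <= d ->
  (forall t, c <= t <= d -> {for t, continuous f}) -> exists M : R, forall t, c <= t <= d -> `|f t| <= M.
Proof.
move=> cd cf.
have [|u _ Hu] := @EVT_max _ (fun t => `|f t|) c d cd.
  apply: continuous_in_subspaceT => t; rewrite inE /= in_itv /= => /cf ct.
  exact: (continuous_comp ct (@norm_continuous _ _ _)).
by exists `|f u| => t tcd; apply: Hu; rewrite in_itv.
Qed.

Variables (a b : \bar R) (N : R -> V3 R).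
Local Notation I := (oitv a b).
Hypotheses (legN : legendrian_lift I N) (nN : normalized_lift I N N)
  (st0 : forall t, I t -> stress N t = 0).

(** Although a may vanish at [c] and [d], these points lie in the domain, so a and b are bounded
    between them. The first integrals are constant on the open interval and are evaluated at its
    midpoint; by [cubic_bounded] they bound B from above, uniformly up to the ends. *)
Lemma stress_riccati c d : c < d -> I c -> I d -> (forall t, c < t < d -> fub_a N t != 0) ->
  exists m K, forall t, c < t < d -> [/\ derivable (fub_a N) t 1,
    derive1 (fub_a N) t = 3 * m t * fub_a N t, derivable m t 1 & - K <= derive1 m t].
Proof.
move=> cd Ic Id a0.
have [sa sb] := normalized_fub_smooth legN nN.
have cdI t : c <= t <= d -> I t by exact: oitv_between.
have [Ma HMa] := bounded_on (ltW cd) (fun t tcd => smooth1_continuous sa (cdI t tcd)).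
have [Mb HMb] := bounded_on (ltW cd) (fun t tcd => smooth1_continuous sb (cdI t tcd)).
pose I' := oitv c%:E d%:E.
have oI' : open I' := @open_oitv R _ _.
have I'E t : I' t <-> c < t < d.
  by rewrite /I' /oitv /= !lte_fin; split=> [[-> ->]|/andP[]].
have I'I t : I' t -> I t by move=> /I'E /andP[/ltW h1 /ltW h2]; apply: cdI; rewrite h1.
have lN := legendrian_lift_sub I'I legN; have nN' := normalized_lift_sub I'I nN.
have [S] := smoothRing_exists (rect (@open_oitv R c%:E d%:E) (@openT R)).
have [g gG] := constant_family S (proj1 lN).
have lG := constant_legendrian lN.
have [qi qqi] := leg_qi gG lG.
set al := alpha g qi; set be := frame_b qi g.
have UP t s : I' t -> oset (rect (@open_oitv R c%:E d%:E) (@openT R)) (t, s) by [].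
have nv s := normalized_values gG lG qqi (Logic.I : (setT : set R) s) nN'.
have alE t s : I' t -> ev al t s = Complex 0 (2 * fub_a N t) by move=> It; have [] := nv s t It.
have beE t s : I' t -> ev be t s = Complex (2 * fub_b N t) 0 by move=> It; have [] := nv s t It.
have [ai [s [ala s6 sE]]] : exists ai s : S, [/\ al * ai = 1, s ^+ 6 * - 4 = al * al &
    forall p, oset (rect (@open_oitv R c%:E d%:E) (@openT R)) p -> ev s p.1 p.2 = Complex (`|Im (ev al p.1 p.2) / 2| `^ (3^-1)) 0].
  apply: strain_elements => -[t r] [/= It _]; rewrite -/al (alE t r It) /=.
  by rewrite mulf_neq0 ?pnatr_eq0// a0//; exact/I'E.
set m := strain_m al ai.
have sE' t r : I' t -> ev s t r = Complex (`|fub_a N t| `^ (3^-1)) 0.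
  move=> It; rewrite (sE (t, r) (UP t r It)) /= alE//=; congr (Complex (`|_| `^ _) _); by field.
have [w ws] : exists w : S, s * w = 1.
  apply: inv_el => -[t r] [/= It _]; rewrite sE'//= powR_gt0// normr_gt0 a0//; exact/I'E.
have ds_ : dt s = m * s := strain_dt ala s6.
have dw : dt w = - 1 * m * w.
  rewrite (dt_inv ws) ds_; transitivity (- (m * w * (s * w))); first by ring.
  by rewrite ws; ring.
have EL0 : EL m be = 0.
  apply: ev_ext => -[t r] Up; rewrite (ev0 _ Up) /=.
  have h := stress_EL gG lG qqi (Logic.I : (setT : set R) r) nN' ala (proj1 Up).
  rewrite -/al -/be -/m in h; rewrite h st0; last by apply: I'I; have [] := Up.
  by rewrite mulr0 mul0r.
rewrite mulrC in ws.
have i1 := first_integral1 dw ws EL0; have i2 := first_integral2 dw ws EL0.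
have cm : cj m = m := cj_m ala.
have cbe : cj be = be by apply/real_cj => -[t r] [/= It _]; rewrite beE.
have cs : cj s = s by apply/real_cj => -[t r] [/= It _]; rewrite sE'.
have cw : cj w = w by rewrite mulrC in ws; exact: cj_inv ws cs.
set B := w ^+ 2 * (be - 2 * dt m + m ^+ 2) in i1 i2.
have cB : cj B = B by rewrite /B cjM expr2 cjM cw cjD cjB cjM cj_dt cjn expr2 cjM cm cbe.
have BE : be - 2 * dt m + m ^+ 2 = s * s * B.
  rewrite /B; transitivity ((w * s) ^+ 2 * (be - 2 * dt m + m ^+ 2)); last by ring.
  by rewrite ws expr1n mul1r.
have [B0 BB] : exists B0, B0 = B by exists B.
rewrite -BB in i1 i2 cB BE.
have [C1 [k [dk de cC1]]] : exists C1 k : S, [/\ dt k = 0,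
    dt (3 * C1 * C1 + 4 * B0 * B0 * B0 - 3 * k * B0) = 0 & cj C1 = C1].
  eexists; eexists; split; [exact: i1|exact: i2|].
  by rewrite cjM cw cj_dt cB.
clear i1 i2; clearbody B.
pose e := 3 * C1 * C1 + 4 * B0 * B0 * B0 - 3 * k * B0.
pose u := (c + d) / 2.
have I'u : I' u by apply/I'E; rewrite /u; apply/andP; split; lra.
have real (x : S) t : cj x = x -> I' t -> ev x t 0 = Complex (Re (ev x t 0)) 0.
  by move=> cx It; apply: complexP => //=; have /real_cj /(_ _ (UP t 0 It)) := cx.
pose mu t := Re (ev m t 0).
pose M := 1 + `|3 * Re (ev k u 0)| + `|Re (ev e u 0)|.
have M0 : 0 < M by rewrite /M ltr_wpDr// ltr_wpDr.
have xM t : I' t -> Re (ev B0 t 0) <= M.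
  move=> It; have U := UP t 0 It; apply: (@cubic_bounded (Re (ev C1 t 0))).
  rewrite -(dt0_constant (Logic.I : (setT : set R) 0) dk It I'u).
  rewrite -(dt0_constant (Logic.I : (setT : set R) 0) de It I'u).
  rewrite /e (evD _ _ U) (evN _ U) !(evM _ _ U) (evD _ _ U) !(evM _ _ U) !(evn _ _ U) /=.
  rewrite (real B0 t cB It) (real C1 t cC1 It); case: (ev k t 0) => k1 k2.
  have -> : (3 : C) = Complex 3 0 by rewrite -(rmorph_nat (real_complex R)).
  have -> : (4 : C) = Complex 4 0 by rewrite -(rmorph_nat (real_complex R)).
  by rewrite /=; ring.
have sm : sm1 I' mu.
  have [m1 _] := ev_smooth m; have := @smooth2_slice _ _ _ 0 m1.
  by apply: sm1_sub => t It; split.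
(* The identity 2b - 2m' + m^2 = |a|^(2/3) B with |a| <= Ma, |b| <= Mb and B <= M gives -2m' <=
   Ma^(2/3) M + 2 Mb. *)
exists mu, (((Ma `^ (3^-1)) ^+ 2 * M + 2 * Mb) / 2) => t tcd.
have It : I' t by exact/I'E. have U := UP t 0 It.
split.
- exact: smooth1_derivable sa (I'I _ It).
- have h := @ev_dtk_im _ _ _ _ _ S 0 (Logic.I : (setT : set R) 0) al (fun t => 2 * fub_a N t) (fun t It => alE t 0 It) 1%N t It.
  rewrite (derive1n_scale _ _ (sm1_sub I'I sa) It) in h.
  have dal : dt al = 3 * m * al := strain_dal ala.
  have : Im (ev (dt al) t 0) = 2 * derive1 (fub_a N) t by have := congr1 (@complex.Im R) h.
  rewrite dal (evM (3 * m) al U) (evM 3 m U) (evn _ _ U) /= (alE t 0 It) (real m t cm It).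
  have -> : (3 : C) = Complex 3 0 by rewrite -(rmorph_nat (real_complex R)).
  rewrite /= -/(mu t); move: (mu t) (fub_a N t) (derive1 _ t) => x y z h'.
  by apply: (@mulfI _ 2); rewrite ?pnatr_eq0// -h'; ring.
- exact: smooth1_derivable sm It.
- have E : 2 * fub_b N t - 2 * derive1 mu t + mu t ^+ 2 = (`|fub_a N t| `^ (3^-1)) ^+ 2 * Re (ev B0 t 0).
    have := congr1 (fun x => Re (ev x t 0)) BE.
    rewrite (evD (be - 2 * dt m) (m ^+ 2) U) (evD be (- (2 * dt m)) U) (evN (2 * dt m) U) (evM 2 (dt m) U).
    rewrite (evX m 2 U) (evM (s * s) B0 U) (evM s s U) (evn _ _ U) /= (sE' t 0 It) (beE t 0 It).
    rewrite (real B0 t cB It) (ev_dt _ U) (real m t cm It) /= -/(mu t).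
    rewrite -/mu; move: (derive1 mu t) (derive1 _ t) (_ `^ _) (mu t) (fub_b N t) (Re _) => *.
    by apply: etrans (etrans _ (_ : _ = _)) _; [|eassumption|]; ring.
  have tcd' : c <= t <= d by case/andP: tcd => /ltW -> /ltW ->.
  have hb := HMb t tcd'; rewrite ler_norml in hb; case/andP: hb => hb _.
  have sq : (`|fub_a N t| `^ (3^-1)) ^+ 2 <= (Ma `^ (3^-1)) ^+ 2.
    rewrite ler_sqr ?nnegrE ?powR_ge0//; apply: ge0_ler_powR; rewrite ?nnegrE//.
    - exact: le_trans (normr_ge0 _) (HMa t tcd').
    - exact: HMa.
  have h1 : (`|fub_a N t| `^ (3^-1)) ^+ 2 * Re (ev B0 t 0) <= (Ma `^ (3^-1)) ^+ 2 * M.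
    apply: le_trans (_ : (`|fub_a N t| `^ (3^-1)) ^+ 2 * M <= _).
      by rewrite ler_wpM2l ?sqr_ge0// xM.
    by rewrite ler_wpM2r// ltW.
  have arith (x y z p q r : R) : 2 * q - 2 * p + x = y -> y <= z -> 0 <= x -> - r <= q ->
      - ((z + 2 * r) / 2) <= p by move=> *; lra.
  exact: (arith _ _ _ _ _ _ E h1 (sqr_ge0 _) hb).
Qed.

Lemma cycle_or_generic : (forall t, I t -> fub_a N t = 0) \/ (forall t, I t -> fub_a N t != 0).
Proof.
have [sa _] := normalized_fub_smooth legN nN.
apply: riccati_dichotomy => [t It|c d cd Ic Id]; first exact: smooth1_continuous sa It.
exact: stress_riccati.
Qed.

End Dichotomy.

(** * The theorem *)

Section Sufficiency.
Variable R : realType.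

Lemma derive1_min (f : R -> R) x : derivable f x 1 -> (forall y, f x <= f y) -> derive1 f x = 0.
Proof.
move=> df fmin.
have /is_derive1_caratheodory[g [fg cg gx]] : is_derive x (1 : R) f (derive1 f x).
  by rewrite derive1E; exact/derivableP.
have near_x P : (\forall y \near x, P y) -> exists2 r : R, 0 < r & P (x - r) /\ P (x + r).
  move=> /nbhs_ballP[e /= e0 H]; exists (e / 2); first by lra.
  have x1 : x - (x - e / 2) = e / 2 by ring.
  have x2 : x - (x + e / 2) = - (e / 2) by ring.
  by split; apply: H; rewrite /ball /= ?x1 ?x2 ?normrN gtr0_norm; lra.
rewrite -gx; apply/eqP; rewrite eq_le; apply/andP; split; rewrite leNgt; apply/negP => g0.
- have [|r r0 [gr _]] := near_x (fun y => 0 < g y); first by apply: (cvgr_gt (g x)) cg _ _.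
  have := fmin (x - r); rewrite -subr_ge0 fg addrAC subrr add0r mulrN oppr_ge0 leNgt.
  by rewrite mulr_gt0.
- have [|r r0 [_ gr]] := near_x (fun y => g y < 0); first by apply: (cvgr_lt (g x)) cg _ _.
  have := fmin (x + r); rewrite -subr_ge0 fg addrAC subrr add0r leNgt.
  by rewrite nmulr_rlt0// r0.
Qed.

Lemma strain_density_ge0 (I : set R) (Gam : R -> V3 R) t : 0 <= strain_density I Gam t.
Proof. by rewrite /strain_density; case: pselect => [H|//]; exact: powR_ge0. Qed.

Lemma compact_in_interval (a b : \bar R) (K : set R) : compact K -> K `<=` oitv a b -> K !=set0 ->
  exists c' c d d' : R, [/\ c' < c, c < d, d < d', forall t, c' <= t <= d' -> oitv a b t &
    forall t, K t -> c < t < d].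
Proof.
move=> cK KI K0; have idc : {within K, continuous (@id R)}.
  by apply: continuous_subspaceT => t; exact: cvg_id.
have [x] := @compact_EVT_min _ R id K K0 cK idc; rewrite inE => Kx xmin.
have [y] := @compact_EVT_max _ R id K K0 cK idc; rewrite inE => Ky ymax.
have [e e0 He] := open_ball_sub (@open_oitv R a b) (KI _ Kx).
have [r r0 Hr] := open_ball_sub (@open_oitv R a b) (KI _ Ky).
have xy : x <= y by apply: xmin; rewrite inE.
exists (x - e), (x - e / 2), (y + r / 2), (y + r); split; try lra.
- move=> t tt; apply: (oitv_between _ _ tt).
  + by apply: He; rewrite addrAC subrr add0r normrN gtr0_norm.
  + by apply: Hr; rewrite addrAC subrr add0r gtr0_norm.
- move=> t Kt; have h1 : x <= t by apply: xmin; rewrite inE.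
  have h2 : t <= y by apply: ymax; rewrite inE.
  by apply/andP; split; lra.
Qed.

Variables (a b : \bar R) (Gam N : R -> V3 R).
Local Notation I := (oitv a b).
Hypotheses (legG : legendrian_lift I Gam) (nN : normalized_lift I Gam N)
  (st0 : forall t, I t -> stress N t = 0).

(** On a cycle the cube root in the strain is taken at its singular point, so the derivative is not
    computed: its existence belongs to the admissibility of the variation, and its value is 0
    because the functional is nonnegative and vanishes at parameter 0. In the generic case the
    primitive P of [EL_density] is constant. *)
Lemma stress_critical : strain_critical I Gam.
Proof.
move=> G eps [e0 [sG [pG [lG [[cK KI] dS]]]]].
have nG : normalized_lift I (fun t => G t 0) N.
  have [sN H] := nN; split=> // t It; have [p ->] := H t It; split=> //.
  exact: proj_eq_trans p (proj_eq_sym (pG t It)).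
have [cyc|gen] := cycle_or_generic (normalized_legendrian legG nN) (normalized_self nN) st0.
- apply: derive1_min => // tau.
  have -> : strain_functional I G 0 = 0.
    have [al [_ al0 alM]] := strain_density_values e0 sG lG nG.
    have [|M _ aM] := alM 0; first by rewrite normr0.
    rewrite /strain_functional (@eq_Rintegral _ _ _ _ _ (fun _ => 0)); first by rewrite /Rintegral integral0.
    move=> t.
    rewrite inE => /KI It; have [_ ->] := aM t It; rewrite al0// cyc// mulr0 mul0r normr0.
    by rewrite powR0// invr_eq0 pnatr_eq0.
  by apply: Rintegral_ge0 => t _; exact: strain_density_ge0.
- have [K0|/eqP/set0P K0] := pselect (var_support I G = set0).
    rewrite (_ : strain_functional I G = fun _ => 0) ?derive1_cst//.
    by apply/funext => tau; rewrite /strain_functional K0 Rintegral_set0.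
  have [c' [c [d [d' [cc cd dd cI Kcd]]]]] := compact_in_interval cK KI K0.
  have Na t : c' <= t <= d' -> fub_a N t != 0 by move=> /cI; exact: gen.
  have [P [dP _ ->]] := strain_functional_derivative e0 sG lG nG cc cd dd cI Kcd cK Na.
  have dP' t : oitv c'%:E d'%:E t -> derivable P t 1 /\ derive1 P t = 0.
    rewrite /oitv /= !lte_fin => -[h1 h2].
    have tt : c' < t < d' by rewrite h1.
    have [dPt ->] := dP t tt; split=> //.
    by rewrite /EL_density st0 ?mulr0 ?mul0r//; apply: cI; rewrite !ltW.
  have between (x y t : R) : oitv c'%:E d'%:E x -> oitv c'%:E d'%:E y -> x <= t <= y -> oitv c'%:E d'%:E t.
    exact: oitv_between.
  have -> : P d = P c; last by rewrite subrr mul0r.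
  apply: (@derive1_0_cst _ (oitv c'%:E d'%:E) P between).
  + by move=> t /dP' [].
  + by move=> t /dP' [].
  + by split; rewrite lte_fin; lra.
  + by split; rewrite lte_fin; lra.
Qed.

End Sufficiency.

Theorem theoremA (R : realType) (a b : \bar R) (Gam N : R -> V3 R) :
  (a < b)%E ->
  legendrian_lift (oitv a b) Gam ->
  normalized_lift (oitv a b) Gam N ->
  (strain_critical (oitv a b) Gam <-> (forall t, oitv a b t -> stress N t = 0)) /\
  ((forall t, oitv a b t -> stress N t = 0) ->
     (forall t, oitv a b t -> fub_a N t = 0) \/
     (forall t, oitv a b t -> fub_a N t != 0)).
Proof.
move=> _ legG nN; have legN := normalized_legendrian legG nN; have nNN := normalized_self nN.
split; last exact: cycle_or_generic legN nNN.
split; last exact: stress_critical legG nN.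
by apply: (critical_stress legN nNN) => t It; have [_ /(_ t It) []] := nN.
Qed.
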